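(* Let $f_0$ be an isolated plane curve singularity that is quasihomogeneous and of the form $$f_0(x,y)=x^p+\ldots+\gamma_{i,j}x^iy^j+\ldots+y^q,\qquad 2\le p\le q .$$ Then: 1. If $p=q$ (i.e. $f_0$ is a homogeneous singularity), then $$\lambda^{lin}(f_0)=\begin{cases}1,& p=2,\\ p-2,& p\ge 3.\end{cases}$$ 2. If $p\neq q$, then $$\lambda^{lin}(f_0)=\begin{cases}p-1,& p\mid q,\\ \mathrm{GCD}(p,q),& p\nmid q.\end{cases}$$
   Context: An (isolated plane curve) singularity is a holomorphic germ $f_0:(\mathbb{C}^2,0)\to(\mathbb{C},0)$ with an isolated critical point at $0$. For a germ $f$ at $0$, $\mu(f)=\dim_{\mathbb{C}}\mathcal{O}_2/(\partial f/\partial x,\partial f/\partial y)$ is the Milnor number at $0$, where $\mathcal{O}_2$ is the ring of holomorphic germs at $0\in\mathbb{C}^2$ (so $\mu(f)=0$ if $f$ is smooth at $0$). A linear deformation of $f_0$ is a family $f_s=f_0+sg$, $s\in(\mathbb{C},0)$, where $g$ is a holomorphic function in a neighbourhood of $0\in\mathbb{C}^2$ with $g(0)=0$. For all sufficiently small $s\neq 0$ the number $\mu(f_s)$ is constant and at most $\mu(f_0)$; the jump of the deformation $(f_s)$ is $\mu(f_0)-\mu(f_s)$ for small $s\ne0$. $\lambda^{lin}(f_0)$ denotes the smallest non-zero value among the jumps of all linear deformations of $f_0$. A singularity $f_0=\sum a_{i,j}x^iy^j$ is quasihomogeneous if there are positive integers $w_x,w_y,W$ such that $iw_x+jw_y=W$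 whenever $a_{i,j}\neq 0$. In the displayed form the dots stand for finitely many further monomials $\gamma_{i,j}x^iy^j$, $\gamma_{i,j}\in\mathbb{C}$, and every monomial occurring with nonzero coefficient (including $x^p$ and $y^q$) has the same weighted degree $W$. *)

(* Defs.v *)
From HB Require Import structures.
From mathcomp Require Import all_boot all_order all_algebra.
From mathcomp Require Import complex.
From mathcomp Require Import all_classical all_reals all_analysis.

Set Implicit Arguments.
Unset Strict Implicit.
Unset Printing Implicit Defensive.

Import Order.TTheory GRing.Theory Num.Theory.
Import numFieldNormedType.Exports.

Local Open Scope classical_set_scope.
Local Open Scope ring_scope.
Local Open Scope complex_scope.

(* R[i] carries the topology and the norm of the field C over itself. *)
HB.instance Definition _ (R : realType) := NormedModule.copy R[i] R[i]^o.

(* Germs at the origin of C^2 are represented by functions C^2 -> C; two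
   functions represent the same germ when they agree near 0. All the notions
   below depend only on the germs of the functions involved. *)

Section PlaneCurveSingularities.
Variable R : realType.
Local Notation C := R[i].

(* [differentiable] is taken over the scalar field C, so this is complex
   differentiability on a neighbourhood of the origin. *)
Definition holomorphic_germ (f : C * C -> C) : Prop :=
  \forall z \near nbhs (0 : C * C), differentiable f z.

Definition dx (f : C * C -> C) (z : C * C) : C := 'D_((1, 0) : C * C) f z.
Definition dy (f : C * C -> C) (z : C * C) : C := 'D_((0, 1) : C * C) f z.

Definition isolated_singularity (f : C * C -> C) : Prop :=
  [/\ holomorphic_germ f,
      f 0 = 0,
      dx f 0 = 0 /\ dy f 0 = 0 &
      \forall z \near (0 : C * C)^', ~ (dx f z = 0 /\ dy f z = 0)].

Definition in_jacobian_ideal (f h : C * C -> C) : Prop :=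
  exists a b : C * C -> C,
    [/\ holomorphic_germ a, holomorphic_germ b &
        \forall z \near nbhs (0 : C * C), h z = a z * dx f z + b z * dy f z].

(* The C-vector space O_2 / (df/dx, df/dy) has dimension n: the classes of some
   holomorphic germs e_0, ..., e_(n-1) form a basis of it. The Milnor number may
   be infinite, in which case no n satisfies this. *)
Definition milnor_number (f : C * C -> C) (n : nat) : Prop :=
  exists e : 'I_n -> C * C -> C,
    (forall i, holomorphic_germ (e i)) /\
    (forall h : C * C -> C, holomorphic_germ h ->
      exists! c : {ffun 'I_n -> C},
        in_jacobian_ideal f (fun z => h z - \sum_(i < n) c i * e i z)).

Definition linear_deformation (f g : C * C -> C) (s : C) : C * C -> C :=
  fun z => f z + s * g z.

(* k = mu(f_0) - mu(f_s) for all small s <> 0, written additively to avoid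
   truncated subtraction. *)
Definition linear_jump (f g : C * C -> C) (k : nat) : Prop :=
  exists m0 m : nat,
    [/\ milnor_number f m0,
        \forall s \near (0 : C)^', milnor_number (linear_deformation f g s) m &
        m0 = (m + k)%N].

Definition is_linear_jump (f : C * C -> C) (k : nat) : Prop :=
  exists g : C * C -> C, [/\ holomorphic_germ g, g 0 = 0 & linear_jump f g k].

(* lambda^lin(f) = k *)
Definition lambda_lin (f : C * C -> C) (k : nat) : Prop :=
  [/\ (0 < k)%N, is_linear_jump f k &
      forall l : nat, (0 < l)%N -> is_linear_jump f l -> (k <= l)%N].

(* F : {poly {poly C}} is a polynomial in y whose coefficients are polynomials
   in x: the coefficient of x^i y^j is F`_j`_i. *)
Definition poly_fun (F : {poly {poly C}}) : C * C -> C :=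
  fun z => F.[z.2%:P].[z.1].

Definition quasihomogeneous (F : {poly {poly C}}) : Prop :=
  exists wx wy W : nat,
    [/\ (0 < wx)%N, (0 < wy)%N, (0 < W)%N &
        forall i j : nat, F`_j`_i != 0 -> (i * wx + j * wy)%N = W].

End PlaneCurveSingularities.

(* Main.v *)
(* The Milnor number of a germ equals the codimension of the ideal generated by the formal
   partial derivatives of its Taylor series, so one may compute with formal power series: by
   the formulas of Cauchy and Hadamard holomorphic germs have Taylor series, and by Nakayama
   a power of the maximal ideal lies in the Jacobian ideal as soon as one of the two
   codimensions is finite.

   Give x the weight q and y the weight p, so that f_0 has weight pq. Let e be the lowest
   weight occurring in g. If e >= pq, counting monomials shows that the jump of f_0 + s g is
   0. Otherwise rescaling and semicontinuity bound mu(f_0 + s g) by mu(f_0 + g_e), where g_e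
   is the part of g of weight e. Put x = X^q, y = Y^p, so that both forms become homogeneous,
   of degrees pq and e, and replace the partial derivatives by x f_x and y f_y. Since f_0 is
   squarefree, the intersection number is at most e pq, and this yields
   mu(f_0 + s g) <= e + 1 - ceil(e/p) - ceil(e/q). With D = pq - e, which is a positive
   multiple of gcd(p,q), the jump is thus at least D - floor(D/p) - floor(D/q), and
   elementary arithmetic gives the lower bounds.

   The bounds are attained by g = x if p = q = 2, by g = l^(p-1) with l a linear factor of
   f_0 if p = q >= 3, by g = y^(q-1) if p divides q and p < q, and otherwise by g = x^a y^b
   with a q + b p = pq - gcd(p,q). *)

From HB Require Import structures.
Require Import Defs.
From mathcomp Require Import all_boot all_order all_algebra.
From mathcomp Require Import complex.
From mathcomp Require Import all_classical all_reals all_analysis.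
From mathcomp Require Import zify ring lra.

Set Implicit Arguments.
Unset Strict Implicit.
Unset Printing Implicit Defensive.

Import Order.TTheory GRing.Theory Num.Theory.
Import numFieldNormedType.Exports.

Local Open Scope ring_scope.

(** * Codimension *)

(** Unlike partial differentiation, x d/dx and y d/dy only rescale monomials. They therefore keep
    weights, commute with x = X^q, y = Y^p up to constants and satisfy Euler's relation on each
    form, which makes the reduction to homogeneous forms possible. The price is contact with the
    axes: their intersection number is m + a + b + 1, where m is the Milnor number and a + 1, b + 1
    are the orders of f on x = 0 and y = 0. Weights give a + 1 >= e/p and b + 1 >= e/q, hence the
    two ceilings. The bound e pq comes from elimination: modulo one series, a form times the other
    is a form of degree pq + e, that is a product of lines, and intersection numbers with lines are
    orders of restrictions. The danger lies in lines on which this order is pq instead of e;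
    squarefreeness of f_0 bounds their number by e. Finiteness of a codimension is never free here,
    so additivity comes in two directions: one builds a codimension from its parts, the other splits
    a codimension known to be finite. *)

Definition subspace (K : fieldType) (V : lmodType K) (I : V -> Prop) :=
  I 0 /\ forall a u v, I u -> I v -> I (a *: u + v).

(** A surjection onto K^n with kernel [I] stands for the quotient V/I, so that V may be
    infinite-dimensional and no quotient type is needed; its mere existence also expresses
    finiteness. *)
Definition codim (K : fieldType) (V : lmodType K) (I : V -> Prop) n :=
  exists phi : V -> 'rV[K]_n,
    [/\ linear phi, forall w, exists v, phi v = w & forall v, I v <-> phi v = 0].

Section LinearAlgebra.
Variable K : fieldType.
Implicit Types V : lmodType K.

Lemma linear_sum_fun V (W : lmodType K) (f : V -> W) (hf : linear f) n (c : 'I_n -> K) e :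
  f (\sum_(i < n) c i *: e i) = \sum_(i < n) c i *: f (e i).
Proof.
have h0 : f 0 = 0 by have := hf (-1) 0 0; rewrite scaleN1r oppr0 addr0 scaleN1r addNr.
rewrite (big_morph f (id1 := 0) (op1 := +%R)) //; last by move=> u v; have := hf 1 u v; rewrite !scale1r.
by apply: eq_bigr => i _; have := hf (c i) (e i) 0; rewrite h0 !addr0.
Qed.

Lemma linear_fun0 V (W : lmodType K) (f : V -> W) : linear f -> f 0 = 0.
Proof. by move=> h; have := h (-1) 0 0; rewrite scaleN1r oppr0 addr0 scaleN1r addNr. Qed.

Lemma linear_funD V (W : lmodType K) (f : V -> W) : linear f ->
  forall u v, f (u + v) = f u + f v.
Proof. by move=> h u v; have := h 1 u v; rewrite !scale1r. Qed.

Lemma linear_funB V (W : lmodType K) (f : V -> W) : linear f ->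
  forall u v, f (u - v) = f u - f v.
Proof. by move=> h u v; rewrite [u - v]addrC -scaleN1r h scaleN1r addrC. Qed.

Lemma subspace_sum V (I : V -> Prop) : subspace I -> forall n (c : 'I_n -> K) e,
  (forall i, I (e i)) -> I (\sum_(i < n) c i *: e i).
Proof.
move=> [I0 Il] n c e he; apply: big_rec => // i x _; exact: Il.
Qed.

Lemma subspaceD V (I : V -> Prop) u v : subspace I -> I u -> I v -> I (u + v).
Proof. by move=> [_ Il] hu hv; rewrite -[u]scale1r; apply: Il. Qed.

Lemma subspaceZ V (I : V -> Prop) a u : subspace I -> I u -> I (a *: u).
Proof. by move=> [I0 Il] hu; rewrite -[_ *: _]addr0; apply: Il. Qed.

Lemma subspaceB V (I : V -> Prop) u v : subspace I -> I u -> I v -> I (u - v).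
Proof. by move=> [_ Il] hu hv; rewrite addrC -scaleN1r; apply: Il. Qed.

(** Among the matrices with row space inside [P] one of maximal rank works: a vector of [P] outside
    its row space would raise the rank. *)
Lemma subspace_rV n (P : 'rV[K]_n -> Prop) : subspace P ->
  exists M : 'M[K]_n, forall v, P v <-> (v <= M)%MS.
Proof.
move=> sP.
pose Q k := `[< exists M : 'M[K]_n, (\rank M >= k)%N /\ forall v, (v <= M)%MS -> P v >].
have Q0 : exists k, Q k.
  exists 0%N; apply/asboolP; exists 0; split=> // v; rewrite submx0 => /eqP ->; exact: (proj1 sP).
have Qb k : Q k -> (k <= n)%N.
  by move=> /asboolP [M [h _]]; apply: leq_trans h (rank_leq_row M).
case: (ex_maxnP Q0 Qb) => k /asboolP [M [hk hM]] kmax.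
exists M => v; split; last exact: hM.
move=> Pv; apply: contrapT => /negP nv.
have : Q k.+1.
  apply/asboolP; exists (M + v)%MS; split.
    apply: leq_ltn_trans hk _; rewrite ltnNge; apply: contra nv => h.
    have := mxrank_leqif_sup (addsmxSl M v) => -[_ hh].
    have e : \rank M == \rank (M + v)%MS.
      by rewrite eqn_leq h andbT; apply: mxrankS; apply: addsmxSl.
    by move: e; rewrite hh => hs; apply: submx_trans hs; apply: addsmxSr.
  move=> u /sub_addsmxP [[a b] ->] /=.
  apply: (subspaceD sP); first by apply: hM; apply: submxMl.
  by rewrite [b]mx11_scalar mul_scalar_mx; apply: subspaceZ.
by move=> /kmax; rewrite ltnn.
Qed.

(** Finiteness without surjectivity: the target is shrunk to the image, which has a basis by
    [subspace_rV]. *)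
Lemma codim_corestrict V n (phi : V -> 'rV[K]_n) (I : V -> Prop) :
  linear phi -> (forall v, I v <-> phi v = 0) -> exists2 r, (r <= n)%N & codim I r.
Proof.
move=> lphi kphi.
pose P (w : 'rV[K]_n) := exists v, phi v = w.
have sP : subspace P.
  split; first by exists 0; exact: linear_fun0.
  by move=> a u v [u' <-] [v' <-]; exists (a *: u' + v'); rewrite lphi.
have [M hM] := subspace_rV sP.
exists (\rank M); first exact: rank_leq_row.
have inM v : (phi v <= row_base M)%MS by rewrite eq_row_base; apply/hM; exists v.
exists (fun v => phi v *m pinvmx (row_base M)); split.
- by move=> a u v; rewrite lphi mulmxDl -scalemxAl.
- move=> w; have : P (w *m row_base M) by apply/hM; rewrite -(eq_row_base M) submxMl.
  move=> [v hv]; exists v; apply/(row_free_inj (row_base_free M)).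
  by rewrite /= mulmxKpV // hv.
- move=> v; rewrite kphi; split=> [->|h]; first by rewrite mul0mx.
  by rewrite -(mulmxKpV (inM v)) h mul0mx.
Qed.

Lemma codim_subspace V (I : V -> Prop) n : codim I n -> subspace I.
Proof.
move=> [phi [lphi _ kphi]]; split; first by apply/kphi; exact: linear_fun0.
by move=> a u v /kphi hu /kphi hv; apply/kphi; rewrite lphi hu hv scaler0 addr0.
Qed.

Lemma codim_ext V (I J : V -> Prop) n : (forall v, I v <-> J v) -> codim I n -> codim J n.
Proof.
move=> h [phi [l s k]]; exists phi; split=> // v; by rewrite -h.
Qed.

Lemma codim_sub V (I J : V -> Prop) n m : (forall v, I v -> J v) ->
  codim I n -> codim J m -> (m <= n)%N.
Proof.
move=> IJ [phi [lphi sphi kphi]] [psi [lpsi spsi kpsi]].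
have /choice [s hs] : forall i : 'I_n, exists v, phi v = delta_mx 0 i by move=> i; apply: sphi.
pose M := \matrix_(i < n) psi (s i).
have hM v : psi v = phi v *m M.
  have : J (v - \sum_(i < n) phi v 0 i *: s i).
    apply: IJ; apply/kphi; rewrite (linear_funB lphi) (linear_sum_fun lphi).
    by under eq_bigr do rewrite hs; rewrite -row_sum_delta subrr.
  move=> /kpsi; rewrite (linear_funB lpsi) (linear_sum_fun lpsi) => /eqP; rewrite subr_eq0.
  move=> /eqP ->; rewrite mulmx_sum_row; apply: eq_bigr => i _; by rewrite rowK.
have full : row_full M.
  apply/row_fullP; have /choice [t ht] : forall j : 'I_m, exists v, psi v = delta_mx 0 j.
    by move=> j; apply: spsi.
  exists (\matrix_j phi (t j)); apply/row_matrixP => j.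
  by rewrite row_mul rowK -hM ht row1.
by move: full; rewrite /row_full => /eqP <-; apply: rank_leq_row.
Qed.

Lemma codim_uniq V (I : V -> Prop) n m : codim I n -> codim I m -> n = m.
Proof.
by move=> hn hm; apply/eqP; rewrite eqn_leq (codim_sub _ hn hm) ?(codim_sub _ hm hn).
Qed.

Lemma codim_super V (I J : V -> Prop) n : (forall v, I v -> J v) -> subspace J ->
  codim I n -> exists2 m, (m <= n)%N & codim J m.
Proof.
move=> IJ sJ [phi [lphi sphi kphi]].
pose P w := exists2 v, J v & phi v = w.
have sP : subspace P.
  split; first by exists 0; [exact: (proj1 sJ)|exact: linear_fun0].
  by move=> a u v [u' Ju <-] [v' Jv <-]; exists (a *: u' + v'); rewrite ?lphi //; apply: (proj2 sJ).
have [M hM] := subspace_rV sP.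
apply: (@codim_corestrict V n (fun v => phi v *m cokermx M)).
  by move=> a u v; rewrite lphi mulmxDl -scalemxAl.
move=> v; split=> [Jv|/eqP].
  by apply/eqP; rewrite -submxE; apply/hM; exists v.
rewrite -submxE => /hM [u Ju /eqP]; rewrite eq_sym -subr_eq0 -(linear_funB lphi) => /eqP /kphi /IJ.
by move=> h; rewrite -[v](subrK u); apply: subspaceD.
Qed.

(** Links [codim] to the formulation of [milnor_number], a family of representatives with unique
    coordinates modulo [I]. *)
Lemma codimP V (I : V -> Prop) n : subspace I ->
  codim I n <-> exists e : 'I_n -> V, forall h, exists! c : {ffun 'I_n -> K},
     I (h - \sum_(i < n) c i *: e i).
Proof.
move=> sI; split.
  move=> [phi [lphi sphi kphi]].
  have /choice [s hs] : forall i : 'I_n, exists v, phi v = delta_mx 0 i by move=> i; apply: sphi.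
  have E h (c : 'I_n -> K) : I (h - \sum_(i < n) c i *: s i) <-> phi h = \row_i c i.
    rewrite kphi (linear_funB lphi) (linear_sum_fun lphi).
    under eq_bigr do rewrite hs.
    have -> : \sum_(i < n) c i *: delta_mx 0 i = \row_i c i :> 'rV_n.
      by rewrite [RHS]row_sum_delta; apply: eq_bigr => i _; rewrite mxE.
    by split=> [/eqP|->]; rewrite ?subrr // subr_eq0 => /eqP.
  exists s => h; exists [ffun i => phi h 0 i]; split.
    by apply/E; apply/rowP => i; rewrite mxE ffunE.
  by move=> c /E ->; apply/ffunP => i; rewrite ffunE mxE.
move=> [e he].
have /choice [c hc] : forall h, exists c : {ffun 'I_n -> K}, 
    I (h - \sum_(i < n) c i *: e i) /\ forall c' : {ffun 'I_n -> K}, I (h - \sum_(i < n) c' i *: e i) -> c = c'.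
  by move=> h; have [c [h1 h2]] := he h; exists c; split.
exists (fun h => \row_i c h i); split.
- move=> a u v.
  have -> : c (a *: u + v) = [ffun i => a * c u i + c v i].
    apply: (proj2 (hc _)).
    have := proj2 sI a _ _ (proj1 (hc u)) (proj1 (hc v)).
    congr I; rewrite scalerBr addrACA -opprD; congr (_ - _).
    rewrite scaler_sumr -big_split /=; apply: eq_bigr => i _.
    by rewrite ffunE scalerDl scalerA.
  by apply/rowP => i; rewrite !mxE ffunE.
- move=> w; exists (\sum_(i < n) w 0 i *: e i).
  have -> : c (\sum_(i < n) w 0 i *: e i) = [ffun i => w 0 i].
    apply: (proj2 (hc _)); under [X in _ - X]eq_bigr do rewrite ffunE.
    by rewrite subrr; apply: (proj1 sI).
  by apply/rowP => i; rewrite !mxE ffunE.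
- move=> v; split=> [Iv|/rowP h].
    have -> : c v = [ffun i => 0].
      apply: (proj2 (hc _)); rewrite big1 ?subr0 // => i _; by rewrite ffunE scale0r.
    by apply/rowP => i; rewrite !mxE ffunE.
  have := proj1 (hc v); rewrite big1 ?subr0 // => i _.
  by have := h i; rewrite !mxE => ->; rewrite scale0r.
Qed.

(* An exact sequence V/mu^-1(I) -> V/I -> V/(I + mu(V)). *)
Lemma codim_add_exact V (I J : V -> Prop) (mu : V -> V) a b :
  linear mu -> subspace I ->
  (forall v, J v <-> exists2 u, I u & exists w, v = u + mu w) ->
  codim J a -> codim (fun v => I (mu v)) b -> codim I (a + b).
Proof.
move=> lmu sI hJ cJ cB.
have sJ := codim_subspace cJ; have sB := codim_subspace cB.
have [e he] := (proj1 (codimP _ sJ)) cJ.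
have [f hf] := (proj1 (codimP _ sB)) cB.
apply/(codimP _ sI).
exists (fun k => match fintype.split k with inl i => e i | inr j => mu (f j) end) => h.
have E (c : 'I_(a + b) -> K) : \sum_(k < a + b) c k *: 
    match fintype.split k with inl i => e i | inr j => mu (f j) end =
   \sum_(i < a) c (lshift b i) *: e i + mu (\sum_(j < b) c (rshift a j) *: f j).
  rewrite big_split_ord /= (linear_sum_fun lmu); congr (_ + _).
    by apply: eq_bigr => i _; rewrite (unsplitK (inl _ i)).
  by apply: eq_bigr => i _; rewrite (unsplitK (inr _ i)).
have [c [hc uc]] := he h.
have [u Iu [w hw]] := (proj1 (hJ _)) hc.
have [d [hd ud]] := hf w.
exists [ffun k => match fintype.split k with inl i => c i | inr j => d j end]; split.
  rewrite E.
  under eq_bigr do rewrite ffunE (unsplitK (inl _ _)).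
  under [X in mu X]eq_bigr do rewrite ffunE (unsplitK (inr _ _)).
  rewrite opprD addrA hw -addrA -(linear_funB lmu); exact: subspaceD.
move=> k; rewrite E => hk.
have k1 : c = [ffun i => k (lshift b i)].
  apply: uc; apply/hJ; under [X in _ - X]eq_bigr do rewrite ffunE.
  exists (h - (\sum_(i < a) k (lshift b i) *: e i + mu (\sum_(j < b) k (rshift a j) *: f j))) => //.
  by exists (\sum_(j < b) k (rshift a j) *: f j); rewrite opprD addrA addrNK.
have c1 i : c i = k (lshift b i) by rewrite k1 ffunE.
have k2 : d = [ffun j => k (rshift a j)].
  apply: ud; rewrite (linear_funB lmu).
  have -> : mu w = h - \sum_(i < a) c i *: e i - u by rewrite hw addrC addKr.
  under eq_bigr do rewrite c1.
  under [X in _ - mu X]eq_bigr do rewrite ffunE.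
  rewrite addrAC -[h - _ - _]addrA -opprD; exact: subspaceB.
apply/ffunP => i; rewrite ffunE k1 k2; case: splitP => j ij; rewrite ffunE; congr (k _);
  exact: val_inj.
Qed.

(** Converse of [codim_add_exact]: both outer terms inherit finiteness from V/I, one as a quotient
    and the other as a subspace, and then the dimensions add up. *)
Lemma codim_exact V (I J : V -> Prop) (mu : V -> V) n :
  linear mu -> subspace J ->
  (forall v, J v <-> exists2 u, I u & exists w, v = u + mu w) ->
  codim I n -> exists a b, [/\ n = (a + b)%N, codim J a & codim (fun v => I (mu v)) b].
Proof.
move=> lmu sJ hJ cI; have sI := codim_subspace cI.
have [a _ ca] : exists2 a, (a <= n)%N & codim J a.
  apply: codim_super cI => // v Iv; apply/hJ; exists v => //; exists 0.
  by rewrite (linear_fun0 lmu) addr0.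
have [b _ cb] : exists2 b, (b <= n)%N & codim (fun v => I (mu v)) b.
  have [phi [lphi _ kphi]] := cI.
  apply: (@codim_corestrict V n (phi \o mu)) => [c u v|v] /=; last exact: kphi.
  by rewrite lmu lphi.
exists a, b; split=> //; apply: codim_uniq cI _; exact: codim_add_exact ca cb.
Qed.

End LinearAlgebra.

(** * Formal power series in two variables *)

Definition ser (K : fieldType) : Type := nat -> nat -> K.

HB.instance Definition _ (K : fieldType) := GRing.Zmodule.copy (ser K) (nat -> nat -> K).

Section SeriesRing.
Variable K : fieldType.
Implicit Types f g h : ser K.

Lemma serP f g : (forall i j, f i j = g i j) -> f = g.
Proof. by move=> e; apply: funext => i; apply: funext => j. Qed.

Definition ser_mul f g : ser K :=
  fun i j => \sum_(b < j.+1) \sum_(a < i.+1) f a b * g (i - a)%N (j - b)%N.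

Definition ser_one : ser K := fun i j => ((i == 0%N) && (j == 0%N))%:R.

(** Coefficients of a product with both exponents below N only involve the N x N box, so the ring
    laws are inherited from polynomials by truncation. *)
Definition ser_poly N f : {poly {poly K}} := \poly_(j < N) \poly_(i < N) f i j.

Lemma coef_ser_poly N f i j : (ser_poly N f)`_j`_i = if ((i < N) && (j < N))%N then f i j else 0.
Proof. by rewrite coef_poly; case: (j < N)%N; rewrite ?coef0 ?andbF // coef_poly andbT. Qed.

Lemma coef2M (P Q : {poly {poly K}}) i j :
  (P * Q)`_j`_i = \sum_(b < j.+1) \sum_(a < i.+1) P`_b`_a * Q`_(j - b)`_(i - a).
Proof. by rewrite coefM coef_sum; apply: eq_bigr => b _; rewrite coefM. Qed.

Lemma ser_mulE N f g i j : (i < N)%N -> (j < N)%N ->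
  ser_mul f g i j = (ser_poly N f * ser_poly N g)`_j`_i.
Proof.
move=> hi hj; rewrite coef2M; apply: eq_bigr => b _; apply: eq_bigr => a _.
have ha : (a < N)%N by apply: leq_ltn_trans hi; rewrite -ltnS.
have hb : (b < N)%N by apply: leq_ltn_trans hj; rewrite -ltnS.
have ha' : (i - a < N)%N by apply: leq_ltn_trans hi; apply: leq_subr.
have hb' : (j - b < N)%N by apply: leq_ltn_trans hj; apply: leq_subr.
by rewrite !coef_ser_poly ha hb ha' hb'.
Qed.

Lemma ser_mulC f g : ser_mul f g = ser_mul g f.
Proof.
apply: serP => i j; pose N := (i + j).+1.
by rewrite !(@ser_mulE N) ?ltnS ?leq_addr ?leq_addl // mulrC.
Qed.

Lemma ser_mulA f g h : ser_mul f (ser_mul g h) = ser_mul (ser_mul f g) h.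
Proof.
apply: serP => i j; pose N := (i + j).+1.
have hi : (i < N)%N by rewrite ltnS leq_addr.
have hj : (j < N)%N by rewrite ltnS leq_addl.
transitivity (ser_poly N f * (ser_poly N g * ser_poly N h))`_j`_i.
  rewrite coef2M; apply: eq_bigr => b _; apply: eq_bigr => a _.
  have ha : (a < N)%N by apply: leq_ltn_trans hi; rewrite -ltnS.
  have hb : (b < N)%N by apply: leq_ltn_trans hj; rewrite -ltnS.
  rewrite -ser_mulE ?coef_ser_poly ?ha ?hb //; 
    [exact: leq_ltn_trans (leq_subr _ _) hi|exact: leq_ltn_trans (leq_subr _ _) hj].
rewrite mulrA coef2M; apply: eq_bigr => b _; apply: eq_bigr => a _.
have ha : (a < N)%N by apply: leq_ltn_trans hi; rewrite -ltnS.
have hb : (b < N)%N by apply: leq_ltn_trans hj; rewrite -ltnS.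
rewrite -ser_mulE ?coef_ser_poly ?ha ?hb // !ifT //.
by rewrite (leq_ltn_trans (leq_subr _ _) hi) (leq_ltn_trans (leq_subr _ _) hj).
Qed.

Lemma ser_mul1 f : ser_mul ser_one f = f.
Proof.
apply: serP => i j; rewrite /ser_mul big_ord_recl big_ord_recl /= big1 => [|a _].
  rewrite big1 => [|b _]; first by rewrite /ser_one /= mul1r !addr0 !subn0.
  by rewrite big1 // => a _; rewrite /ser_one /= andbF mul0r.
by rewrite /ser_one /= mul0r.
Qed.

Lemma ser_mulDl f g h : ser_mul (f + g) h = ser_mul f h + ser_mul g h.
Proof.
apply: serP => i j; rewrite /ser_mul; apply/esym.
rewrite [LHS](_ : _ = ser_mul f h i j + ser_mul g h i j) // -big_split /=.
apply: eq_bigr => b _; rewrite -big_split /=; apply: eq_bigr => a _.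
by rewrite -mulrDl.
Qed.

Lemma ser_one_neq0 : ser_one != 0 :> ser K.
Proof.
apply/eqP => /(congr1 (fun f : ser K => f 0%N 0%N)) /eqP; rewrite /ser_one /=; exact/negP/oner_neq0.
Qed.

HB.instance Definition _ := GRing.Zmodule_isComNzRing.Build (ser K)
  ser_mulA ser_mulC ser_mul1 ser_mulDl ser_one_neq0.

Definition ser_scale (a : K) f : ser K := fun i j => a * f i j.

Lemma ser_scaleA a b f : ser_scale a (ser_scale b f) = ser_scale (a * b) f.
Proof. by apply: serP => i j; rewrite /ser_scale mulrA. Qed.
Lemma ser_scale1 : left_id 1 ser_scale.
Proof. by move=> f; apply: serP => i j; rewrite /ser_scale mul1r. Qed.
Lemma ser_scaleDr : right_distributive ser_scale +%R.
Proof. by move=> a f g; apply: serP => i j; exact: mulrDr. Qed.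
Lemma ser_scaleDl f : {morph ser_scale^~ f : a b / a + b}.
Proof. by move=> a b; apply: serP => i j; exact: mulrDl. Qed.

HB.instance Definition _ := GRing.Zmodule_isLmodule.Build K (ser K)
  ser_scaleA ser_scale1 ser_scaleDr ser_scaleDl.

Lemma ser_scaleAl (a : K) f g : a *: (f * g) = a *: f * g.
Proof.
apply: serP => i j; change (a * ser_mul f g i j = ser_mul (ser_scale a f) g i j).
rewrite /ser_mul mulr_sumr.
by apply: eq_bigr => b _; rewrite mulr_sumr; apply: eq_bigr => c _; rewrite mulrA.
Qed.

HB.instance Definition _ := GRing.Lmodule_isLalgebra.Build K (ser K) ser_scaleAl.
HB.instance Definition _ := GRing.Lalgebra_isComAlgebra.Build K (ser K).

Lemma ser0 i j : (0 : ser K) i j = 0. Proof. by []. Qed.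
Lemma ser1 i j : (1 : ser K) i j = ((i == 0%N) && (j == 0%N))%:R. Proof. by []. Qed.
Lemma serD f g i j : (f + g) i j = f i j + g i j. Proof. by []. Qed.
Lemma serN f i j : (- f) i j = - f i j. Proof. by []. Qed.
Lemma serB f g i j : (f - g) i j = f i j - g i j. Proof. by []. Qed.
Lemma serZ a f i j : (a *: f) i j = a * f i j. Proof. by []. Qed.
Lemma serM f g i j : (f * g) i j =
  \sum_(b < j.+1) \sum_(a < i.+1) f a b * g (i - a)%N (j - b)%N.
Proof. by []. Qed.
Definition serE := (ser0, ser1, serD, serN, serZ).

(* The homogeneous component of degree n of f, dehomogenized at y = 1. *)
Definition hom n f : {poly K} := \poly_(i < n.+1) f i (n - i)%N.

Lemma coef_hom n f i : (i <= n)%N -> (hom n f)`_i = f i (n - i)%N.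
Proof. by move=> h; rewrite coef_poly ltnS h. Qed.

Lemma size_hom n f : (size (hom n f) <= n.+1)%N.
Proof. exact: size_poly. Qed.

Lemma homP f g : (forall n, hom n f = hom n g) -> f = g.
Proof.
move=> h; apply: serP => i j; have := congr1 (fun p : {poly K} => p`_i) (h (i + j)%N).
by rewrite !coef_hom ?leq_addr // addKn.
Qed.

Lemma homM n f g : hom n (f * g) = \sum_(k < n.+1) hom k f * hom (n - k) g.
Proof.
apply/polyP => i; rewrite coef_sum.
under eq_bigr do rewrite coefM.
rewrite exchange_big /=.
have [hi|hi] := leqP i n; last first.
  rewrite nth_default; last by rewrite (leq_trans (size_hom _ _)).
  rewrite big1 // => a _; rewrite big1 // => k _.
  have [ka|ak] := ltnP k a; first by rewrite [(hom k f)`_a]nth_default ?mul0r // (leq_trans (size_hom _ _)).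
  rewrite [X in _ * X]nth_default ?mulr0 //; apply: leq_trans (size_hom _ _) _.
  have := ltn_ord k; have := ltn_ord a; lia.
rewrite coef_hom // serM exchange_big /=; apply: eq_bigr => a _.
have ha : (a <= i)%N by rewrite -ltnS.
(* For fixed a only the degrees k with a <= k <= a + n - i contribute; they are reindexed by the
   exponent b = k - a of y, and the two outer ranges vanish. *)
have e : n.+1 = (a + (n - i).+1 + (i - a))%N by lia.
rewrite -(big_mkord xpredT (fun b => f a b * g (i - a)%N (n - i - b)%N)).
rewrite -(big_mkord xpredT (fun k => (hom k f)`_a * (hom (n - k) g)`_(i - a))).
set s := (X in X = _).
rewrite (@big_cat_nat _ _ _ a) //=; last lia.
rewrite big_nat_cond big1 ?add0r; last first.
  move=> k /andP[/andP[_ ka] _]; rewrite nth_default ?mul0r //; exact: leq_trans (size_hom _ _) _.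
rewrite (@big_cat_nat _ _ _ (a + (n - i).+1)%N) //=; try lia.
rewrite [X in _ + X]big_nat_cond [X in _ + X]big1 ?addr0; last first.
  move=> k /andP[/andP[ka kn] _]; rewrite [X in _ * X]nth_default ?mulr0 //.
  apply: leq_trans (size_hom _ _) _; lia.
rewrite -{1}[a : nat]add0n [(a + _.+1)%N]addnC big_addn addnK /s.
apply: eq_big_nat => b /andP[_ hb].
rewrite !coef_hom; try lia.
congr (f _ _ * g _ _); lia.
Qed.

Lemma homD n f g : hom n (f + g) = hom n f + hom n g.
Proof. by apply/polyP => i; rewrite coefD !coef_poly; case: ifP; rewrite ?addr0. Qed.

Lemma homZ n a f : hom n (a *: f) = a *: hom n f.
Proof. by apply/polyP => i; rewrite coefZ !coef_poly; case: ifP; rewrite ?mulr0. Qed.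

Lemma homN n f : hom n (- f) = - hom n f.
Proof. by rewrite -scaleN1r homZ scaleN1r. Qed.

Lemma homB n f g : hom n (f - g) = hom n f - hom n g.
Proof. by rewrite homD homN. Qed.

Lemma hom0 n : hom n 0 = 0.
Proof. by apply/polyP => i; rewrite coef_poly coef0; case: ifP. Qed.

(** Series can be assembled from arbitrary components; divisions are therefore carried out one
    degree at a time, in a univariate polynomial ring. *)
Lemma hom_surj (P : nat -> {poly K}) : (forall n, size (P n) <= n.+1)%N ->
  exists f, forall n, hom n f = P n.
Proof.
move=> h; exists (fun i j => (P (i + j)%N)`_i) => n; apply/polyP => i.
rewrite coef_poly ltnS; case: leqP => hi; first by rewrite subnKC.
by rewrite nth_default // (leq_trans (h n)).
Qed.

End SeriesRing.

(** * Intersection numbers *)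

Section Filtration.
Variable K : fieldType.
Implicit Types f g h : ser K.

(* The weighted order of f is at least N. *)
Definition word (w1 w2 N : nat) f := forall i j, (i * w1 + j * w2 < N)%N -> f i j = 0.

Lemma wordM w1 w2 a b f g : word w1 w2 a f -> word w1 w2 b g -> word w1 w2 (a + b) (f * g).
Proof.
move=> hf hg i j hij; rewrite serM big1 // => l _; rewrite big1 // => k _.
have [lt|ge] := ltnP (k * w1 + l * w2) a; first by rewrite hf ?mul0r.
rewrite hg ?mulr0 //; have := ltn_ord k; have := ltn_ord l; rewrite !ltnS => hl hk.
by rewrite !mulnBl; have := leq_mul hl (leqnn w2); have := leq_mul hk (leqnn w1); lia.
Qed.

Lemma wordW w1 w2 a b f : (a <= b)%N -> word w1 w2 b f -> word w1 w2 a f.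
Proof. by move=> ab h i j hij; apply: h; apply: leq_trans ab. Qed.

Lemma wordD w1 w2 a f g : word w1 w2 a f -> word w1 w2 a g -> word w1 w2 a (f + g).
Proof. by move=> hf hg i j h; rewrite serE hf ?hg ?addr0. Qed.

Lemma wordZ w1 w2 a c f : word w1 w2 a f -> word w1 w2 a (c *: f).
Proof. by move=> hf i j h; rewrite serE hf ?mulr0. Qed.

Lemma wordN w1 w2 a f : word w1 w2 a f -> word w1 w2 a (- f).
Proof. by move=> hf i j h; rewrite serE hf ?oppr0. Qed.

Lemma wordMl w1 w2 a f g : word w1 w2 a g -> word w1 w2 a (f * g).
Proof. by move=> h; rewrite -[a]add0n; apply: wordM. Qed.

Lemma word_sum w1 w2 a I (r : seq I) (P : pred I) (F : I -> ser K) :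
  (forall i, P i -> word w1 w2 a (F i)) -> word w1 w2 a (\sum_(i <- r | P i) F i).
Proof. by move=> h; elim/big_rec: _ => // i x Pi hx; apply: wordD => //; apply: h. Qed.

Lemma wordX f k : word 1 1 1 f -> word 1 1 k (f ^+ k).
Proof. by move=> h; elim: k => // k ih; rewrite exprS -[k.+1]add1n; apply: wordM. Qed.

Lemma ser_sumE I (r : seq I) (P : pred I) (F : I -> ser K) i j :
  (\sum_(k <- r | P k) F k) i j = \sum_(k <- r | P k) F k i j.
Proof. by elim/big_rec2: _ => // k x y _ <-; rewrite serE. Qed.

(* Inverses are geometric series. *)
Lemma ser_unit f : f 0%N 0%N != 0 -> exists g, g * f = 1.
Proof.
move=> f0; pose M := 1 - (f 0%N 0%N)^-1 *: f.
have hM : word 1 1 1 M.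
  move=> i j; rewrite ltnS !muln1 leqn0 addn_eq0 => /andP[/eqP -> /eqP ->].
  by rewrite /M serB serE serZ /= mulVf ?subrr.
pose g : ser K := fun i j => \sum_(k < (i + j).+1) (M ^+ k) i j.
have hg N i j : (i + j <= N)%N -> g i j = (\sum_(k < N.+1) M ^+ k) i j.
  move=> hN; rewrite ser_sumE /g.
  rewrite -(big_mkord xpredT (fun k => (M ^+ k) i j)) -(big_mkord xpredT (fun k => (M ^+ k) i j)).
  rewrite [RHS](@big_cat_nat _ _ _ (i + j).+1) //= [X in _ + X]big_nat_cond [X in _ + X]big1 ?addr0 //.
  move=> k /andP[/andP[hk _] _]; apply: (@wordX M k hM i j); rewrite !muln1; lia.
have e : g * (1 - M) = 1.
  apply: serP => i j; rewrite serM.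
  transitivity (((\sum_(k < (i + j).+1) M ^+ k) * (1 - M)) i j).
    rewrite serM; apply: eq_bigr => b _; apply: eq_bigr => a _; congr (_ * _).
    by apply: hg; have := ltn_ord a; have := ltn_ord b; lia.
  rewrite mulrC -[1 - M]opprB mulNr -subrX1 opprB serB.
  by rewrite (@wordX M (i + j).+1 hM i j) ?subr0 // !muln1; lia.
exists ((f 0%N 0%N)^-1 *: g); rewrite -scalerAl scalerAr -[_ *: f](subKr 1); exact: e.
Qed.

(** The binary form y^d P(x/y), at least when P has degree at most d; the degree is kept apart
    because P alone forgets the power of y. *)
Definition form (d : nat) (P : {poly K}) : ser K := fun i j => if (i + j == d)%N then P`_i else 0.

Lemma hom_form d (P : {poly K}) k : (size P <= d.+1)%N -> hom k (form d P) = if k == d then P else 0.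
Proof.
move=> hP; apply/polyP => i; rewrite coef_poly /form ltnS; case: leqP => hi.
  by rewrite subnKC //; case: eqP => // _; rewrite coef0.
by case: eqP => [e|]; rewrite ?coef0 // nth_default // (leq_trans hP) // -e.
Qed.

Lemma hom_formM d (P : {poly K}) g n : (size P <= d.+1)%N ->
  hom n (form d P * g) = if (d <= n)%N then P * hom (n - d) g else 0.
Proof.
move=> hP; rewrite homM; case: leqP => hd.
  rewrite (bigD1 (Ordinal (hd : d < n.+1)%N)) //= hom_form // eqxx big1 ?addr0 // => i hi.
  by rewrite hom_form // ifN ?mul0r //; apply: contra hi => /eqP e; apply/eqP/val_inj.
by rewrite big1 // => i _; rewrite hom_form // ifN ?mul0r //; apply/eqP; have := ltn_ord i; lia.
Qed.

Lemma formM d d' (P P' : {poly K}) : (size P <= d.+1)%N -> (size P' <= d'.+1)%N ->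
  form d P * form d' P' = form (d + d') (P * P').
Proof.
move=> h h'; apply: homP => n; rewrite hom_formM // !hom_form //; last first.
  have [->|P0] := eqVneq P 0; first by rewrite mul0r size_poly0.
  have [->|P0'] := eqVneq P' 0; first by rewrite mulr0 size_poly0.
  by rewrite (leq_trans (size_polyMleq _ _)) //; lia.
case: leqP => hd; last by rewrite ifN //; apply/eqP; lia.
have -> : (n - d == d')%N = (n == d + d')%N by apply/eqP/eqP; lia.
by case: ifP; rewrite ?mulr0.
Qed.

Lemma formZ d c P : form d (c *: P) = c *: form d P.
Proof. by apply: serP => i j; rewrite serE /form; case: ifP; rewrite ?coefZ ?mulr0. Qed.

Lemma formD d P Q : form d (P + Q) = form d P + form d Q.
Proof. by apply: serP => i j; rewrite serE /form; case: ifP; rewrite ?coefD ?addr0. Qed.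

Lemma formB d P Q : form d (P - Q) = form d P - form d Q.
Proof. by rewrite formD -scaleN1r formZ scaleN1r. Qed.

Lemma form1 : form 0 1 = 1.
Proof.
apply: serP => i j; rewrite serE /form coef1 addn_eq0; by case: i j => [|i] [|j].
Qed.

Lemma form_nzd d (P : {poly K}) h : (size P <= d.+1)%N -> P != 0 -> form d P * h = 0 -> h = 0.
Proof.
move=> hP P0 e; apply: homP => n; rewrite hom0.
have := congr1 (hom (n + d)) e; rewrite hom_formM // hom0 leq_addl addnK.
by move/eqP; rewrite mulf_eq0 (negPf P0) => /eqP.
Qed.

Definition mono (a b : nat) : ser K := form (a + b) 'X^a.

Lemma monoE a b i j : mono a b i j = ((i == a) && (j == b))%:R.
Proof.
rewrite /mono /form coefXn; case: (eqVneq i a) => [->|] /=; last by case: ifP.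
by rewrite eqn_add2l; case: ifP.
Qed.

Lemma size_monop a b : (size ('X^a : {poly K}) <= (a + b).+1)%N.
Proof. by rewrite size_polyXn ltnS leq_addr. Qed.

Lemma mono_mulE a b f i j :
  (mono a b * f) i j = if ((a <= i) && (b <= j))%N then f (i - a)%N (j - b)%N else 0.
Proof.
rewrite serM; case: ifP => [/andP[ha hb]|/negbT h].
  rewrite (bigD1 (Ordinal (hb : b < j.+1)%N)) //= [X in _ + X]big1 ?addr0; last first.
    move=> l hl; rewrite big1 // => k _; rewrite monoE.
    by rewrite [X in _ && X]negbTE ?andbF ?mul0r //; apply: contra hl => /eqP e; apply/eqP/val_inj.
  rewrite (bigD1 (Ordinal (ha : a < i.+1)%N)) //= [X in _ + X]big1 ?addr0; last first.
    move=> k hk; rewrite monoE.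
    by rewrite [X in X && _]negbTE ?mul0r //; apply: contra hk => /eqP e; apply/eqP/val_inj.
  by rewrite monoE !eqxx mul1r.
rewrite big1 // => l _; rewrite big1 // => k _; rewrite monoE.
case: andP => [[/eqP e1 /eqP e2]|]; rewrite ?mul0r //.
by move: h (ltn_ord k) (ltn_ord l); rewrite e1 e2 !ltnS => /negP h h1 h2; case: h; rewrite h1.
Qed.

Lemma word_mono w1 w2 a b : word w1 w2 (a * w1 + b * w2) (mono a b).
Proof.
move=> i j h; rewrite monoE; case: eqP => [e1|//]; case: eqP => [e2|//].
by move: h; rewrite e1 e2 ltnn.
Qed.

End Filtration.


(** * Restriction to lines and additivity of intersection numbers *)

Section Restriction.
Variable K : fieldType.
Implicit Types f g h A B C : ser K.

(* The coefficient of y^n in the restriction of f to the line x = w y. *)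
Definition rs w f n : K := (hom n f).[w].

Lemma rsD w f g n : rs w (f + g) n = rs w f n + rs w g n.
Proof. by rewrite /rs homD hornerD. Qed.
Lemma rsB w f g n : rs w (f - g) n = rs w f n - rs w g n.
Proof. by rewrite /rs homB hornerD hornerN. Qed.
Lemma rsZ w a f n : rs w (a *: f) n = a * rs w f n.
Proof. by rewrite /rs homZ hornerZ. Qed.
Lemma rsM w f g n : rs w (f * g) n = \sum_(k < n.+1) rs w f k * rs w g (n - k).
Proof. by rewrite /rs homM horner_sum; apply: eq_bigr => k _; rewrite hornerM. Qed.
Lemma rs_form w d (P : {poly K}) g n : (size P <= d.+1)%N ->
  rs w (form d P * g) n = if (d <= n)%N then P.[w] * rs w g (n - d) else 0.
Proof. by move=> h; rewrite /rs hom_formM //; case: ifP; rewrite ?hornerM ?horner0. Qed.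

Definition line (w : K) : ser K := form 1 ('X - w%:P).

Lemma size_line (w : K) : (size ('X - w%:P)%R <= 2)%N.
Proof. by rewrite size_XsubC. Qed.

Lemma rs_line w h n : rs w (line w * h) n = 0.
Proof. by rewrite rs_form ?size_line // !hornerE subrr mul0r if_same. Qed.

Lemma line_nzd w h : line w * h = 0 -> h = 0.
Proof. by apply: form_nzd; rewrite ?size_line ?polyXsubC_eq0. Qed.

(** X - w divides each dehomogenized component, and the quotients, one degree lower, are the
    components of g. *)
Lemma rs_eq0 w h : (forall n, rs w h n = 0) -> exists g, h = line w * g.
Proof.
move=> h0; have /choice [Q hQ] : forall n, exists Q, hom n h = Q * ('X - w%:P).
  by move=> n; apply/factor_theorem/rootP; exact: h0.
have sQ n : (size (Q n.+1) <= n.+1)%N.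
  have [->|Q0] := eqVneq (Q n.+1) 0; first by rewrite size_poly0.
  have := size_hom n.+1 h; rewrite hQ size_Mmonic ?monicXsubC // size_XsubC. by rewrite addnC.
have [g hg] := hom_surj sQ.
exists g; apply: homP => -[|n].
  have e0 : (hom 0 h)`_0 = 0.
    by have := h0 0%N; rewrite /rs {1}[hom 0 h]size1_polyC ?size_hom // hornerC.
  by rewrite hom_formM ?size_line //= [LHS]size1_polyC ?size_hom // e0.
by rewrite hom_formM ?size_line //= subn1 hg mulrC -hQ.
Qed.

Lemma rs_ord_exists (a : nat -> K) : (exists n, a n != 0) ->
  exists2 n, a n != 0 & forall k, (k < n)%N -> a k = 0.
Proof.
move=> /ex_minnP [n hn hm]; exists n => // k kn; apply/eqP; apply: contraLR kn => /hm.
by rewrite -leqNgt.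
Qed.

Definition has_ord (a : nat -> K) n := a n != 0 /\ forall k, (k < n)%N -> a k = 0.

Lemma rs_mul_ord w f g a b : has_ord (rs w f) a -> has_ord (rs w g) b ->
  has_ord (rs w (f * g)) (a + b).
Proof.
move=> [fa fl] [gb gl]; split.
  have ha : (a < (a + b).+1)%N by rewrite ltnS leq_addr.
  rewrite rsM (bigD1 (Ordinal ha)) //= big1 ?addr0 ?addKn ?mulf_neq0 // => i hi.
  have : (i : nat) != a by apply: contra hi => /eqP e; apply/eqP/val_inj.
  rewrite neq_ltn => /orP[h|h]; first by rewrite fl ?mul0r.
  by rewrite gl ?mulr0 //; have := ltn_ord i; lia.
move=> k hk; rewrite rsM big1 // => i _.
have [h|h] := ltnP i a; first by rewrite fl ?mul0r.
by rewrite gl ?mulr0 //; have := ltn_ord i; lia.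
Qed.

Definition ideal2 A B h := exists u v, h = u * A + v * B.

(* The intersection number at the origin of A = 0 and B = 0. *)
Definition cd A B n := codim (ideal2 A B) n.

Lemma ideal2_subspace A B : subspace (ideal2 A B).
Proof.
split; first by exists 0, 0; rewrite !mul0r addr0.
move=> a u v [u1 [u2 ->]] [v1 [v2 ->]]; exists (a *: u1 + v1), (a *: u2 + v2).
by rewrite scalerDr !mulrDl !scalerAl addrACA.
Qed.

Lemma ideal2M A B h k : ideal2 A B h -> ideal2 A B (k * h).
Proof. by move=> [u [v ->]]; exists (k * u), (k * v); rewrite mulrDr !mulrA. Qed.

Lemma ideal2D A B h k : ideal2 A B h -> ideal2 A B k -> ideal2 A B (h + k).
Proof. exact: subspaceD (ideal2_subspace A B). Qed.

Lemma ideal2_l A B : ideal2 A B A. Proof. by exists 1, 0; rewrite mul1r mul0r addr0. Qed.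
Lemma ideal2_r A B : ideal2 A B B. Proof. by exists 0, 1; rewrite mul1r mul0r add0r. Qed.

Lemma ideal2_sub A B A' B' h : ideal2 A' B' A -> ideal2 A' B' B -> ideal2 A B h -> ideal2 A' B' h.
Proof. by move=> hA hB [u [v ->]]; apply: ideal2D; apply: ideal2M. Qed.

Lemma cd_eq A B A' B' n : ideal2 A B A' -> ideal2 A B B' -> ideal2 A' B' A -> ideal2 A' B' B ->
  cd A B n -> cd A' B' n.
Proof. by move=> h1 h2 h3 h4; apply: codim_ext => v; split; apply: ideal2_sub. Qed.

Lemma cd_sym A B n : cd A B n -> cd B A n.
Proof. by apply: cd_eq; (exact: ideal2_l || exact: ideal2_r). Qed.

Lemma cd_scale A B c n : c != 0 -> cd A B n -> cd A (c *: B) n.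
Proof.
move=> c0; apply: cd_eq.
- exact: ideal2_l.
- by exists 0, (c%:A); rewrite mul0r add0r mulr_algl.
- exact: ideal2_l.
- by exists 0, (c^-1%:A); rewrite mul0r add0r mulr_algl scalerA mulVf // scale1r.
Qed.

Lemma cd_one A B : ideal2 A B 1 -> cd A B 0.
Proof.
move=> h1; exists (fun _ => 0); split=> [a u v|w|v].
- by rewrite scaler0 addr0.
- by exists 0; rewrite [w]thinmx0.
- by split=> // _; rewrite -[v]mulr1; apply: ideal2M.
Qed.

(* B is not a zero divisor modulo A. *)
Definition nzd A B := forall h u, B * h = u * A -> exists v, h = v * A.

Lemma nzdM A B C : nzd A B -> nzd A C -> nzd A (B * C).
Proof. by move=> hB hC h u; rewrite -mulrA => /hB [v]; apply: hC. Qed.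

Lemma nzd1 A : nzd A 1. Proof. by move=> h u; rewrite mul1r => ->; exists u. Qed.

Lemma nzdZ A B c : c != 0 -> nzd A B -> nzd A (c *: B).
Proof.
move=> c0 hB h u e; apply: (hB h (c^-1 *: u)).
by rewrite -scalerAl -e -scalerAl scalerA mulVf // scale1r.
Qed.

Lemma linear_mul (B : ser K) : linear (fun h : ser K => B * h).
Proof. by move=> a u v; rewrite mulrDr scalerAr. Qed.

(** Multiplication by B embeds the quotient by (A, C) into the quotient by (A, BC), with cokernel
    the quotient by (A, B); that B is regular modulo A identifies the ideal quotient (A, BC) : B
    with (A, C). *)
Lemma cd_mul A B C a b : nzd A B -> cd A B a -> cd A C b -> cd A (B * C) (a + b).
Proof.
move=> hB cB cC; apply: (codim_add_exact (mu := fun h => B * h)) cB _.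
- exact: linear_mul.
- exact: ideal2_subspace.
- move=> v; split=> [[u [w ->]]|[u [s [t ->]] [w ->]]].
    by exists (u * A); [exists u, 0; rewrite mul0r addr0 | exists w; rewrite [B * w]mulrC].
  by exists s, (t * C + w); ring.
- apply: codim_ext cC => h; split=> [[u [v ->]]|[u [v e]]].
    by exists (B * u), v; ring.
  have [|t ht] := hB (h - v * C) u.
    by rewrite mulrBr e; ring.
  by exists t, v; rewrite -ht subrK.
Qed.

Lemma cd_split A B C n : nzd A B -> cd A (B * C) n ->
  exists a b, [/\ n = (a + b)%N, cd A B a & cd A C b].
Proof.
move=> hB cBC.
have [|||a [b [-> ca cb]]] := codim_exact (J := ideal2 A B) (mu := fun h => B * h) _ _ _ cBC.
- exact: linear_mul.
- exact: ideal2_subspace.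
- move=> v; split=> [[u [w ->]]|[u [s [t ->]] [w ->]]].
    by exists (u * A); [exists u, 0; rewrite mul0r addr0 | exists w; rewrite [B * w]mulrC].
  by exists s, (t * C + w); ring.
- exists a, b; split=> //; apply: codim_ext cb => h; split=> [[u [v e]]|[u [v ->]]]; last first.
    by exists (B * u), v; ring.
  have [|t ht] := hB (h - v * C) u.
    by rewrite mulrBr e; ring.
  by exists t, v; rewrite -ht subrK.
Qed.

(** If [line w] divides u A, then u vanishes on the line because A does not, so u is a multiple of
    [line w], which can be cancelled. *)
Lemma nzd_line w A n : has_ord (rs w A) n -> nzd A (line w).
Proof.
move=> hA h u e.
have [u' hu] : exists u', u = line w * u'.
  apply: rs_eq0; apply: contrapT => /existsNP [k hk].
  have [m mk ml] := @rs_ord_exists (rs w u) (ex_intro _ k (introN eqP hk)).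
  have [/eqP nz _] := rs_mul_ord (conj mk ml) hA; apply: nz.
  by rewrite -e rs_line.
exists u'; apply/eqP; rewrite -subr_eq0; apply/eqP; apply: (@line_nzd w).
by rewrite mulrBr e hu mulrA subrr.
Qed.

Lemma rs_lift w (a : nat -> K) : exists v, forall n, rs w v n = a n.
Proof.
have [|v hv] := @hom_surj K (fun n => (a n)%:P).
  by move=> n; rewrite (leq_trans (size_polyC_leq1 _)).
by exists v => n; rewrite /rs hv hornerC.
Qed.

(** Weierstrass division by hand: h equals y^k v up to a multiple of the line, with v prescribed on
    the line. *)
Lemma rs_shift w h k : (forall n, (n < k)%N -> rs w h n = 0) ->
  exists v g, h = mono K 0 k * v + line w * g /\ forall n, rs w v n = rs w h (n + k).
Proof.
move=> hk; have [v hv] := rs_lift w (fun n => rs w h (n + k)).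
have [|g hg] := @rs_eq0 w (h - mono K 0 k * v).
  move=> n; rewrite rsB rs_form ?size_monop // ?add0n expr0 hornerC mul1r.
  by case: leqP => kn; rewrite ?hv ?subnK ?subrr // hk ?subr0.
by exists v, g; rewrite -hg addrC subrK.
Qed.

(** Modulo the line the ring becomes K[[y]], where A is y^n times a unit; the first n coefficients
    of the restriction are the coordinates. *)
Lemma cd_line w A n : has_ord (rs w A) n -> cd A (line w) n.
Proof.
move=> [An Al]; exists (fun h => \row_(k < n) rs w h k); split.
- by move=> a u v; apply/rowP => k; rewrite !mxE rsD rsZ.
- move=> r; have [v hv] := rs_lift w (fun k => if insub k is Some i then r 0 i else 0 : K).
  exists v; apply/rowP => k; rewrite mxE hv; case: insubP => [i _ e|]; last by rewrite ltn_ord.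
  by congr (r 0 _); apply: val_inj.
move=> h; split=> [[u [v ->]]|/rowP e].
  apply/rowP => k; rewrite !mxE rsD [v * _]mulrC rs_line addr0 rsM big1 // => i _.
  by rewrite Al ?mulr0 //; have := ltn_ord i; have := ltn_ord k; lia.
have [v [g [-> hv]]] : exists v g, h = mono K 0 n * v + line w * g /\ forall m, rs w v m = rs w h (m + n).
  by apply: rs_shift => k kn; have := e (Ordinal kn); rewrite !mxE.
have [a [b [eA ha]]] := rs_shift Al.
(* The constant term of a is the leading coefficient of A on the line, so a is invertible. *)
have [|c hc] := @ser_unit K a.
  have := ha 0%N; rewrite add0n => h0; move: An; rewrite -h0 /rs [hom 0 a]size1_polyC ?size_hom //.
  by rewrite hornerC coef_hom.
exists (v * c), (g - v * c * b); rewrite {1}eA.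
have -> : v * c * (mono K 0 n * a + line w * b) + (g - v * c * b) * line w =
   mono K 0 n * v * (c * a) + line w * g by ring.
by rewrite hc mulr1.
Qed.

Definition swap f : ser K := locked (fun i j => f j i).

Lemma swapE f i j : swap f i j = f j i. Proof. by rewrite /swap -lock. Qed.

Lemma swapM f g : swap (f * g) = swap f * swap g.
Proof.
apply: serP => i j; rewrite swapE !serM exchange_big.
by apply: eq_bigr => a _; apply: eq_bigr => b _; rewrite !swapE.
Qed.
Lemma swapD f g : swap (f + g) = swap f + swap g.
Proof. by apply: serP => i j; rewrite serD !swapE. Qed.
Lemma swapZ c f : swap (c *: f) = c *: swap f.
Proof. by apply: serP => i j; rewrite serZ !swapE. Qed.
Lemma swapK f : swap (swap f) = f.
Proof. by apply: serP => i j; rewrite !swapE. Qed.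

Lemma ideal2_swap A B h : ideal2 A B h -> ideal2 (swap A) (swap B) (swap h).
Proof. by move=> [u [t ->]]; exists (swap u), (swap t); rewrite swapD !swapM. Qed.

Lemma cd_swap A B n : cd A B n -> cd (swap A) (swap B) n.
Proof.
move=> [phi [l s k]]; exists (fun h => phi (swap h)); split=> [a u v|w|v].
- by rewrite swapD swapZ l.
- by have [v <-] := s w; exists (swap v); rewrite swapK.
- rewrite -k; split=> h; first by have := ideal2_swap h; rewrite !swapK.
  by have := ideal2_swap h; rewrite swapK.
Qed.

Lemma nzd_swap A B : nzd A B -> nzd (swap A) (swap B).
Proof.
move=> hB h u /(congr1 swap); rewrite !swapM !swapK => /hB [v hv].
by exists (swap v); rewrite -[h]swapK hv swapM.
Qed.

(* [None] stands for the line y = 0 and [Some w] for x = w y. *)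
Definition pline (l : option K) : ser K := if l is Some w then line w else mono K 0 1.

Definition prs (l : option K) f : nat -> K := if l is Some w then rs w f else fun n => f n 0%N.

Lemma swap_mono a b : swap (mono K a b) = mono K b a.
Proof. by apply: serP => i j; rewrite swapE !monoE andbC. Qed.

Lemma rs0 f n : rs 0 f n = f 0%N n.
Proof. by rewrite /rs horner_coef0 coef_hom // subn0. Qed.

Lemma line0 : line 0 = mono K 1 0.
Proof. by rewrite /line /mono subr0. Qed.

Lemma cd_pline l A n : has_ord (prs l A) n -> cd A (pline l) n.
Proof.
case: l => [w|] /= h; first exact: cd_line.
rewrite -[A]swapK -[mono _ _ _]swapK; apply: cd_swap; rewrite swap_mono -line0; apply: cd_line.
by split=> [|k kn]; rewrite rs0 swapE; [exact: (proj1 h) | exact: (proj2 h)].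
Qed.

Lemma nzd_pline l A n : has_ord (prs l A) n -> nzd A (pline l).
Proof.
case: l => [w|] /= h; first exact: nzd_line h.
rewrite -[A]swapK -[mono _ _ _]swapK; apply: nzd_swap; rewrite swap_mono -line0; apply: (@nzd_line _ _ n).
by split=> [|k kn]; rewrite rs0 swapE; [exact: (proj1 h) | exact: (proj2 h)].
Qed.

Lemma cd_lines A (o : option K -> nat) (s : seq (option K)) :
  (forall l, l \in s -> has_ord (prs l A) (o l)) ->
  cd A (\prod_(l <- s) pline l) (\sum_(l <- s) o l) /\ nzd A (\prod_(l <- s) pline l).
Proof.
elim: s => [|l s ih] h.
  by rewrite !big_nil; split; [apply: cd_one; apply: ideal2_r | apply: nzd1].
have [|h1 h2] := ih; first by move=> k ks; apply: h; rewrite inE ks orbT.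
have hl := h l (mem_head _ _).
rewrite !big_cons; split; last by apply: nzdM => //; apply: nzd_pline hl.
by apply: cd_mul => //; [apply: nzd_pline hl | apply: cd_pline].
Qed.

End Restriction.

(** The factor y occurs as often as the degree of P falls short of d; this is the role of the [None]
    entries. *)
Lemma form_lines (K : closedFieldType) d (P : {poly K}) : (size P <= d.+1)%N -> P != 0 ->
  exists2 rs : seq K, P = lead_coef P *: \prod_(z <- rs) ('X - z%:P) &
   form d P = lead_coef P *: \prod_(l <- map Some rs ++ nseq (d - size rs)%N None) pline l.
Proof.
move=> hd P0; have [rs e] := closed_field_poly_normal P.
have sz : size P = (size rs).+1.
  by rewrite {1}e size_scale ?lead_coef_eq0 // size_prod_XsubC.
exists rs => //; rewrite {1}e formZ; congr (_ *: _).
rewrite big_cat /= big_map.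
have -> : \prod_(l <- nseq (d - size rs)%N None) pline l = form (d - size rs)%N 1 :> ser K.
  elim: (d - _)%N => [|n ih]; first by rewrite big_nil form1.
  by rewrite big_cons ih /= /mono formM ?size_poly1 // expr0 ?size_poly1 // mulr1.
have -> : \prod_(w <- rs) pline (Some w) = form (size rs) (\prod_(z <- rs) ('X - z%:P)).
  elim: (rs) => [|r s ih]; first by rewrite !big_nil form1.
  by rewrite !big_cons ih /= /line formM ?size_XsubC ?size_prod_XsubC.
rewrite formM ?size_prod_XsubC ?size_poly1 // mulr1 subnKC //.
by rewrite sz in hd.
Qed.

Section CodimExtra.
Variable K : fieldType.

Lemma codim_prod (V W : lmodType K) (I : V -> Prop) (J : W -> Prop) a b :
  codim I a -> codim J b -> codim (fun z : V * W => I z.1 /\ J z.2) (a + b).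
Proof.
move=> [f [lf sf kf]] [g [lg sg kg]].
exists (fun z => row_mx (f z.1) (g z.2)); split=> [c u v|w|[v w]] /=.
- by rewrite lf lg scale_row_mx add_row_mx.
- have [v hv] := sf (lsubmx w); have [u hu] := sg (rsubmx w).
  by exists (v, u); rewrite /= hv hu hsubmxK.
- rewrite kf kg; split=> [[-> ->]|/eqP]; first by rewrite row_mx0.
  by rewrite row_mx_eq0 => /andP[/eqP -> /eqP ->].
Qed.

Lemma codim_rV n : codim (fun v : 'rV[K]_n => v = 0) n.
Proof. by exists id; split=> // w; exists w. Qed.

Lemma codim_preim (V W : lmodType K) (f : V -> W) (I : W -> Prop) n :
  linear f -> (forall w, exists v, f v = w) -> codim I n -> codim (fun v => I (f v)) n.
Proof.
move=> lf sf [phi [lp sp kp]]; exists (phi \o f); split=> [c u v|w|v] /=; rewrite ?lf ?lp //.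
by have [u <-] := sp w; have [v <-] := sf u; exists v.
Qed.

Lemma codim_submx D k (M : 'M[K]_(k, D)) : codim (fun w : 'rV_D => (w <= M)%MS) (D - \rank M).
Proof.
rewrite -mxrank_coker.
exists (fun w => w *m col_base (cokermx M)); split=> [c u v|w|v].
- by rewrite mulmxDl scalemxAl.
- have /row_fullP [L hL] : row_full (col_base (cokermx M)).
    exact: col_base_full.
  by exists (w *m L); rewrite -mulmxA hL mulmx1.
- rewrite submxE -{1}[cokermx M]mulmx_base mulmxA mulmx_free_eq0 ?row_base_free //.
  by split=> /eqP.
Qed.

End CodimExtra.

(** * Nakayama's lemma relative to a subring *)

Section Nakayama.
(** One statement serves two rings: formal series with [H] everything, and germs, where [O] consists
    of all functions and [H] selects the holomorphic ones. Since germs agree only near 0, [munit]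
    asks for an inverse modulo [I]. *)
Variables (O : comNzRingType) (H m I : O -> Prop).
Hypothesis I0 : I 0.
Hypothesis ID : forall a b, I a -> I b -> I (a + b).
Hypothesis IM : forall a b, H a -> I b -> I (a * b).
Hypothesis H1 : H (-1).
Hypothesis HM : forall a b, H a -> H b -> H (a * b).
Hypothesis mH : forall a, m a -> H a.
Hypothesis mD : forall a b, m a -> m b -> m (a + b).
Hypothesis mM : forall a b, H a -> m b -> m (a * b).
Hypothesis munit : forall a, m a -> exists2 g, H g & forall w, H w -> I (w - g * (1 - a) * w).

(* Eliminates the generators one at a time instead of inverting a matrix. *)
Lemma nakayama_elim r (w : nat -> O) : (forall i, H (w i)) ->
  (forall i, (i < r)%N -> exists2 M : nat -> O, (forall l, m (M l)) &
      I (w i - \sum_(l < r) M l * w l)) ->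
  forall i, (i < r)%N -> I (w i).
Proof.
move=> Hw; elim: r => // r ih hr.
have IB a b : I a -> I b -> I (a - b) by move=> Ia Ib; rewrite -mulN1r; apply: ID; last apply: IM.
have [M hM] := hr r (ltnSn r); rewrite big_ord_recr /= => Ir.
have [g Hg hg] := munit (hM r).
have wr : I (w r - \sum_(l < r) (g * M l) * w l).
  have -> : w r - \sum_(l < r) g * M l * w l = (w r - g * (1 - M r) * w r) +
      g * (w r - (\sum_(i < r) M i * w i + M r * w r)).
    have -> : \sum_(l < r) g * M l * w l = g * \sum_(l < r) M l * w l.
      by rewrite mulr_sumr; apply: eq_bigr => l _; rewrite mulrA.
    ring.
  by apply: ID; [apply: hg | apply: IM].
have wI i : (i < r)%N -> I (w i).
  apply: ih => {}i ir; have [N hN] := hr i (ltnW ir); rewrite big_ord_recr /= => Ii.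
  exists (fun l => N l + N r * g * M l).
    by move=> l; apply: mD => //; apply: mM => //; apply: HM => //; apply: mH.
  have -> : w i - \sum_(l < r) (N l + N r * g * M l) * w l =
    (w i - (\sum_(i0 < r) N i0 * w i0 + N r * w r)) + N r * (w r - \sum_(l < r) g * M l * w l).
    have -> : \sum_(l < r) (N l + N r * g * M l) * w l =
        \sum_(l < r) N l * w l + N r * \sum_(l < r) g * M l * w l.
      by rewrite mulr_sumr -big_split; apply: eq_bigr => l _; rewrite mulrDl !mulrA.
    ring.
  by apply: ID => //; apply: IM => //; apply: mH.
move=> i; rewrite ltnS leq_eqVlt => /orP[/eqP ->|]; last exact: wI.
rewrite -[w r](subrK (\sum_(l < r) (g * M l) * w l)); apply: ID => //.
elim/big_ind: _ => // l _; apply: IM; last exact: wI.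
by apply: HM => //; apply: mH.
Qed.

End Nakayama.

Section Adic.
Variable K : fieldType.
Implicit Types f g h A B : ser K.

(** Every monomial x^a y^b of degree at least k is charged to exactly one generator of degree k, the
    one with i = min(a, k), so no coefficient is counted twice. *)
Lemma word1_decomp k f : word 1 1 k f -> exists r : nat -> ser K,
  f = \sum_(i < k.+1) mono K i (k - i) * r i /\ (word 1 1 k.+1 f -> forall i, word 1 1 1 (r i)).
Proof.
move=> hf; pose r (i : nat) : ser K := fun a b => if ((i <= k) && ((i == k) || (a == 0)))%N
   then f (a + i)%N (b + (k - i))%N else 0.
exists r; split; last first.
  move=> hf1 i a b; rewrite !muln1 ltnS leqn0 addn_eq0 => /andP[/eqP -> /eqP ->].
  rewrite /r; case: ifP => // /andP[ik _].
  by apply: hf1; rewrite !muln1; lia.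
apply: serP => a b; rewrite ser_sumE.
under eq_bigr do rewrite mono_mulE /r.
have [lt|ge] := ltnP (a + b) k.
  rewrite hf ?muln1 // big1 // => i _; case: ifP => // /andP[ia ib].
  by move: lt; have := ltn_ord i; lia.
have hm : (minn a k < k.+1)%N by rewrite ltnS geq_minr.
rewrite (bigD1 (Ordinal hm)) //= big1 ?addr0.
  rewrite ifT; last lia.
  rewrite ifT; last lia.
  by congr (f _ _); lia.
move=> i hi; case: ifP => // /andP[ia ib]; case: ifP => // hh.
case/negP: hi; apply/eqP/val_inj => /=; have := ltn_ord i; lia.
Qed.

(** Nakayama's lemma for the k + 1 monomials of degree k, which generate the k-th power of the
    maximal ideal. *)
Lemma adic_nakayama A B k :
  (forall f, word 1 1 k f -> exists2 g, word 1 1 k.+1 g & ideal2 A B (f - g)) ->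
  forall f, word 1 1 k f -> ideal2 A B f.
Proof.
move=> hk f /word1_decomp [r [-> _]].
have hw : forall i, (i < k.+1)%N -> ideal2 A B (mono K i (k - i)).
  apply: (@nakayama_elim (ser K) (fun=> True) (word 1 1 1)) => //.
  - by exists 0, 0; rewrite !mul0r addr0.
  - exact: ideal2D.
  - by move=> a b _; apply: ideal2M.
  - by move=> a b; apply: wordD.
  - by move=> a b _; apply: wordMl.
  - move=> a ha; have [|g hg] := @ser_unit K (1 - a).
      by rewrite serB (ha 0%N 0%N) // subr0 ser1 oner_neq0.
    by exists g => // w _; rewrite hg mul1r subrr; exists 0, 0; rewrite !mul0r addr0.
  - move=> i ik; have [|g hg hI] := hk (mono K i (k - i)).
      by have := @word_mono K 1 1 i (k - i); rewrite !muln1 subnKC.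
    have [M [eM hM]] := word1_decomp (wordW (leqnSn k) hg).
    exists M; first exact: hM.
    have -> : \sum_(l < k.+1) M l * mono K l (k - l) = g.
      by rewrite eM; apply: eq_bigr => l _; rewrite mulrC.
    exact: hI.
elim/big_ind: _ => [|a b|i _].
- by exists 0, 0; rewrite !mul0r addr0.
- exact: ideal2D.
- by rewrite mulrC; apply: ideal2M; apply: hw.
Qed.

(* In the chain of the images of the powers of the maximal ideal m, either two
   consecutive ones coincide, or the n-th one vanishes. *)
Lemma cd_adic A B n : cd A B n -> forall f, word 1 1 n f -> ideal2 A B f.
Proof.
move=> [phi [l s k]].
have sub j : subspace (fun w => exists2 f, word 1 1 j f & phi f = w).
  split; first by exists 0 => //; exact: linear_fun0.
  move=> c u v [f hf <-] [g hg <-]; exists (c *: f + g); last by rewrite l.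
  by apply: wordD => //; apply: wordZ.
have /choice [M hM] := fun j => subspace_rV (sub j).
have Mle j : (M j.+1 <= M j)%MS.
  apply/row_subP => i; apply/hM; have /hM [f hf e] := row_sub i (M j.+1).
  by exists f => //; apply: wordW hf.
have [/existsP [j hj]|/existsPn hn] := boolP [exists j : 'I_n, \rank (M j) == \rank (M j.+1)].
  move=> f hf; apply: (@adic_nakayama A B j) => [g hg|]; last by apply: wordW hf; apply: ltnW.
  have : (M j <= M j.+1)%MS.
    by have [_ <-] := mxrank_leqif_sup (Mle j); rewrite eq_sym.
  move=> hle; have : (phi g <= M j)%MS by apply/hM; exists g.
  move=> /submx_trans /(_ hle) /hM [h hh e]; exists h => //.
  by apply/k; rewrite (linear_funB l) e subrr.
have hr j : (j <= n)%N -> (\rank (M j) <= n - j)%N.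
  elim: j => [|j ih] jn; first by rewrite subn0 rank_leq_row.
  have := hn (Ordinal jn); have := ih (ltnW jn); have := mxrankS (Mle j) => /=; lia.
move=> f hf; apply/k; have : (phi f <= M n)%MS by apply/hM; exists f.
have := hr n (leqnn n); rewrite subnn leqn0 mxrank_eq0 => /eqP ->.
by rewrite submx0 => /eqP.
Qed.

End Adic.

(** * Semicontinuity and weights *)

Section Semicontinuity.
Variable K : fieldType.
Implicit Types f g h u : ser K.

Definition ix N (l : 'I_#|{: 'I_N * 'I_N}|) : 'I_N * 'I_N := enum_val l.
Definition gx N (k : 'I_#|{: bool * ('I_N * 'I_N)}|) : bool * ('I_N * 'I_N) := enum_val k.

(** A box of exponents rather than a triangle: the index set is a product of ordinals, and the
    kernel still consists of series of order at least N. *)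
Definition trunc N f : 'rV[K]_#|{: 'I_N * 'I_N}| :=
  \row_l f (ix l).1 (ix l).2.

Lemma trunc_linear N : linear (trunc N).
Proof. by move=> c u v; apply/rowP => l; rewrite !mxE. Qed.

Lemma trunc_eq0 N f : trunc N f = 0 <-> forall i j, (i < N)%N -> (j < N)%N -> f i j = 0.
Proof.
split=> [/rowP e i j hi hj|h]; last by apply/rowP => l; rewrite !mxE h.
by have := e (enum_rank (Ordinal hi, Ordinal hj)); rewrite !mxE /ix enum_rankK.
Qed.

Lemma trunc_eq0_word N f : trunc N f = 0 -> word 1 1 N f.
Proof. move/trunc_eq0 => h i j; rewrite !muln1 => hij; apply: h; lia. Qed.

Lemma trunc_surj N w : exists f, trunc N f = w.
Proof.
exists (fun i j => if (insub i, insub j) is (Some i, Some j) then w 0 (enum_rank (i, j)) else 0).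
by apply/rowP => l; rewrite mxE !valK -surjective_pairing /ix enum_valK.
Qed.

Lemma sum_ord_le N i (G : nat -> K) : (i < N)%N ->
  \sum_(a < i.+1) G a = \sum_(a < N) if (a <= i)%N then G a else 0.
Proof. by move=> h; rewrite (big_ord_widen N G h) big_mkcond. Qed.

Lemma trunc_mul N u (A : ser K) :
  trunc N (u * A) = \sum_(x : 'I_N * 'I_N) u x.1 x.2 *: trunc N (mono K x.1 x.2 * A).
Proof.
apply/rowP => l; rewrite summxE mxE serM.
rewrite (@sum_ord_le N _ (fun b => \sum_(a < (ix l).1.+1) u a b * A ((ix l).1 - a)%N
  ((ix l).2 - b)%N)) //.
rewrite -(pair_bigA _ (fun a b : 'I_N => (u a b *: trunc N (mono K a b * A)) 0 l)) /= exchange_big /=.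
apply: eq_bigr => b _.
rewrite (@sum_ord_le N _ (fun a => u a b * A ((ix l).1 - a)%N ((ix l).2 - b)%N)) //.
case: ifP => hb; last by rewrite big1 // => a _; rewrite !mxE mono_mulE hb andbF mulr0.
by apply: eq_bigr => a _; rewrite !mxE mono_mulE hb andbT; case: ifP; rewrite ?mulr0.
Qed.

(** A family of series whose coefficients are polynomials in the parameter, specialized at t. *)
Definition spec (t : K) (A : nat -> nat -> {poly K}) : ser K := fun i j => (A i j).[t].

Definition shiftp (a b : nat) (A : nat -> nat -> {poly K}) i j : {poly K} :=
  if ((a <= i) && (b <= j))%N then A (i - a)%N (j - b)%N else 0.

Lemma horner_shiftp t a b (A : nat -> nat -> {poly K}) i j : (shiftp a b A i j).[t] = (mono K a b * spec t A) i j.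
Proof. by rewrite mono_mulE /shiftp; case: ifP; rewrite ?horner0. Qed.

Variables A B : nat -> nat -> {poly K}.

Definition gens N : 'M[{poly K}]_(#|{: bool * ('I_N * 'I_N)}|, #|{: 'I_N * 'I_N}|) :=
  \matrix_(k, l) shiftp (gx k).2.1 (gx k).2.2 (if (gx k).1 then A else B)
     (ix l).1 (ix l).2.

Definition gens_at N t := map_mx (horner_eval t) (gens N).

Lemma row_gens N t k : row k (gens_at N t) =
  trunc N (mono K (gx k).2.1 (gx k).2.2 * spec t (if (gx k).1 then A else B)).
Proof.
apply/rowP => l; rewrite !mxE /horner_eval horner_shiftp.
by case: (gx k) => -[].
Qed.

(** As the ideal contains all series of order N, membership only depends on the truncation, where it
    becomes a finite system of linear equations. *)
Lemma ideal2_gens N t h : (forall f, word 1 1 N f -> ideal2 (spec t A) (spec t B) f) ->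
  ideal2 (spec t A) (spec t B) h <-> (trunc N h <= gens_at N t)%MS.
Proof.
move=> hN; split=> [[u [v ->]]|].
  rewrite (linear_funD (@trunc_linear N)); apply: addmx_sub; rewrite trunc_mul;
  apply: summx_sub => x _; apply: scalemx_sub.
    by have := row_sub (enum_rank (true, x)) (gens_at N t); rewrite row_gens /gx enum_rankK.
  by have := row_sub (enum_rank (false, x)) (gens_at N t); rewrite row_gens /gx enum_rankK.
move=> /submxP [c e].
pose z : ser K := \sum_k c 0 k *: (mono K (gx k).2.1 (gx k).2.2 *
   spec t (if (gx k).1 then A else B)).
have Iz : ideal2 (spec t A) (spec t B) z.
  apply: (subspace_sum (ideal2_subspace _ _)) => k; apply: ideal2M.
  by case: (gx k).1; [apply: ideal2_l | apply: ideal2_r].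
rewrite -[h](subrK z); apply: ideal2D => //; apply: hN; apply: trunc_eq0_word.
rewrite (linear_funB (@trunc_linear N)) e (linear_sum_fun (@trunc_linear N)) mulmx_sum_row.
by apply/eqP; rewrite subr_eq0; apply/eqP/eq_bigr => k _; rewrite row_gens.
Qed.

Lemma cd_gens N t n : (forall f, word 1 1 N f -> ideal2 (spec t A) (spec t B) f) ->
  cd (spec t A) (spec t B) n ->
  n = (#|{: 'I_N * 'I_N}| - \rank (gens_at N t))%N.
Proof.
move=> hN h; apply: (codim_uniq h).
apply: codim_ext (codim_preim (@trunc_linear N) (@trunc_surj N) (codim_submx (gens_at N t))).
by move=> v; apply: iff_sym; apply: ideal2_gens.
Qed.

(* Upper semicontinuity: the rank of the truncated generators is lower
   semicontinuous in the parameter. *)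
Lemma cd_semicontinuous n m : cd (spec 0 A) (spec 0 B) n ->
  (forall P : {poly K}, P != 0 -> exists2 t, P.[t] != 0 & cd (spec t A) (spec t B) m) ->
  (m <= n)%N.
Proof.
(* By [cd_adic] a single N serves both parameter values, because it dominates both codimensions. *)
move=> c0 ct; pose N := maxn n m.
(* L and R cut out an invertible minor of maximal size at 0; its determinant P is a polynomial in t,
   and where P does not vanish the rank is at least as large. *)
have [L [R eLR]] : exists L R, L *m gens_at N 0 *m R = 1%:M :> 'M[K]_(\rank (gens_at N 0)).
  have /row_fullP [L hL] := col_base_full (gens_at N 0).
  have /row_freeP [R hR] := row_base_free (gens_at N 0).
  exists L, R.
  transitivity (L *m (col_base (gens_at N 0) *m row_base (gens_at N 0)) *m R).
    by rewrite mulmx_base.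
  by rewrite mulmxA hL mul1mx hR.
pose P := \det (map_mx polyC L *m gens N *m map_mx polyC R).
have hP t : P.[t] = \det (L *m gens_at N t *m R).
  rewrite -[P.[t]]/(horner_eval t P) /P -det_map_mx !map_mxM /=; congr (\det (_ *m _ *m _)).
    by apply/matrixP => i j; rewrite !mxE /horner_eval hornerC.
  by apply/matrixP => i j; rewrite !mxE /horner_eval hornerC.
have P0 : P != 0.
  by apply/eqP => e; have := hP 0; rewrite e horner0 eLR det1 => /eqP; rewrite eq_sym oner_eq0.
have [t Pt ctt] := ct P P0.
have hr : (\rank (gens_at N 0) <= \rank (gens_at N t))%N.
  have : row_free (L *m gens_at N t *m R) by rewrite row_free_unit unitmxE unitfE -hP.
  move=> /eqP <-; apply: leq_trans (mxrankM_maxl _ _) _; exact: mxrankM_maxr.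
rewrite (@cd_gens N _ _ _ ctt); last first.
  by move=> f hf; apply: (cd_adic ctt); apply: wordW hf; rewrite leq_maxr.
rewrite (@cd_gens N _ _ _ c0); last first.
  by move=> f hf; apply: (cd_adic c0); apply: wordW hf; rewrite leq_maxl.
exact: leq_sub2l.
Qed.

Variables w1 w2 : nat.

Definition dilate (t : K) f : ser K := fun i j => t ^+ (i * w1 + j * w2) * f i j.

Lemma dilateM t f g : dilate t (f * g) = dilate t f * dilate t g.
Proof.
apply: serP => i j; rewrite /dilate !serM mulr_sumr; apply: eq_bigr => b _.
rewrite mulr_sumr; apply: eq_bigr => a _; rewrite mulrACA -exprD; congr (_ ^+ _ * _).
have := ltn_ord a; have := ltn_ord b; rewrite !ltnS => h1 h2.
by rewrite addnACA -!mulnDl !subnKC.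
Qed.

Lemma dilateD t f g : dilate t (f + g) = dilate t f + dilate t g.
Proof. by apply: serP => i j; rewrite serD /dilate serD mulrDr. Qed.

Lemma dilateZ t c f : dilate t (c *: f) = c *: dilate t f.
Proof. by apply: serP => i j; rewrite serZ /dilate serZ mulrCA. Qed.

Lemma dilateK t f : t != 0 -> dilate t^-1 (dilate t f) = f.
Proof. by move=> t0; apply: serP => i j; rewrite /dilate mulrA -exprMn mulVf // expr1n mul1r. Qed.

Lemma ideal2_dilate t f g h : ideal2 f g h -> ideal2 (dilate t f) (dilate t g) (dilate t h).
Proof. by move=> [u [v ->]]; exists (dilate t u), (dilate t v); rewrite dilateD !dilateM. Qed.

Lemma cd_dilate t f g n : t != 0 -> cd f g n -> cd (dilate t f) (dilate t g) n.
Proof.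
move=> t0 [phi [l s k]].
have t0' : t^-1 != 0 by rewrite invr_eq0.
have K' h : dilate t (dilate t^-1 h) = h by rewrite -{1}[t]invrK dilateK.
exists (fun h => phi (dilate t^-1 h)); split=> [c u v|w|v].
- by rewrite dilateD dilateZ l.
- by have [v <-] := s w; exists (dilate t v); rewrite dilateK.
- rewrite -k; split=> h; first by have := ideal2_dilate t^-1 h; rewrite !dilateK.
  by have := ideal2_dilate t h; rewrite K'.
Qed.

End Semicontinuity.

(** * A lower bound for intersection numbers in terms of weights *)

Section Counting.
Variable K : fieldType.
Implicit Types f g h u A B : ser K.

Lemma codim_word w1 w2 N : (0 < w1)%N -> (0 < w2)%N -> exists D, codim (@word K w1 w2 N) D.
Proof.
move=> h1 h2.
pose cut f : ser K := fun i j => if (i * w1 + j * w2 < N)%N then f i j else 0.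
have [||r _ c] := @codim_corestrict K (ser K) _ (fun f => trunc N (cut f)) (@word K w1 w2 N); last by exists r.
  move=> c u v; rewrite -(trunc_linear N); congr trunc; apply: serP => i j.
  by rewrite serD serZ /cut; case: ifP; rewrite ?serD ?mulr0 ?addr0.
move=> f; rewrite trunc_eq0; split=> [h i j _ _|h i j hij].
  by rewrite /cut; case: ifP => // /h.
have := h i j; rewrite /cut hij; apply.
  by apply: leq_ltn_trans hij; apply: leq_trans (leq_addr _ _); rewrite leq_pmulr.
by apply: leq_ltn_trans hij; apply: leq_trans (leq_addl _ _); rewrite leq_pmulr.
Qed.

(* The monomials of weight < a*w1 + b*w2 split into the box i < a, j < b, the
   multiples of x^a and the multiples of y^b. *)
Lemma cd_ge w1 w2 a b A B n : (0 < w1)%N -> (0 < w2)%N ->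
  word w1 w2 (a * w1) A -> word w1 w2 (b * w2) B -> cd A B n -> (a * b <= n)%N.
Proof.
move=> h1 h2 hA hB cAB.
have [e he] := (proj1 (codimP _ (ideal2_subspace A B))) cAB.
have [D1 c1] := codim_word (b * w2) h1 h2.
have [D2 c2] := codim_word (a * w1) h1 h2.
have cI := codim_prod (codim_rV K n) (codim_prod c1 c2).
pose V := ('rV[K]_n * (ser K * ser K))%type.
(* [comb] is onto. A multiplier of A matters only modulo weight b w2, one of B only modulo weight a
   w1. Comparing with the series modulo weight a w1 + b w2 gives ab + D1 + D2 <= n + D1 + D2. *)
pose comb (z : V) : ser K := \sum_(i < n) z.1 0 i *: e i + (z.2.1 * A + z.2.2 * B).
have lcomb : linear comb.
  move=> c [z1 [z2 z3]] [y1 [y2 y3]]; rewrite /comb /=.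
  rewrite scalerDr scaler_sumr addrACA -big_split /=; congr (_ + _).
    by apply: eq_bigr => i _; rewrite !mxE scalerDl scalerA.
  by rewrite !mulrDl -!scalerAl scalerDr addrACA.
have scomb h : exists z, comb z = h.
  have [c [[u [v e1]] _]] := he h; exists (\row_i c i, (u, v)).
  rewrite /comb /= -e1; under eq_bigr do rewrite mxE; by rewrite addrC subrK.
have cbox : codim (fun M : 'M[K]_(a, b) => M = 0) (a * b).
  exists mxvec; split=> [c u v|w|v]; first exact: linearP.
    by exists (vec_mx w); rewrite vec_mxK.
  by split=> [->|/eqP]; rewrite ?linear0 // mxvec_eq0 => /eqP.
pose parts (h : ser K) : 'M[K]_(a, b) * (ser K * ser K) :=
  (\matrix_(i < a, j < b) h i j, ((fun i j => h (a + i)%N j) : ser K, (fun i j => h i (b + j)%N) : ser K)).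
have lparts : linear parts.
  by move=> c u v; rewrite /parts; congr (_, _); apply/matrixP => i j; rewrite !mxE.
pose J (z : 'M[K]_(a, b) * (ser K * ser K)) :=
  z.1 = 0 /\ word w1 w2 (b * w2) z.2.1 /\ word w1 w2 (a * w1) z.2.2.
have cJ : codim J (a * b + (D1 + D2)) by apply: codim_prod cbox (codim_prod c1 c2).
(* The three regions of exponents do not overlap: weight below b w2 forces j < b and weight below a
   w1 forces i < a. Hence [parts] is onto modulo [J]. *)
have sparts (z : 'M[K]_(a, b) * (ser K * ser K)) : exists h, J (parts h - z).
  case: z => M [u v].
  exists (fun i j => if insub i is Some i' then if insub j is Some j' then M i' j' 
                     else v i (j - b)%N else if ((i - a) * w1 + j * w2 < b * w2)%N then u (i - a)%N j
                       else v i (j - b)%N).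
  split; first by apply/matrixP => i j; rewrite !mxE !valK subrr.
  split=> i j hij; rewrite /= serB.
    by rewrite insubN -?leqNgt ?leq_addr // addKn hij subrr.
  have ia : (i < a)%N.
    rewrite -(ltn_pmul2r h1); apply: leq_ltn_trans hij; exact: leq_addr.
  by rewrite (insubT (fun k => k < a)%N ia) insubN -?leqNgt ?leq_addr // addKn subrr.
have cP : codim (fun h => J (parts h)) (a * b + (D1 + D2)).
  have [phi [l s k]] := cJ; exists (phi \o parts); split=> [c u v|w|v] /=; rewrite ?lparts ?l //.
  have [z <-] := s w; have [h /k hh] := sparts z; exists h => /=.
  by apply/eqP; rewrite -subr_eq0 -(linear_funB l) hh.
have := codim_sub _ cI (codim_preim lcomb scomb cP).
rewrite [(n + _)%N]addnC [(a * b + _)%N]addnC leq_add2l; apply.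
move=> [c [u v]] /= [-> [hu hv]].
have hw : word w1 w2 (a * w1 + b * w2) (comb (0, (u, v))).
  rewrite /comb /= big1 ?add0r => [|i _]; last by rewrite mxE scale0r.
  by apply: wordD; [rewrite addnC|]; apply: wordM.
split; first by apply/matrixP => i j; rewrite !mxE hw //; have := ltn_ord i; have := ltn_ord j; nia.
by split=> i j hij /=; apply: hw; nia.
Qed.

End Counting.

(** * The substitution x = X^q, y = Y^p *)

Section Pullback.
Variable K : fieldType.
Implicit Types f g h u A B : ser K.
Variables q p : nat.
Hypotheses (q0 : (0 < q)%N) (p0 : (0 < p)%N).

(* Substitution x := X^q, y := Y^p. *)
Definition pb f : ser K := fun i j => if ((q %| i) && (p %| j))%N then f (i %/ q)%N (j %/ p)%N else 0.

(** Coordinate of h at X^a Y^b: the ring is free over the image of [pb] on the monomials with a < q,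
    b < p. *)
Definition part a b h : ser K := fun i j => h (q * i + a)%N (p * j + b)%N.

Lemma sum_multiples n i a (G : nat -> K) : (0 < n)%N -> (a < n)%N ->
  \sum_(k < (n * i + a).+1) (if (n %| k)%N then G k else 0) = \sum_(c < i.+1) G (n * c)%N.
Proof.
move=> n0 an.
have blk r c : (0 < r <= n)%N ->
    \sum_(k < r) (if (n %| n * c + k)%N then G (n * c + k)%N else 0) = G (n * c)%N.
  case: r => // r /andP[_ rn]; rewrite big_ord_recl /= addn0 dvdn_mulr // big1 ?addr0 // => k _.
  rewrite ifF // dvdn_addr ?dvdn_mulr //; apply/negbTE; rewrite gtnNdvd //=.
  by rewrite /bump /= add1n; apply: leq_trans rn; rewrite ltnS.
rewrite -addnS big_split_ord /= blk; last by rewrite ltn0Sn.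
rewrite big_ord_recr /=; congr (_ + _).
elim: i => [|i ih]; first by rewrite muln0 !big_ord0.
rewrite mulnS addnC big_split_ord /= blk ?n0 ?leqnn // ih.
by rewrite big_ord_recr.
Qed.

Lemma part_mul a b f u : (a < q)%N -> (b < p)%N -> part a b (pb f * u) = f * part a b u.
Proof.
move=> aq bp; apply: serP => i j; rewrite /part serM.
pose G l k := f (k %/ q)%N (l %/ p)%N * u (q * i + a - k)%N (p * j + b - l)%N.
pose H l := \sum_(c < i.+1) G l (q * c)%N.
transitivity (\sum_(l < (p * j + b).+1) if (p %| l)%N then H l else 0).
  apply: eq_bigr => l _; rewrite /H -(@sum_multiples q i a (G l)) //.
  case: ifP => hl; last by rewrite big1 // => k _; rewrite /pb hl andbF mul0r.
  by apply: eq_bigr => k _; rewrite /pb hl andbT; case: ifP; rewrite ?mul0r.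
rewrite sum_multiples // serM; apply: eq_bigr => d _; apply: eq_bigr => c _.
rewrite /G !mulKn //; congr (_ * u _ _); have := ltn_ord c; have := ltn_ord d; rewrite !ltnS => h1 h2.
  by rewrite mulnBr addnBAC // leq_mul2l h2 orbT.
by rewrite mulnBr addnBAC // leq_mul2l h1 orbT.
Qed.

Lemma part_pb f : part 0 0 (pb f) = f.
Proof. by apply: serP => i j; rewrite /part /pb !addn0 !dvdn_mulr // !mulKn. Qed.

Lemma part_pb0 a b f : (a < q)%N -> (b < p)%N -> (a != 0)%N || (b != 0)%N -> part a b (pb f) = 0.
Proof.
move=> aq bp ab; apply: serP => i j; rewrite /part /pb !dvdn_addr ?dvdn_mulr //.
rewrite ifF //; apply/negbTE; rewrite negb_and.
case/orP: ab => h; apply/orP; [left|right]; rewrite gtnNdvd // lt0n //.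
Qed.

Lemma pb_eqP f g : (forall a b, (a < q)%N -> (b < p)%N -> part a b f = part a b g) -> f = g.
Proof.
move=> h; apply: serP => i j.
have := congr1 (fun k : ser K => k (i %/ q)%N (j %/ p)%N) (h (i %% q)%N (j %% p)%N (ltn_pmod _ q0) (ltn_pmod _ p0)).
by rewrite /part ![(_ * (_ %/ _))%N]mulnC -!divn_eq.
Qed.

Lemma pbM f g : pb (f * g) = pb f * pb g.
Proof.
apply: pb_eqP => a b aq bp; rewrite part_mul //.
have [ab|] := boolP ((a != 0) || (b != 0))%N; first by rewrite !part_pb0 ?mulr0.
by rewrite negb_or !negbK => /andP[/eqP -> /eqP ->]; rewrite !part_pb.
Qed.

Lemma pbD f g : pb (f + g) = pb f + pb g.
Proof. by apply: serP => i j; rewrite serD /pb serD; case: ifP; rewrite ?addr0. Qed.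

Lemma pbZ c f : pb (c *: f) = c *: pb f.
Proof. by apply: serP => i j; rewrite serZ /pb serZ; case: ifP; rewrite ?mulr0. Qed.

Lemma partD a b f g : part a b (f + g) = part a b f + part a b g. Proof. by []. Qed.
Lemma partZ a b c f : part a b (c *: f) = c *: part a b f. Proof. by []. Qed.

Lemma pb_decomp f : f = \sum_(a < q) \sum_(b < p) mono K a b * pb (part a b f).
Proof.
apply: serP => i j; rewrite ser_sumE.
have hi := ltn_pmod i q0; have hj := ltn_pmod j p0.
rewrite (bigD1 (Ordinal hi)) //= [X in _ + X]big1 ?addr0 => [|a ha]; last first.
  rewrite ser_sumE big1 // => b _; rewrite mono_mulE /pb; case: ifP => // /andP[ai bj].
  case: ifP => // /andP[qa _]; case/negP: ha; apply/eqP/val_inj => /=.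
  by rewrite -(subnK ai) -modnDml (eqP qa) add0n modn_small.
rewrite ser_sumE (bigD1 (Ordinal hj)) //= [X in _ + X]big1 ?addr0 => [|b hb]; last first.
  rewrite mono_mulE /pb; case: ifP => // /andP[ai bj].
  case: ifP => // /andP[_ pb]; case/negP: hb; apply/eqP/val_inj => /=.
  by rewrite -(subnK bj) -modnDml (eqP pb) add0n modn_small.
have ei : (i - i %% q = q * (i %/ q))%N by rewrite {1}(divn_eq i q) addnK mulnC.
have ej : (j - j %% p = p * (j %/ p))%N by rewrite {1}(divn_eq j p) addnK mulnC.
rewrite mono_mulE !leq_mod /= /pb ei ej !dvdn_mulr //= !mulKn // /part.
by rewrite -ei -ej !subnK ?leq_mod.
Qed.

(** By freeness, membership in an extended ideal can be tested on each coordinate; freeness of rank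
    qp also explains the factor in [cd_pb]. *)
Lemma ideal2_pb A B h : ideal2 (pb A) (pb B) h <->
  forall a b, (a < q)%N -> (b < p)%N -> ideal2 A B (part a b h).
Proof.
split=> [[u [v ->]] a b aq bp|hab].
  exists (part a b u), (part a b v).
  by rewrite partD mulrC [v * _]mulrC !part_mul // ![_ * part _ _ _]mulrC.
rewrite [h]pb_decomp.
elim/big_ind: _ => [|x y|a _]; [by exists 0, 0; rewrite !mul0r addr0 | exact: ideal2D |].
elim/big_ind: _ => [|x y|b _]; [by exists 0, 0; rewrite !mul0r addr0 | exact: ideal2D |].
apply: ideal2M; have [u [v ->]] := hab a b (ltn_ord a) (ltn_ord b).
by exists (pb u), (pb v); rewrite pbD !pbM.
Qed.

Lemma cd_pb A B n : cd A B n -> cd (pb A) (pb B) (q * p * n).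
Proof.
move=> [phi [l s k]].
pose M h : 'M[K]_(q * p, n) := \matrix_k phi (part (k %/ p) (k %% p) h).
have kq (x : 'I_(q * p)) : (x %/ p < q)%N by rewrite ltn_divLR.
have idx a b : (a < q)%N -> (b < p)%N -> (a * p + b < q * p)%N.
  by move=> aq bp; rewrite -(ltn_add2l (p - b)); nia.
exists (fun h => mxvec (M h)); split.
- move=> c u v; rewrite -linearP; congr mxvec; apply/row_matrixP => a.
  by rewrite linearP /= !rowK partD partZ l.
- move=> w; have /choice [h hh] : forall x : 'I_(q * p), exists h, phi h = row x (vec_mx w).
    by move=> x; apply: s.
  exists (fun i j => h (Ordinal (idx _ _ (ltn_pmod i q0) (ltn_pmod j p0))) (i %/ q)%N (j %/ p)%N).
  rewrite -[RHS]vec_mxK; congr mxvec; apply/row_matrixP => x; rewrite rowK -hh.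
  congr phi; apply: serP => i j; rewrite /part.
  have -> : Ordinal (idx _ _ (ltn_pmod (q * i + x %/ p) q0) (ltn_pmod (p * j + x %% p) p0)) = x.
    apply: val_inj => /=; rewrite [(q * i)%N]mulnC [(p * j)%N]mulnC !modnMDl modn_mod.
    by rewrite modn_small // -divn_eq.
  rewrite [(q * i)%N]mulnC [(p * j)%N]mulnC !divnMDl // [(x %/ p %/ q)%N]divn_small //.
  by rewrite [(x %% p %/ p)%N]divn_small ?ltn_pmod // !addn0.
- move=> h; rewrite (ideal2_pb A B h); split=> [hab|/eqP].
    apply/eqP; rewrite mxvec_eq0; apply/eqP/row_matrixP => x.
    by rewrite rowK row0; apply/k/hab => //; rewrite ltn_pmod.
  rewrite mxvec_eq0 => /eqP e a b aq bp.
  have := congr1 (row (Ordinal (idx a b aq bp))) e; rewrite rowK row0 /=.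
  by rewrite divnMDl // divn_small // addn0 modnMDl modn_small // => /k.
Qed.

(** [pb] is injective on the quotients, so finiteness descends; the factor is then forced by
    uniqueness of the codimension. *)
Lemma cd_pb_inv A B N : cd (pb A) (pb B) N -> exists2 n, cd A B n & N = (q * p * n)%N.
Proof.
move=> c; have [phi [l s k]] := c.
have [||n _ cn] := @codim_corestrict K (ser K) _ (fun h => phi (pb h)) (ideal2 A B).
- by move=> x u v; rewrite pbD pbZ l.
- move=> h; rewrite -k ideal2_pb; split=> [hh a b aq bp|].
    have [ab|] := boolP ((a != 0) || (b != 0))%N.
      by rewrite part_pb0 //; exists 0, 0; rewrite !mul0r addr0.
    by rewrite negb_or !negbK => /andP[/eqP -> /eqP ->]; rewrite part_pb.
  by move=> /(_ 0%N 0%N q0 p0); rewrite part_pb.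
by exists n => //; apply: (codim_uniq c); apply: cd_pb.
Qed.

End Pullback.

(** * Milnor numbers of deformations of quasihomogeneous series *)

Section Euler.
Variable K : fieldType.
Implicit Types f g h u A B : ser K.

Definition thx f : ser K := fun i j => i%:R * f i j.
Definition thy f : ser K := fun i j => j%:R * f i j.

Lemma thxD f g : thx (f + g) = thx f + thx g.
Proof. by apply: serP => i j; rewrite serD /thx serD mulrDr. Qed.
Lemma thyD f g : thy (f + g) = thy f + thy g.
Proof. by apply: serP => i j; rewrite serD /thy serD mulrDr. Qed.

Lemma thx_form d P : thx (form d P) = form d ('X * P^`()).
Proof.
apply: serP => i j; rewrite /thx /form; case: ifP => _; last by rewrite mulr0.
rewrite coefXM; case: i => [|i] /=; first by rewrite mul0r.
by rewrite coef_deriv mulr_natl.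
Qed.

Lemma th_form d P : thx (form d P) + thy (form d P) = d%:R *: form d P.
Proof.
apply: serP => i j; rewrite serD serZ /thx /thy /form -mulrDl -natrD.
by case: eqP => [->|]; rewrite ?mulr0.
Qed.

Lemma size_theta d (P : {poly K}) : (size P <= d.+1)%N -> (size ('X * P^`())%R <= d.+1)%N.
Proof.
move=> h; have [->|P0] := eqVneq P^`() 0; first by rewrite mulr0 size_poly0.
rewrite mulrC size_mulX //; apply: leq_trans _ h.
rewrite lt_size_deriv //; apply: contraNneq P0 => ->; by rewrite deriv0.
Qed.

Lemma rs_formE w d (P : {poly K}) n : (size P <= d.+1)%N ->
  rs w (form d P) n = if n == d then P.[w] else 0.
Proof. by move=> h; rewrite /rs hom_form //; case: ifP; rewrite ?horner0. Qed.

End Euler.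

(** * The intersection number for a sum of two forms *)

Section TwoForms.
Variable K : numClosedFieldType.
Variables (W e : nat) (Phi Gam : {poly K}).
Hypotheses (e0 : (0 < e)%N) (eW : (e < W)%N).
Hypotheses (szPhi : size Phi = W.+1) (Phi0 : Phi.[0] != 0).
Hypothesis sqfree : forall v, root Phi v -> Phi^`().[v] != 0.
Hypotheses (Gam0 : Gam != 0) (szGam : (size Gam <= e.+1)%N).

Definition Kp : {poly K} := 'X * (W%:R *: (Phi * Gam^`()) - e%:R *: (Gam * Phi^`())).

Lemma KpE : Kp = 'X * (W%:R%:P * (Phi * Gam^`()) - e%:R%:P * (Gam * Phi^`())).
Proof. by rewrite /Kp !mul_polyC. Qed.

(** At v the logarithmic derivative W Gam'/Gam - e Phi'/Phi has a simple pole with residue W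
    mult(Gam) - e mult(Phi). This is nonzero, as mult(Phi) <= 1 and e < W. Multiplying back by X Phi
    Gam costs at most one extra order, since X and Phi have no common zero. *)
Lemma mup_Kp v : root Gam v -> Kp != 0 /\ (mup v Kp <= mup v Gam)%N.
Proof.
move=> Gv.
have [a [U [a0 hU eG]]] : exists a U, [/\ (0 < a)%N, ~~ root U v & Gam = U * ('X - v%:P) ^+ a].
  have [a [U]] := multiplicity_XsubC Gam v; rewrite Gam0 /= => hU eG.
  exists a, U; split=> //.
  by case: a eG => // eG; move: Gv; rewrite eG expr0 mulr1 (negPf hU).
have X0 k : ('X - v%:P) ^+ k != 0 :> {poly K} by rewrite expf_neq0 // polyXsubC_eq0.
suff [b [R [ba hR eK]]] : exists b R, [/\ (b <= a)%N, ~~ root R v & Kp = R * ('X - v%:P) ^+ b].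
  split; first by rewrite eK mulf_neq0 //; apply: contraNneq hR => ->; rewrite root0.
  by rewrite eK eG !mupMr // !mup_XsubCX !eqxx.
case: a a0 eG => // a _ eG.
have dG : Gam^`() = (U * a.+1%:R%:P + U^`() * ('X - v%:P)) * ('X - v%:P) ^+ a.
  rewrite eG derivM deriv_exp derivXsubC mul1r /= -mulr_natr exprS -polyC_natr; ring.
pose T := W%:R%:P * (Phi * (U * a.+1%:R%:P + U^`() * ('X - v%:P))) - e%:R%:P * (('X - v%:P) * U * Phi^`()).
have eT : Kp = 'X * T * ('X - v%:P) ^+ a by rewrite KpE dG eG exprS /T; ring.
have W0 : W%:R != 0 :> K by rewrite pnatr_eq0 -lt0n (leq_trans e0) // ltnW.
have a0 : a.+1%:R != 0 :> K by rewrite pnatr_eq0.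
have Uv : U.[v] != 0 by [].
have Tv : T.[v] = W%:R * (Phi.[v] * (U.[v] * a.+1%:R)).
  by rewrite /T !(hornerD, hornerN, hornerM, hornerC, hornerX) subrr !(mul0r, mulr0) subr0 addr0.
have [v0|v0] := eqVneq v 0.
  exists a.+1, T; split=> //; last by rewrite eT exprS -{1}['X]subr0 -polyC0 -v0; ring.
  by rewrite rootE Tv !mulf_neq0 // v0.
have [Pv|Pv] := boolP (root Phi v); last first.
  exists a, ('X * T); split=> //.
  by rewrite rootE hornerM hornerX Tv !mulf_neq0.
have [Psi ePsi] := factor_theorem _ _ Pv.
have PsiE : Phi^`().[v] = Psi.[v] by rewrite ePsi derivM derivXsubC !(hornerD, hornerN, hornerM, hornerC, hornerX) subrr mulr0 add0r mulr1.
pose T' := W%:R%:P * (Psi * (U * a.+1%:R%:P + U^`() * ('X - v%:P))) - e%:R%:P * (U * Phi^`()).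
exists a.+1, ('X * T'); split=> //; last first.
  rewrite eT exprS; have -> : T = ('X - v%:P) * T' by rewrite /T /T' ePsi; ring.
  by ring.
rewrite rootE hornerM hornerX mulf_neq0 //.
have -> : T'.[v] = Psi.[v] * U.[v] * (W%:R * a.+1%:R - e%:R).
  rewrite /T' !(hornerD, hornerN, hornerM, hornerC, hornerX) PsiE subrr mulr0 addr0; ring.
rewrite !mulf_neq0 -?PsiE ?sqfree // subr_eq0 -natrM eqr_nat; apply/eqP; nia.
Qed.

Lemma size_mul_top (P Q : {poly K}) a b : (size P <= a.+1)%N -> (size Q <= b.+1)%N ->
  (size (P * Q)%R <= (a + b).+1)%N.
Proof. by move=> hP hQ; rewrite (leq_trans (size_polyMleq _ _)) //; lia. Qed.

Lemma coef_mul_top (P Q : {poly K}) a b : (size P <= a.+1)%N -> (size Q <= b.+1)%N ->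
  (P * Q)`_(a + b) = P`_a * Q`_b.
Proof.
move=> hP hQ; have ha : (a < (a + b).+1)%N by rewrite ltnS leq_addr.
rewrite coefM (bigD1 (Ordinal ha)) //= addKn big1 ?addr0 // => i hi.
have : (i : nat) != a by apply: contra hi => /eqP h; apply/eqP/val_inj.
rewrite neq_ltn => /orP[h|h].
  by rewrite [X in _ * X]nth_default ?mulr0 //; apply: leq_trans hQ _; have := ltn_ord i; lia.
by rewrite nth_default ?mul0r // (leq_trans hP).
Qed.

(** The analogue of [mup_Kp] at infinity: if deg Gam is not e, then Kp has degree W + deg Gam, so as
    forms of degrees W + e and e both contain the same power of y. *)
Lemma coef_Kp k : (size Gam <= k.+1)%N ->
  Kp`_(W + k) = W%:R * Phi`_W * Gam`_k * (k%:R - e%:R).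
Proof.
move=> hk.
have coefT (P : {poly K}) n : ('X * P^`())`_n = n%:R * P`_n.
  by rewrite coefXM; case: n => [|n] /=; rewrite ?mul0r // coef_deriv mulr_natl.
have -> : Kp = W%:R%:P * (Phi * ('X * Gam^`())) - e%:R%:P * (('X * Phi^`()) * Gam).
  by rewrite KpE; ring.
rewrite coefB !coefCM !coef_mul_top ?szPhi ?size_theta ?szPhi // !coefT; ring.
Qed.

Lemma Kp_neq0 : Kp != 0.
Proof.
have [ge0|ge0] := eqVneq Gam`_e 0; last first.
  have sG : (size Gam != 1)%N.
    apply: contraNneq ge0 => h; by rewrite nth_default // h.
  have [v hv] := closed_rootP _ sG.
  by have [] := mup_Kp hv.
have sg : (0 < size Gam)%N by rewrite size_poly_gt0.
have sge : (size Gam).-1 != e.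
  apply: contraNneq Gam0 => h; by rewrite -lead_coef_eq0 lead_coefE h ge0.
apply/eqP => K0; have := @coef_Kp (size Gam).-1; rewrite prednK // leqnn K0 coef0 => /(_ isT) /eqP.
rewrite eq_sym !mulf_eq0 -!lead_coefE lead_coef_eq0 (negPf Gam0) orbF.
have -> : Phi`_W = lead_coef Phi by rewrite lead_coefE szPhi.
rewrite lead_coef_eq0 -size_poly_eq0 szPhi /= orbF pnatr_eq0 subr_eq0 eqr_nat (negPf sge) orbF.
by rewrite -leqn0 leqNgt (leq_trans _ eW).
Qed.

Lemma mup_roots (c : K) (rs : seq K) v : c != 0 ->
  mup v (c *: \prod_(z <- rs) ('X - z%:P)) = count_mem v rs.
Proof.
move=> c0; rewrite -mul_polyC mupMr ?rootC //.
elim: rs => [|r s ih]; first by rewrite big_nil mupNroot // root1.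
rewrite big_cons mupM ?polyXsubC_eq0 ?monic_neq0 ?monic_prod_XsubC // ih /=.
by rewrite -['X - r%:P]expr1 mup_XsubCX eq_sym; case: eqP.
Qed.

Lemma fresh_nat (L : seq K) : exists c : nat, c%:R \notin L.
Proof.
apply: contrapT => /forallNP h.
have : uniq [seq n%:R : K | n <- iota 0 (size L).+1].
  by rewrite map_inj_uniq ?iota_uniq // => a b /eqP; rewrite eqr_nat => /eqP.
move=> /uniq_leq_size hh; have := hh L; rewrite size_map size_iota ltnn => {}hh.
suff : false by []; apply: hh => x /mapP [n _ ->]; by have /negP := h n; rewrite negbK.
Qed.

(** A common zero v of the two combinations is a zero of their determinant Kp, which does not depend
    on c. Each of the finitely many roots of Kp rules out at most one c. A natural c keeps 1 + c
    nonzero, which preserves leading coefficients later. *)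
Lemma generic_direction : exists c : nat, forall v,
  (W%:R *: Phi + c%:R *: ('X * Phi^`())).[v] = 0 ->
  (e%:R *: Gam + c%:R *: ('X * Gam^`())).[v] != 0.
Proof.
have [rs eK] := closed_field_poly_normal Kp.
have [c hc] := fresh_nat [seq - (W%:R * Phi.[v]) / (v * Phi^`().[v]) | v <- rs].
exists c => v; rewrite !(hornerD, hornerZ, hornerM, hornerX) => h1; apply/eqP => h2.
have rK : root Kp v.
  rewrite rootE KpE !(hornerD, hornerN, hornerM, hornerC, hornerX).
  apply/eqP; transitivity ((W%:R * Phi.[v] + c%:R * (v * Phi^`().[v])) * (v * Gam^`().[v]) -
    (e%:R * Gam.[v] + c%:R * (v * Gam^`().[v])) * (v * Phi^`().[v])); first by ring.
  by rewrite h1 h2 !mul0r subr0.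
have vrs : v \in rs.
  by move: rK; rewrite eK rootZ ?lead_coef_eq0 ?Kp_neq0 // root_prod_XsubC.
have [z|nz] := eqVneq (v * Phi^`().[v]) 0.
  move: h1; rewrite z mulr0 addr0 => /eqP; rewrite mulf_eq0 pnatr_eq0 -leqn0 leqNgt (leq_trans _ eW) //=.
  move=> Pv; move/eqP: z; rewrite mulf_eq0 (negPf (sqfree Pv)) orbF => /eqP v0.
  by move: Pv; rewrite v0 (negPf Phi0).
case/negP: hc; apply/mapP; exists v => //.
apply: (mulIf nz); rewrite divfK //; apply/eqP; rewrite -subr_eq0 opprK addrC; exact/eqP.
Qed.

Lemma two_ord (a : nat -> K) x y : (forall n, a n = (if n == W then x else 0) + (if n == e then y else 0)) ->
  (y = 0 -> x != 0) -> has_ord a (if y == 0 then W else e).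
Proof.
move=> ha hxy; have nWe : W == e = false by apply/negbTE/eqP; lia.
case: eqP => [y0|/eqP y0]; split=> [|k kn].
- by rewrite ha eqxx nWe addr0 hxy.
- by rewrite ha y0 if_same addr0 ifF //; apply/eqP; lia.
- by rewrite ha eqxx [e == W]eq_sym nWe add0r.
- by rewrite ha !ifF ?addr0 //; apply/eqP; lia.
Qed.

(** With A a generic combination and B = x f_x, the product of B with the lower part of A is, up to
    sign and modulo A, the form of Kp. Hence the intersection number of A and B is the difference of
    two numbers that count orders of A along lines. *)
Lemma cd_two_forms : exists2 n, (n <= W * e)%N &
  cd (thx (form W Phi + form e Gam)) (thy (form W Phi + form e Gam)) n.
Proof.
have [c hc] := generic_direction.
pose P0 := W%:R *: Phi + c%:R *: ('X * Phi^`()).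
pose Pg := e%:R *: Gam + c%:R *: ('X * Gam^`()).
pose Q0 := 'X * Phi^`(). pose Qg := 'X * Gam^`().
have sP : (size Phi <= W.+1)%N by rewrite szPhi.
have sQ0 : (size Q0 <= W.+1)%N by apply: size_theta.
have sQg : (size Qg <= e.+1)%N by apply: size_theta.
have sP0 : (size P0 <= W.+1)%N.
  by rewrite (leq_trans (size_polyD _ _)) // geq_max !(leq_trans (size_scale_leq _ _)).
have sPg : (size Pg <= e.+1)%N.
  by rewrite (leq_trans (size_polyD _ _)) // geq_max !(leq_trans (size_scale_leq _ _)).
pose A := form W P0 + form e Pg.
pose B := form W Q0 + form e Qg.
have eB : thx (form W Phi + form e Gam) = B by rewrite thxD !thx_form.
have eA : A = (1 + c%:R)%:A * thx (form W Phi + form e Gam) + thy (form W Phi + form e Gam).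
  rewrite scalerDl scale1r mulrDl mul1r mulr_algl addrAC.
  have -> : thx (form W Phi + form e Gam) + thy (form W Phi + form e Gam) =
     W%:R *: form W Phi + e%:R *: form e Gam.
    by rewrite thxD thyD addrACA !th_form.
  by rewrite eB /A /P0 /Pg !formD !formZ scalerDr addrACA.
have coefT (P : {poly K}) n : ('X * P^`())`_n = n%:R * P`_n.
  by rewrite coefXM; case: n => [|n] /=; rewrite ?mul0r // coef_deriv mulr_natl.
have nz n : (0 < n)%N -> n%:R + c%:R * n%:R != 0 :> K.
  by move=> n0; rewrite -natrM -natrD pnatr_eq0; lia.
have PhiW : Phi`_W != 0.
  have -> : Phi`_W = lead_coef Phi by rewrite lead_coefE szPhi.
  by rewrite lead_coef_eq0 -size_poly_eq0 szPhi.
(* On a line A has order e, unless its lower form vanishes there; then it has order W, because by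
   the choice of c the two forms of A have no common line. *)
pose bad (l : option K) := if l is Some v then Pg.[v] == 0 else Pg`_e == 0.
pose o l := if bad l then W else e.
have oA l : has_ord (prs l A) (o l).
  case: l => [v|] /=.
    apply: (@two_ord _ P0.[v]) => [n|h]; first by rewrite rsD !rs_formE.
    by apply/eqP => h0; have := hc v h0; rewrite -/Pg h eqxx.
  apply: (@two_ord _ P0`_W) => [n|_].
    rewrite /A serD /form !addn0; by case: eqP => [->|_]; case: eqP => [->|_].
  by rewrite /P0 coefD !coefZ coefT mulrA -mulrDl mulf_neq0 // nz //; lia.
have Pg_e : (Pg`_e == 0) = (Gam`_e == 0).
  by rewrite /Pg coefD !coefZ coefT mulrA -mulrDl mulf_eq0 (negPf (nz _ e0)).
have Pg0 : Pg != 0.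
  apply/eqP => h; have : Pg`_(size Gam).-1 = 0 by rewrite h coef0.
  rewrite /Pg coefD !coefZ coefT mulrA -mulrDl -lead_coefE => /eqP.
  by rewrite mulf_eq0 lead_coef_eq0 (negPf Gam0) orbF -natrM -natrD pnatr_eq0 addn_eq0 -leqn0 leqNgt e0.
have [rP eP fP] := form_lines sPg Pg0.
have sK : (size Kp <= (W + e).+1)%N.
  rewrite /Kp; have [->|n0] := eqVneq (W%:R *: (Phi * Gam^`()) - e%:R *: (Gam * Phi^`())) 0.
    by rewrite mulr0 size_poly0.
  have -> : 'X * (W%:R *: (Phi * Gam^`()) - e%:R *: (Gam * Phi^`())) = P0 * Qg - Q0 * Pg.
    by rewrite /P0 /Pg /Q0 /Qg -!mul_polyC; ring.
  rewrite (leq_trans (size_polyD _ _)) // geq_max size_polyN.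
  by rewrite !size_mul_top.
have [rK eK fK] := form_lines sK Kp_neq0.
have [rG eG _] := form_lines szGam Gam0.
set lK := _ ++ _ in fK; set lP := _ ++ _ in fP.
pose lG := map Some rG ++ nseq (e - size rG)%N None.
have [cK _] := @cd_lines K A o lK (fun l _ => oA l).
have [cP nP] := @cd_lines K A o lP (fun l _ => oA l).
have szr (P : {poly K}) (r : seq K) : P != 0 -> P = lead_coef P *: \prod_(z <- r) ('X - z%:P) ->
    size P = (size r).+1.
  by move=> P_0 {1}->; rewrite size_scale ?lead_coef_eq0 // size_prod_XsubC.
have slG : size lG = e.
  by rewrite size_cat size_map size_nseq subnKC // -ltnS -(szr _ _ Gam0 eG).
have slK : size lK = (W + e)%N.
  by rewrite size_cat size_map size_nseq subnKC // -ltnS -(szr _ _ Kp_neq0 eK).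
have slP : size lP = e.
  by rewrite size_cat size_map size_nseq subnKC // -ltnS -(szr _ _ Pg0 eP).
have sumP : (\sum_(l <- lP) o l = W * e)%N.
  have -> : (\sum_(l <- lP) o l = \sum_(l <- lP) W)%N.
    apply: eq_big_seq => l; rewrite mem_cat => /orP[/mapP [v vr ->]|].
      rewrite /o /= ifT //; have : root Pg v by rewrite eP rootZ ?lead_coef_eq0 // root_prod_XsubC.
      by [].
    rewrite mem_nseq => /andP[h /eqP ->]; rewrite /o /= ifT //.
    by rewrite nth_default // (szr _ _ Pg0 eP) -subn_gt0.
  by rewrite big_const_seq count_predT slP iter_addn_0.
(* A bad line of Kp is a line of Gam, since P0 is nonzero on it, and its multiplicity in Kp is at
   most that in Gam. As Gam has e lines, there are at most e bad ones. *)
have nbad : (count bad lK <= e)%N.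
  rewrite -slG -size_filter.
  have /count_subseqP [s ss pe] : forall x, (count_mem x (seq.filter bad lK) <= count_mem x lG)%N.
    move=> x; rewrite count_filter.
    have [bx|nbx] := boolP (bad x); last first.
      rewrite (@eq_count _ _ pred0) ?count_pred0 // => y /=; by case: eqP => // ->; rewrite (negPf nbx).
    rewrite (@eq_count _ _ (pred1 x)); last by move=> y /=; case: eqP => // ->; rewrite bx.
    rewrite !count_cat !count_map !count_nseq; case: x bx => [v|] /= hb; last first.
      rewrite !(@eq_count _ _ pred0) // !count_pred0 !add0n !mul1n.
      have gG := szr _ _ Gam0 eG; have gK := szr _ _ Kp_neq0 eK.
      rewrite Pg_e in hb.
      have sge : (size rG != e)%N.
        by apply: contraNneq Gam0 => h; rewrite -lead_coef_eq0 lead_coefE gG h.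
      have : Kp`_(W + size rG) != 0.
        rewrite coef_Kp ?gG // !mulf_neq0 //; first by rewrite pnatr_eq0 -lt0n (leq_trans _ eW).
          by have := Gam0; rewrite -lead_coef_eq0 lead_coefE gG.
        by rewrite subr_eq0 eqr_nat.
      move=> hk; have : (W + size rG < size Kp)%N.
        by rewrite ltnNge; apply: contra hk => h; rewrite nth_default.
      rewrite gK ltnS leq_subLR => h1; apply: leq_trans (leq_add h1 (leqnn _)).
      by rewrite -addnA subnKC // -ltnS -gG.
    rewrite !mul0n !addn0.
    rewrite (@eq_count _ _ (pred1 v)); last by move=> y /=; apply/eqP/eqP => [[->]|->].
    rewrite [X in (_ <= X)%N](@eq_count _ _ (pred1 v)); last by move=> y /=; apply/eqP/eqP => [[->]|->].
    have [rv|nrv] := boolP (root Kp v); last first.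
      have -> : count_mem v rK = 0%N; last by [].
      apply/count_memPn; apply: contra nrv => h.
      by rewrite eK rootZ ?lead_coef_eq0 ?Kp_neq0 // root_prod_XsubC.
    have rG' : root Gam v.
      have p0 : P0.[v] != 0 by apply/eqP => h0; have := hc v h0; rewrite -/Pg (eqP hb) eqxx.
      have : P0.[v] * Qg.[v] = 0.
        transitivity (Kp.[v] + Q0.[v] * Pg.[v]).
          by rewrite KpE /P0 /Pg /Q0 /Qg !(hornerD, hornerN, hornerM, hornerZ, hornerC, hornerX); ring.
        by rewrite (eqP rv) (eqP hb) mulr0 addr0.
      move=> /eqP; rewrite mulf_eq0 (negPf p0) /= => /eqP q0.
      by move: hb; rewrite /Pg hornerD !hornerZ -/Qg q0 mulr0 addr0 mulf_eq0 pnatr_eq0 => /orP[|//]; rewrite -leqn0 leqNgt e0.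
    have [_] := mup_Kp rG'.
    by rewrite {1}eK {1}eG !mup_roots ?lead_coef_eq0 ?Kp_neq0.
  rewrite (perm_size pe); exact: size_subseq.
have sumK : (\sum_(l <- lK) o l = W * count bad lK + e * (W + e - count bad lK))%N.
  rewrite (bigID bad) /= (eq_bigr (fun=> W)) => [|l hl]; last by rewrite /o hl.
  rewrite [X in (_ + X)%N](eq_bigr (fun=> e)) => [|l hl]; last by rewrite /o (negPf hl).
  rewrite !big_const_seq !iter_addn_0 -slK; congr (_ + _ * _)%N.
  by rewrite -(count_predC bad lK) addKn.
have cPg : cd A (form e Pg) (W * e).
  by rewrite fP; apply: cd_scale; rewrite ?lead_coef_eq0 // -sumP.
have nPg : nzd A (form e Pg) by rewrite fP; apply: nzdZ; rewrite ?lead_coef_eq0.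
have cKp : cd A (form (W + e) Kp) (\sum_(l <- lK) o l).
  by rewrite fK; apply: cd_scale; rewrite ?lead_coef_eq0 ?Kp_neq0.
have rel : form (W + e) Kp = form e Qg * A - form e Pg * B.
  have -> : Kp = P0 * Qg - Q0 * Pg by rewrite KpE /P0 /Pg /Q0 /Qg -!mul_polyC; ring.
  rewrite formB -!formM // /A /B; ring.
have [a [b [eN ca cb]]] : exists a b, [/\ (\sum_(l <- lK) o l = a + b)%N, cd A (form e Pg) a & cd A B b].
  apply: cd_split => //; apply: cd_eq cKp.
  - exact: ideal2_l.
  - exists (form e Qg), (-1); rewrite rel; ring.
  - exact: ideal2_l.
  - exists (form e Qg), (-1); rewrite rel; ring.
have ea := codim_uniq ca cPg.
(* With k <= e bad lines, b = Wk + e(W + e - k) - We = We - (W - e)(e - k) <= We. *)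
exists b; first by rewrite sumK ea in eN; nia.
apply: cd_eq cb.
- by rewrite eB; apply: ideal2_r.
- by exists 1, (- (1 + c%:R)%:A); rewrite eA eB; ring.
- by exists (1 + c%:R)%:A, 1; rewrite eA; ring.
- by rewrite eB; apply: ideal2_l.
Qed.

End TwoForms.

(** * From x f_x and y f_y to the partial derivatives *)

Section Derivations.
Variable K : numClosedFieldType.
Implicit Types f g h u A B : ser K.

Definition dX f : ser K := fun i j => i.+1%:R * f i.+1 j.
Definition dY f : ser K := fun i j => j.+1%:R * f i j.+1.

Lemma mono_dX f : mono K 1 0 * dX f = thx f.
Proof.
apply: serP => i j; rewrite mono_mulE andbT subn0 /thx /dX.
by case: i => [|i]; rewrite ?mul0r // subn1.
Qed.

Lemma mono_dY f : mono K 0 1 * dY f = thy f.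
Proof.
apply: serP => i j; rewrite mono_mulE subn0 /thy /dY.
by case: j => [|j]; rewrite ?mul0r // subn1.
Qed.

Lemma word_dX w1 w2 N f : word w1 w2 (N + w1) f -> word w1 w2 N (dX f).
Proof. by move=> h i j hij; rewrite /dX h ?mulr0 // mulSn; lia. Qed.

Lemma word_dY w1 w2 N f : word w1 w2 (N + w2) f -> word w1 w2 N (dY f).
Proof. by move=> h i j hij; rewrite /dY h ?mulr0 // mulSn; lia. Qed.

Lemma word_thx w1 w2 N f : word w1 w2 N f -> word w1 w2 N (thx f).
Proof. by move=> h i j hij; rewrite /thx h ?mulr0. Qed.

Section Axes.
Variables (f : ser K) (a b : nat).
Hypotheses (ha : has_ord (fun j => f 0%N j.+1) a) (hb : has_ord (fun i => f i.+1 0%N) b).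

Let oY : has_ord (prs (Some 0) (dY f)) a.
Proof.
have [h1 h2] := ha; split=> [|k ka] /=; rewrite rs0 /dY; first by rewrite mulf_neq0 // pnatr_eq0.
by rewrite h2 ?mulr0.
Qed.

Let oX : has_ord (prs None (thx f)) b.+1.
Proof.
have [h1 h2] := hb; split=> [|k ka] /=; rewrite /thx; first by rewrite mulf_neq0 // pnatr_eq0.
by case: k ka => [|k] ka; rewrite ?mul0r // h2 ?mulr0.
Qed.

(* x f_x and y f_y differ from f_x and f_y by the two axes. *)
Lemma cd_theta m : cd (dX f) (dY f) m -> cd (thx f) (thy f) (m + a + b + 1).
Proof.
move=> /cd_sym c.
have := cd_mul (nzd_pline oY) (cd_pline oY) c; rewrite /= line0 mono_dX => /cd_sym c'.
have := cd_mul (nzd_pline oX) (cd_pline oX) c'; rewrite /= mono_dY.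
by congr (cd _ _ _); lia.
Qed.

Lemma cd_theta_inv N : cd (thx f) (thy f) N ->
  exists2 m, cd (dX f) (dY f) m & (N = m + a + b + 1)%N.
Proof.
rewrite -mono_dY => /(cd_split (nzd_pline oX)) [b' [N' [-> cb]]].
move=> /cd_sym; rewrite -mono_dX -line0 => /(cd_split (nzd_pline oY)) [a' [m [-> ca /cd_sym cm]]].
exists m => //; rewrite (codim_uniq ca (cd_pline oY)) (codim_uniq cb (cd_pline oX)); lia.
Qed.

End Axes.

Lemma thx_pb q p f : (0 < q)%N -> thx (pb q p f) = q%:R *: pb q p (thx f).
Proof.
move=> q0; apply: serP => i j; rewrite serZ /thx /pb; case: ifP => [/andP[h _]|_]; last by rewrite !mulr0.
by rewrite mulrA -natrM [(q * _)%N]mulnC divnK.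
Qed.

Lemma thy_pb q p f : (0 < p)%N -> thy (pb q p f) = p%:R *: pb q p (thy f).
Proof.
move=> q0; apply: serP => i j; rewrite serZ /thy /pb; case: ifP => [/andP[_ h]|_]; last by rewrite !mulr0.
by rewrite mulrA -natrM [(p * _)%N]mulnC divnK.
Qed.

Lemma word_pb q p N f : (0 < q)%N -> (0 < p)%N -> word q p N f -> word 1 1 N (pb q p f).
Proof.
move=> q0 p0 h i j hij; rewrite /pb; case: ifP => // /andP[h1 h2]; apply: h.
by rewrite !divnK // -[ i ]muln1 -[j]muln1.
Qed.

Definition homogeneous w1 w2 N f := forall i j, f i j != 0 -> (i * w1 + j * w2 = N)%N.

Lemma homogeneous_word w1 w2 N f : homogeneous w1 w2 N f -> word w1 w2 N f.
Proof. by move=> h i j hij; apply/eqP; apply: contraLR hij => /h ->; rewrite ltnn. Qed.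

Lemma homogeneous_pb q p N f : (0 < q)%N -> (0 < p)%N -> homogeneous q p N f ->
  pb q p f = form N (hom N (pb q p f)).
Proof.
move=> q0 p0 h; apply: serP => i j; rewrite /form.
case: eqP => [<-|ne]; first by rewrite coef_hom ?leq_addr // addKn.
rewrite /pb; case: ifP => // /andP[h1 h2]; apply/eqP; apply: contraNT (introN eqP ne) => /h.
by rewrite !divnK // => ->.
Qed.

Lemma cd_thetaZ a b f g n : a != 0 -> b != 0 -> cd (a *: f) (b *: g) n -> cd f g n.
Proof.
move=> a0 b0 h.
have := @cd_scale K (a *: f) (b *: g) b^-1 n; rewrite scalerA mulVf // scale1r invr_eq0 => /(_ b0 h) /cd_sym.
by move=> /(@cd_scale K g (a *: f) a^-1 n); rewrite scalerA mulVf // scale1r invr_eq0 => /(_ a0) /cd_sym.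
Qed.

End Derivations.

(** * Bounds for a quasihomogeneous series and a perturbation of lower weight *)

Section QuasiHomogeneous.
Variable K : numClosedFieldType.
Implicit Types f g h u A B : ser K.
Variables (p q : nat) (F : ser K).
Hypotheses (p2 : (2 <= p)%N) (pq : (p <= q)%N).
Hypotheses (Fp : F p 0%N = 1) (Fq : F 0%N q = 1) (hF : homogeneous q p (p * q) F).

(* F(x, 1), for F homogeneous of weight pq; the exponent of y is then determined by i. *)
Definition slice : {poly K} := \poly_(i < p.+1) F i ((p - i) * q %/ p)%N.

Hypothesis sqfree : forall v, root slice v -> slice^`().[v] != 0.

Let p0 : (0 < p)%N. Proof. by lia. Qed.
Let q0 : (0 < q)%N. Proof. by lia. Qed.
Let W := (p * q)%N.
Let Phi := hom W (pb q p F).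

Let PhiE : Phi = slice \Po 'X^q.
Proof.
apply/polyP => i; rewrite coef_comp_poly_Xn // coef_poly /pb.
have [iW|Wi] := leqP i W; rewrite ltnS ?iW; last first.
  rewrite leqNgt Wi /=; case: ifP => // qi; rewrite coef_poly ifF //.
  by apply/negbTE; rewrite -leqNgt -(ltn_pmul2r q0) divnK //.
have -> : (q %| i)%N && (p %| W - i)%N = (q %| i)%N && (p %| i)%N.
  by case qi : (q %| i)%N => //=; rewrite dvdn_subr // dvdn_mulr.
case qi : (q %| i)%N => //=.
have ip : (i %/ q <= p)%N by rewrite leq_divLR // .
rewrite coef_poly ltnS ip mulnBl divnK //.
case pi : (p %| i)%N; first by [].
(* If p does not divide i, the rounded exponent in [slice] lies off the weight line, so F has
   coefficient 0 there. *)
apply/esym/eqP; apply: contraFT pi => /hF; rewrite divnK // => e.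
have : (p %| i + (W - i) %/ p * p)%N by rewrite e dvdn_mulr.
by rewrite dvdn_addl // dvdn_mull.
Qed.

Let szPhi : size Phi = W.+1.
Proof.
apply/eqP; rewrite eqn_leq size_hom ltnNge; apply/negP => h.
have : Phi`_W = 1 by rewrite coef_hom // subnn /pb dvdn_mull //= dvdn0 mulnK // div0n.
by rewrite nth_default // => /eqP; rewrite eq_sym oner_eq0.
Qed.

Let Phi0 : Phi.[0] != 0.
Proof.
by rewrite horner_coef0 coef_hom // subn0 /pb dvdn0 dvdn_mulr //= div0n mulKn // Fq oner_eq0.
Qed.

Let sqPhi v : root Phi v -> Phi^`().[v] != 0.
Proof.
move=> rv; have v0 : v != 0 by apply: contraTneq rv => ->.
move: rv; rewrite PhiE rootE horner_comp hornerXn => rv.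
rewrite deriv_comp derivXn hornerM horner_comp hornerXn hornerMn hornerXn.
by rewrite mulf_neq0 ?sqfree // mulrn_eq0 negb_or expf_neq0 // andbT; lia.
Qed.

Let FE : pb q p F = form W Phi. Proof. by rewrite {1}(homogeneous_pb q0 p0 hF). Qed.

(** The bound We of the pulled-back forms, divided by the factor pq = W of the substitution. *)
Lemma cd_theta_homogeneous e g : homogeneous q p e g -> g != 0 -> (0 < e < W)%N ->
  exists2 n, (n <= e)%N & cd (thx (F + g)) (thy (F + g)) n.
Proof.
move=> hg g0 /andP[e0 eW]; pose Gam := hom e (pb q p g).
have gE : pb q p g = form e Gam by exact: homogeneous_pb.
have Gam0 : Gam != 0.
  apply: contraNneq g0 => h; rewrite -[g](part_pb q0 p0) gE h.
  by apply/eqP; apply: serP => i j; rewrite /part /form coef0 if_same.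
have [n nW c] := @cd_two_forms K W e Phi Gam e0 eW szPhi Phi0 sqPhi Gam0 (size_hom _ _).
rewrite -FE -gE -pbD thx_pb // thy_pb // in c.
have := cd_thetaZ _ _ c; rewrite !pnatr_eq0 -!lt0n p0 q0 => /(_ isT isT) /(cd_pb_inv q0 p0) [k ck en].
exists k => //; move: nW; rewrite en /W [(p * q)%N]mulnC leq_pmul2l // muln_gt0 p0 q0 //.
Qed.

Lemma F_axis_y j : j != q -> F 0%N j = 0.
Proof.
by move=> h; apply/eqP; apply: contraNT h => /hF; rewrite mul0n add0n mulnC => /eqP; rewrite eqn_pmul2l.
Qed.

Lemma F_axis_x i : i != p -> F i 0%N = 0.
Proof.
by move=> h; apply/eqP; apply: contraNT h => /hF; rewrite mul0n addn0 => /eqP; rewrite eqn_pmul2r.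
Qed.

(** By Euler's relation y F_y may be replaced by F, a product of W distinct lines after pullback; x
    F_x has order W on each. Dividing W^2 by pq and removing the axes leaves pq - (q - 1) - (p - 1)
    - 1. *)
Lemma cd_F : cd (dX F) (dY F) ((p - 1) * (q - 1)).
Proof.
have Fy : has_ord (fun j => F 0%N j.+1) (q - 1).
  by split=> [|k kq]; rewrite ?subn1 ?prednK ?Fq ?oner_eq0 // F_axis_y //; apply/eqP; lia.
have Fx : has_ord (fun j => F j.+1 0%N) (p - 1).
  by split=> [|k kq]; rewrite ?subn1 ?prednK ?Fp ?oner_eq0 // F_axis_x //; apply/eqP; lia.
have Pn0 : Phi != 0 by rewrite -size_poly_eq0 szPhi.
have [rs eP fP] := form_lines (size_hom W (pb q p F)) Pn0; rewrite -/Phi in eP fP.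
have srs : size rs = W.
  by apply: succn_inj; rewrite -szPhi {1}eP size_scale ?lead_coef_eq0 // size_prod_XsubC.
rewrite srs subnn cats0 in fP.
have cW : cd (thx (form W Phi)) (form W Phi) (W * W).
  rewrite [X in cd _ X _]fP; apply: cd_scale; rewrite ?lead_coef_eq0 //.
  have [|c _] := @cd_lines K (thx (form W Phi)) (fun=> W) (map Some rs); last first.
    by move: c; rewrite big_const_seq count_predT size_map srs iter_addn_0.
  move=> l /mapP [v vrs ->]; have rv : root Phi v.
    by rewrite eP rootZ ?lead_coef_eq0 // root_prod_XsubC.
  have v0 : v != 0 by apply: contraTneq rv => ->.
  split=> [|k kW]; rewrite /= thx_form rs_formE ?size_theta ?size_hom //.
    by rewrite eqxx hornerM hornerX mulf_neq0 // sqPhi.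
  by rewrite ltn_eqF.
have cT : cd (thx (pb q p F)) (thy (pb q p F)) (W * W).
  rewrite FE; apply: cd_eq cW.
  - exact: ideal2_l.
  - by exists (-1), (W%:R%:A); rewrite mulr_algl -th_form; ring.
  - exact: ideal2_l.
  - exists (W%:R^-1%:A), (W%:R^-1%:A); rewrite -mulrDr th_form -scalerAl mul1r scalerA mulVf ?scale1r //.
    by rewrite pnatr_eq0 -lt0n muln_gt0 p0.
rewrite thx_pb // thy_pb // in cT.
have := cd_thetaZ _ _ cT; rewrite !pnatr_eq0 -!lt0n p0 q0 => /(_ isT isT) /(cd_pb_inv q0 p0) [k ck en].
have kW : k = W.
  by move/eqP: en; rewrite {1}/W [(p * q)%N]mulnC eqn_pmul2l ?muln_gt0 ?p0 ?q0 // => /eqP.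
have [m cm em] := cd_theta_inv Fy Fx ck.
suff -> : ((p - 1) * (q - 1) = m)%N by [].
move: em; rewrite kW /W; nia.
Qed.

End QuasiHomogeneous.

(** * Milnor numbers of F + s g *)

Section Jumps.
Variable K : numClosedFieldType.
Implicit Types f g h u A B : ser K.
Variables (p q : nat) (F : ser K).
Hypotheses (p2 : (2 <= p)%N) (pq : (p <= q)%N).
Hypotheses (Fp : F p 0%N = 1) (Fq : F 0%N q = 1) (hF : homogeneous q p (p * q) F).
Hypothesis sqfree : forall v, root (slice p q F) v -> (slice p q F)^`().[v] != 0.

Let p0 : (0 < p)%N. Proof. by lia. Qed.
Let q0 : (0 < q)%N. Proof. by lia. Qed.

(** The order on the axis is read off from the supports of F and g. It is the same for all
    admissible parameters, the excluded ones being those for which y^q cancels. *)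
Lemma order_axis_y g s : s != 0 -> 1 + s * g 0%N q != 0 -> g 0%N 0%N = 0 ->
  exists2 a, has_ord (fun j => (F + s *: g) 0%N j.+1) a &
    forall s', s' != 0 -> 1 + s' * g 0%N q != 0 -> has_ord (fun j => (F + s' *: g) 0%N j.+1) a.
Proof.
move=> s0 gq g00.
have exP : exists j, (g 0%N j.+1 != 0) || (j.+1 == q).
  by exists q.-1; rewrite prednK // eqxx orbT.
have key s' : s' != 0 -> 1 + s' * g 0%N q != 0 -> has_ord (fun j => (F + s' *: g) 0%N j.+1) (ex_minn exP).
  move=> s'0 gq'; case: ex_minnP => a ha hm; split=> [|k ka]; rewrite serD serZ.
    have [aq|aq] := eqVneq a.+1 q; first by rewrite aq Fq.
    rewrite (F_axis_y p2 pq hF) // add0r mulf_neq0 //; by move: ha; rewrite (negPf aq) orbF.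
  have : ~~ ((g 0%N k.+1 != 0) || (k.+1 == q)) by apply/negP => /hm; rewrite leqNgt ka.
  by rewrite negb_or negbK => /andP[/eqP -> kq]; rewrite (F_axis_y p2 pq hF) // mulr0 addr0.
by exists (ex_minn exP); [exact: key | exact: key].
Qed.

Lemma order_axis_x g s : s != 0 -> 1 + s * g p 0%N != 0 -> g 0%N 0%N = 0 ->
  exists2 a, has_ord (fun j => (F + s *: g) j.+1 0%N) a &
    forall s', s' != 0 -> 1 + s' * g p 0%N != 0 -> has_ord (fun j => (F + s' *: g) j.+1 0%N) a.
Proof.
move=> s0 gq g00.
have exP : exists j, (g j.+1 0%N != 0) || (j.+1 == p).
  by exists p.-1; rewrite prednK // eqxx orbT.
have key s' : s' != 0 -> 1 + s' * g p 0%N != 0 -> has_ord (fun j => (F + s' *: g) j.+1 0%N) (ex_minn exP).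
  move=> s'0 gq'; case: ex_minnP => a ha hm; split=> [|k ka]; rewrite serD serZ.
    have [aq|aq] := eqVneq a.+1 p; first by rewrite aq Fp.
    rewrite (F_axis_x p2 pq hF) // add0r mulf_neq0 //; by move: ha; rewrite (negPf aq) orbF.
  have : ~~ ((g k.+1 0%N != 0) || (k.+1 == p)) by apply/negP => /hm; rewrite leqNgt ka.
  by rewrite negb_or negbK => /andP[/eqP -> kq]; rewrite (F_axis_x p2 pq hF) // mulr0 addr0.
by exists (ex_minn exP); [exact: key | exact: key].
Qed.

(* For small s the Milnor number of F + s g is at most that of F + g_e, where
   g_e is the part of g of lowest weight e. *)
Lemma cd_lower_part e g N : word q p e g -> (exists i j, (i * q + j * p = e)%N /\ g i j != 0) ->
  (0 < e < p * q)%N ->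
  (forall P : {poly K}, P != 0 -> exists2 t, P.[t] != 0 &
     cd (thx (F + t ^+ (p * q - e) *: g)) (thy (F + t ^+ (p * q - e) *: g)) N) ->
  (N <= e)%N.
Proof.
move=> wg [i0 [j0 [eij gij]]] he hN.
pose ge : ser K := fun i j => if (i * q + j * p == e)%N then g i j else 0.
have hge : homogeneous q p e ge by move=> i j; rewrite /ge; case: ifP => [/eqP //|_]; rewrite eqxx.
have ge0 : ge != 0.
  by apply: contraNneq gij => /(congr1 (fun f : ser K => f i0 j0)); rewrite /ge eij eqxx => ->.
have [n ne cn] := @cd_theta_homogeneous K p q F p2 pq Fp Fq hF sqfree e ge hge ge0 he.
apply: leq_trans ne.
(* The family t^(-pq) (F + t^(pq-e) g)(t^q x, t^p y): g has no weight below e, so the coefficients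
   are polynomials in t, and at t = 0 only F + g_e survives. *)
pose fam : nat -> nat -> {poly K} := fun i j =>
   (F i j)%:P + (g i j)%:P * (if (e <= i * q + j * p)%N then 'X^(i * q + j * p - e) else 0).
have fam0 : spec 0 fam = F + ge.
  apply: serP => i j; rewrite serD /spec /fam hornerD hornerM !hornerC; congr (_ + _).
  rewrite /ge; case: (ltngtP (i * q + j * p) e) => [lt|gt|->].
  - by rewrite horner0 mulr0.
  - by rewrite hornerXn expr0n subn_eq0 leqNgt gt mulr0.
  - by rewrite subnn expr0 hornerC mulr1.
have famt t : t != 0 -> spec t fam = t ^- (p * q) *: dilate q p t (F + t ^+ (p * q - e) *: g).
  move=> t0; apply: serP => i j; rewrite serZ /dilate serD serZ /spec /fam hornerD hornerM !hornerC.
  rewrite mulrDr mulrDr; congr (_ + _).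
    have [->|Fn] := eqVneq (F i j) 0; first by rewrite !mulr0.
    by rewrite (hF Fn) mulrA mulVf ?expf_neq0 // mul1r.
  have [lt|le] := ltnP (i * q + j * p) e; first by rewrite wg // horner0 !mulr0.
  rewrite hornerXn mulrC !mulrA; congr (_ * _).
  apply: (mulfI (expf_neq0 (p * q) t0)); rewrite !mulrA divff ?expf_neq0 // mul1r -!exprD.
  by congr (_ ^+ _); move: he => /andP[_ h]; lia.
apply: (@cd_semicontinuous K (fun i j => i%:R * fam i j) (fun i j => j%:R * fam i j)).
  suff [-> ->] : spec 0 (fun i j => i%:R * fam i j) = thx (F + ge) /\
                 spec 0 (fun i j => j%:R * fam i j) = thy (F + ge) by [].
  by rewrite -fam0; split; apply: serP => i j; rewrite /spec hornerM -polyC_natr hornerC.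
(* The extra factor X keeps t away from 0, where rescaling is not invertible. *)
move=> P Pn0; have [|t] := hN ('X * P); first by rewrite mulf_neq0 ?polyX_eq0.
rewrite hornerM hornerX mulf_eq0 negb_or => /andP[t0 Pt] ct.
exists t => //.
have tW : t ^- (p * q) != 0 by rewrite invr_neq0 ?expf_neq0.
have -> : spec t (fun i j => i%:R * fam i j) =
    t ^- (p * q) *: dilate q p t (thx (F + t ^+ (p * q - e) *: g)).
  apply: serP => i j; rewrite /spec hornerM -polyC_natr hornerC -[(fam i j).[t]]/(spec t fam i j) famt //.
  by rewrite !serZ /dilate /thx; ring.
have -> : spec t (fun i j => j%:R * fam i j) =
    t ^- (p * q) *: dilate q p t (thy (F + t ^+ (p * q - e) *: g)).
  apply: serP => i j; rewrite /spec hornerM -polyC_natr hornerC -[(fam i j).[t]]/(spec t fam i j) famt //.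
  by rewrite !serZ /dilate /thy; ring.
by apply: cd_scale => //; apply: cd_sym; apply: cd_scale => //; apply: cd_sym; apply: cd_dilate.
Qed.

(** All powers t^d occur in the hypothesis because the rescaling takes s = t^(pq-e), with e
    determined only by g. Its shape, avoiding the zeros of any given P, is what semicontinuity
    consumes. *)
Lemma milnor_bound g m : g 0%N 0%N = 0 ->
  (forall P : {poly K}, P != 0 -> exists2 t, P.[t] != 0 &
     forall d, (0 < d)%N -> cd (dX (F + t ^+ d *: g)) (dY (F + t ^+ d *: g)) m) ->
  ((p - 1) * (q - 1) <= m)%N \/
  exists e a b, [/\ (e < p * q)%N, (gcdn p q %| e)%N, (m + a + b + 1 <= e)%N,
    (e <= (a + 1) * p)%N & (e <= (b + 1) * q)%N].
Proof.
move=> g00 hm.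
have [/existsP [e /asboolP he]|/existsPn none] :=
   boolP [exists e : 'I_(p * q), `[< exists i j, (i * q + j * p = e)%N /\ g i j != 0 >]]; last first.
  (* All of F + t g has weight at least pq, so its partial derivatives have weights at least (p-1)q
     and (q-1)p, and [cd_ge] applies. *)
  left; have [t _ ct] := hm 1 (oner_neq0 _).
  have wF : word q p (p * q) (F + t ^+ 1 *: g).
    apply: wordD; first exact: homogeneous_word.
    apply: wordZ => i j hij; apply/eqP; apply/negPn/negP => gij.
    by have /negP := none (Ordinal hij); apply; apply/asboolP; exists i, j.
  apply: (@cd_ge _ q p _ _ _ _ _ _ _ _ _ (ct 1%N isT)) => //.
    by apply: word_dX; apply: wordW wF; nia.
  by apply: word_dY; apply: wordW wF; nia.
right.
have exP : exists e, `[< exists i j, (i * q + j * p = e)%N /\ g i j != 0 >].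
  by exists e; apply/asboolP.
have [e1 /asboolP [i0 [j0 [eij gij]]] emin] := ex_minnP exP.
have {he} e1W : (e1 < p * q)%N.
  by apply: leq_ltn_trans (ltn_ord e); apply: emin; apply/asboolP.
have wg : word q p e1 g.
  move=> i j hij; apply/eqP/negPn/negP => h; move: hij; rewrite ltnNge => /negP; apply.
  by apply: emin; apply/asboolP; exists i, j.
have e10 : (0 < e1)%N.
  rewrite lt0n; apply: contraNneq gij => h.
  have [i00 j00] : i0 = 0%N /\ j0 = 0%N by move: eij; rewrite h; split; nia.
  by rewrite i00 j00 g00.
pose D := (p * q - e1)%N.
have D0 : (0 < D)%N by rewrite subn_gt0.
(* Zeros to avoid: t = 0 and the values at which the coefficient of y^q or of x^p cancels. *)
pose Q := 'X * (1 + g 0%N q *: 'X^D) * (1 + g p 0%N *: 'X^D) : {poly K}.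
have H1 c : (1 + c *: 'X^D : {poly K}) != 0.
  apply/eqP => /(congr1 (fun P : {poly K} => P.[0])); rewrite hornerD hornerZ hornerXn hornerC horner0.
  by rewrite expr0n (gtn_eqF D0) mulr0 addr0 => /eqP; rewrite oner_eq0.
have Q0 : Q != 0 by rewrite !mulf_neq0 ?polyX_eq0.
have Qt t : Q.[t] != 0 -> [/\ t ^+ D != 0, 1 + t ^+ D * g 0%N q != 0 & 1 + t ^+ D * g p 0%N != 0].
  rewrite /Q !hornerM hornerX !hornerD !hornerZ !hornerXn !hornerC !mulf_eq0 !negb_or.
  move=> /andP[/andP[t0 h1] h2]; split; first exact: expf_neq0.
    by rewrite mulrC.
  by rewrite mulrC.
have [t Qt0 _] := hm Q Q0; have [t0 gq gp] := Qt t Qt0.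
have [a ha ha'] := order_axis_y t0 gq g00.
have [b hb hb'] := order_axis_x t0 gp g00.
have wf : word q p e1 (F + t ^+ D *: g).
  by apply: wordD; [apply: wordW (homogeneous_word hF); exact: ltnW | exact: wordZ].
exists e1, a, b; split=> //.
- by rewrite -eij dvdn_add // dvdn_mull // ?dvdn_gcdr ?dvdn_gcdl.
- apply: (cd_lower_part wg) => [||P Pn0].
  + by exists i0, j0.
  + by rewrite e10.
  have [|s] := hm (Q * P); first by rewrite mulf_neq0.
  rewrite hornerM mulf_eq0 negb_or => /andP[/Qt [s0 sq sp] Ps] cs.
  by exists s => //; apply: cd_theta; [exact: ha' | exact: hb' | exact: cs].
- rewrite leqNgt; apply/negP => h; have [/eqP + _] := ha; apply.
  by apply: wf; rewrite mul0n add0n -[a.+1]addn1.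
- rewrite leqNgt; apply/negP => h; have [/eqP + _] := hb; apply.
  by apply: wf; rewrite mul0n addn0 -[b.+1]addn1.
Qed.

Lemma cd_deformation e g a b : homogeneous q p e g -> g != 0 -> (0 < e < p * q)%N ->
  has_ord (fun j => (F + g) 0%N j.+1) a -> has_ord (fun i => (F + g) i.+1 0%N) b ->
  exists2 m, (m + a + b + 1 <= e)%N & cd (dX (F + g)) (dY (F + g)) m.
Proof.
move=> hg g0 he ha hb.
have [n ne cn] := cd_theta_homogeneous p2 pq Fp Fq hF sqfree hg g0 he.
by have [m cm em] := cd_theta_inv ha hb cn; exists m => //; rewrite -em.
Qed.

Lemma homogeneous_mono a b s : homogeneous q p (a * q + b * p) (s *: mono K a b).
Proof.
move=> i j; rewrite serZ monoE; case: (eqVneq i a) => [->|_]; last by rewrite mulr0 eqxx.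
by case: (eqVneq j b) => [->|_] //; rewrite mulr0 eqxx.
Qed.

Lemma monoZ_neq0 a b s : s != 0 -> s *: mono K a b != 0.
Proof.
move=> s0; apply: contraNneq s0 => /(congr1 (fun f : ser K => f a b)).
by rewrite serZ monoE !eqxx mulr1 ser0 => ->.
Qed.

(** The upper bound is the general one with e = (q-1)p, where the axis y = 0 is unaffected and the
    order on x = 0 drops to q - 1. It is sharp by weights: g does not involve x, so f_x keeps weight
    (p-1)q, while f_y has weight at least (q-2)p. *)
Lemma cd_divides s : (p < q)%N -> s != 0 ->
  cd (dX (F + s *: mono K 0 (q - 1))) (dY (F + s *: mono K 0 (q - 1))) ((p - 1) * (q - 2)).
Proof.
move=> ltpq s0; set f := F + _.
have [|||||m em cm] := cd_deformation (e := ((q - 1) * p)%N) (a := (q - 2)%N) (b := (p - 1)%N)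
   (g := s *: mono K 0 (q - 1)).
- by have := @homogeneous_mono 0 (q - 1) s.
- exact: monoZ_neq0.
- by apply/andP; split; nia.
- split=> [|k kq]; rewrite serD serZ monoE /=.
    rewrite (F_axis_y p2 pq hF); last by apply/eqP; lia.
    by rewrite add0r mulf_neq0 // pnatr_eq0 eqb0 negbK; apply/eqP; lia.
  rewrite (F_axis_y p2 pq hF); last by apply/eqP; lia.
  by rewrite add0r; case: eqP => [h|_]; rewrite ?mulr0 //; lia.
- split=> [|k kp]; rewrite serD serZ monoE /= mulr0 addr0.
    by rewrite subn1 prednK // Fp oner_eq0.
  by rewrite (F_axis_x p2 pq hF) //; apply/eqP; lia.
suff -> : ((p - 1) * (q - 2) = m)%N by [].
apply/eqP; rewrite eqn_leq; apply/andP; split; last by nia.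
apply: (@cd_ge _ q p _ _ _ _ _ _ _ _ _ cm) => //.
  have -> : dX (F + s *: mono K 0 (q - 1)) = dX F.
    by apply: serP => i j; rewrite /dX serD serZ monoE /= mulr0 addr0.
  by apply: word_dX; apply: wordW (homogeneous_word hF); nia.
apply: word_dY; apply: wordD; first by apply: wordW (homogeneous_word hF); nia.
by apply: wordW (homogeneous_word (@homogeneous_mono 0 (q - 1) s)); nia.
Qed.

(** The monomial x^a y^b is on neither axis, so the axis orders remain q and p and m = n - p - q +
    1. The general bound n <= pq - gcd is matched by weights after one combination is raised to
    weight pq. *)
Lemma cd_not_divides s a b : (0 < a)%N -> (0 < b)%N -> (a * q + b * p = p * q - gcdn p q)%N -> s != 0 ->
  cd (dX (F + s *: mono K a b)) (dY (F + s *: mono K a b)) ((p - 1) * (q - 1) - gcdn p q).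
Proof.
move=> a0 b0 eab s0; set f := F + _.
have gp : (gcdn p q <= p)%N by apply: dvdn_leq (dvdn_gcdl _ _).
have g0 : (0 < gcdn p q)%N by rewrite gcdn_gt0 p0.
have hg := @homogeneous_mono a b s; rewrite eab in hg.
have he : (0 < p * q - gcdn p q < p * q)%N by apply/andP; split; nia.
have [n ne cn] := cd_theta_homogeneous p2 pq Fp Fq hF sqfree hg (@monoZ_neq0 a b s s0) he.
have fy : has_ord (fun j => f 0%N j.+1) (q - 1).
  split=> [|k kp]; rewrite /f serD serZ monoE (ltn_eqF a0) /= mulr0 addr0.
    by rewrite subn1 prednK // Fq oner_eq0.
  by rewrite (F_axis_y p2 pq hF) //; apply/eqP; lia.
have fx : has_ord (fun j => f j.+1 0%N) (p - 1).
  split=> [|k kp]; rewrite /f serD serZ monoE (ltn_eqF b0) andbF mulr0 addr0.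
    by rewrite subn1 prednK // Fp oner_eq0.
  by rewrite (F_axis_x p2 pq hF) //; apply/eqP; lia.
have [m cm em] := cd_theta_inv fy fx cn.
suff -> : ((p - 1) * (q - 1) - gcdn p q = m)%N by [].
have en : (p * q - gcdn p q <= n)%N.
  (* b theta - a eta kills the monomial x^a y^b *)
  pose H := b%:R *: thx f - a%:R *: thy f.
  have cH : cd H (thx f) n.
    apply: cd_eq cn.
    - by exists (b%:R%:A), (- a%:R%:A); rewrite mulNr !mulr_algl.
    - exact: ideal2_l.
    - exact: ideal2_r.
    - exists (- a%:R^-1%:A), ((a%:R^-1 * b%:R)%:A); rewrite mulNr !mulr_algl /H scalerBr !scalerA.
      by rewrite mulVf ?pnatr_eq0 -?lt0n // scale1r opprB addrNK.
  have wH : word q p (p * q) H.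
    move=> i j hij; rewrite /H serB !serZ /thx /thy /f serD serZ monoE.
    rewrite (homogeneous_word hF hij) add0r; case: eqP => [->|_] /=; last by rewrite !mulr0 subrr.
    case: eqP => [->|_] /=; last by rewrite !mulr0 subrr.
    by rewrite mulr1; ring.
  have wf : word q p (p * q - gcdn p q) (thx f).
    apply: word_thx; apply: wordD; last exact: homogeneous_word hg.
    by apply: wordW (homogeneous_word hF); apply: leq_subr.
  have := cd_pb q0 p0 cH.
  move/(cd_ge (w1 := 1) (w2 := 1) (a := (p * q)%N) (b := (p * q - gcdn p q)%N) isT isT).
  rewrite !muln1 => /(_ (word_pb q0 p0 wH) (word_pb q0 p0 wf)).
  by rewrite [(q * p)%N]mulnC leq_pmul2l // muln_gt0 p0 q0.
nia.
Qed.

End Jumps.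

(** * The homogeneous case: perturbation by a power of a linear factor *)

Section Homogeneous.
Variable K : numClosedFieldType.
Implicit Types f g h u A B : ser K.

Lemma dX_form n (P : {poly K}) : dX (form n.+1 P) = form n P^`().
Proof.
apply: serP => i j; rewrite /dX /form addSn eqSS; case: ifP => _; last by rewrite mulr0.
by rewrite coef_deriv mulr_natl.
Qed.

Lemma dY_form n (P : {poly K}) : dY (form n.+1 P) = form n (n.+1%:R *: P - 'X * P^`()).
Proof.
apply: serP => i j; rewrite /dY /form addnS eqSS; case: eqP => [<-|_]; last by rewrite mulr0.
rewrite coefB coefZ coefXM; case: i => [|i] /=; first by rewrite subr0.
by rewrite coef_deriv -[X in _ - X]mulr_natl -mulrBl; congr (_ * _); rewrite -natrB; [congr _%:R|]; lia.
Qed.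

Lemma dXD f g : dX (f + g) = dX f + dX g.
Proof. by apply: serP => i j; rewrite serD /dX serD mulrDr. Qed.
Lemma dYD f g : dY (f + g) = dY f + dY g.
Proof. by apply: serP => i j; rewrite serD /dY serD mulrDr. Qed.
Lemma dXZ c f : dX (c *: f) = c *: dX f.
Proof. by apply: serP => i j; rewrite serZ /dX serZ mulrCA. Qed.
Lemma dYZ c f : dY (c *: f) = c *: dY f.
Proof. by apply: serP => i j; rewrite serZ /dY serZ mulrCA. Qed.

Lemma word_form n (P : {poly K}) : word 1 1 n (form n P).
Proof. by move=> i j; rewrite !muln1 /form => h; rewrite ltn_eqF. Qed.

Variables (n : nat) (F : ser K).
Let d := n.+3.
Hypotheses (Fp : F d 0%N = 1) (Fq : F 0%N d = 1) (hF : homogeneous d d (d * d) F).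
Hypothesis sqfree : forall v, root (slice d d F) v -> (slice d d F)^`().[v] != 0.

Lemma slice_hom : slice d d F = hom d F.
Proof.
apply/polyP => i; rewrite !coef_poly; case: ifP => // _; by rewrite mulnK.
Qed.

Lemma homogeneous_form : F = form d (hom d F).
Proof.
apply: serP => i j; rewrite /form; case: eqP => [<-|ne].
  by rewrite coef_hom ?leq_addr // addKn.
apply/eqP; apply: contraT => /hF; rewrite -mulnDl => /eqP; rewrite eqn_pmul2r // => /eqP //.
Qed.

(* With l a linear factor of F, the derivative of F + s l^(d-1) along the line l = 0
   is divisible by l, so the intersection number with it can be split. *)
Lemma cd_linear_factor : exists w : K, forall s, s != 0 ->
  let g := s *: form d.-1 (('X - w%:P) ^+ d.-1) in
  cd (dX (F + g)) (dY (F + g)) ((d - 1) * (d - 1) - (d - 2)).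
Proof.
pose P := hom d F.
have sP : (size P <= d.+1)%N := size_hom d F.
have Pd : P`_d = 1 by rewrite coef_hom // subnn.
have P0 : P.[0] = 1 by rewrite horner_coef0 coef_hom // subn0.
have sP1 : size P != 1%N.
  by apply/eqP => h; move/eqP: Pd; rewrite nth_default ?h // eq_sym oner_eq0.
have [w rw] := closed_rootP P sP1.
have w0 : w != 0 by apply: contraTneq rw => ->; rewrite rootE P0 oner_eq0.
have dPw : P^`().[w] != 0 by rewrite /P -slice_hom; apply: sqfree; rewrite slice_hom.
have [Q eQ] := factor_theorem _ _ rw.
exists w => s s0 g.
have sL k : size (('X - w%:P) ^+ k) = k.+1 :> nat by rewrite size_exp_XsubC.
have hg : homogeneous d d (d.-1 * d) g.
  by move=> i j; rewrite /g serZ /form -mulnDl; case: ifP => [/eqP -> //|_]; rewrite mulr0 eqxx.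
have g0n : g 0%N d.-1 = s * (- w) ^+ d.-1.
  by rewrite /g serZ /form add0n eqxx -horner_coef0 horner_exp hornerXsubC sub0r.
have gn0 : g d.-1 0%N = s.
  rewrite /g serZ /form addn0 eqxx.
  have := lead_coef_exp ('X - w%:P) d.-1; rewrite lead_coefXsubC expr1n lead_coefE sL => ->.
  by rewrite mulr1.
have gne0 : g != 0 by apply: contraNneq s0 => h; rewrite -gn0 h.
have gk i j : (i + j != d.-1)%N -> g i j = 0 by move=> h; rewrite /g serZ /form (negPf h) mulr0.
have d2 : (2 <= d)%N by [].
have [|||m em cm] := cd_deformation d2 (leqnn d) Fp Fq hF sqfree (a := n.+1) (b := n.+1) hg gne0.
- by apply/andP; split; rewrite /d; nia.
- split=> [|k kn]; rewrite serD (F_axis_y d2 (leqnn d) hF) ?add0r.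
  + by rewrite -[n.+2]/d.-1 g0n mulf_neq0 // expf_neq0 // oppr_eq0.
  + by rewrite /d; apply/eqP; lia.
  + by rewrite gk // /d add0n; apply/eqP; rewrite /=; lia.
  + by rewrite /d; apply/eqP; lia.
- split=> [|k kn]; rewrite serD (F_axis_x d2 (leqnn d) hF) ?add0r.
  + by rewrite -[n.+2]/d.-1 gn0.
  + by rewrite /d; apply/eqP; lia.
  + by rewrite gk // /d addn0; apply/eqP; rewrite /=; lia.
  + by rewrite /d; apply/eqP; lia.
suff -> : ((d - 1) * (d - 1) - (d - 2) = m)%N by [].
apply/eqP; rewrite eqn_leq; apply/andP; split; last by move: em; rewrite /d; nia.
pose A := dX (F + g).
have eF := homogeneous_form; rewrite -/P in eF.
have eA : A = form n.+2 P^`() + (s * n.+2%:R) *: form n.+1 (('X - w%:P) ^+ n.+1).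
  rewrite /A dXD dXZ {1}eF !dX_form deriv_exp derivXsubC mul1r -scaler_nat formZ scalerA.
  by [].
(* g is a power of x - w y, hence constant along the direction (w, 1). *)
have eYg : w *: dX g + dY g = 0.
  have -> : g = s *: form n.+2 (('X - w%:P) ^+ n.+2) by [].
  rewrite dXZ dYZ dX_form dY_form scalerA mulrC -scalerA -scalerDr -formZ -formD.
  rewrite (_ : w *: _ + _ = 0); first by apply: serP => i j; rewrite serZ /form coef0 if_same mulr0.
  rewrite deriv_exp derivXsubC mul1r -[_ *+ n.+2]mulr_natl -!mul_polyC -polyC_natr /= (exprS _ n.+1).
  ring.
(* Euler's formula gives w P' + d P - X P' = (X - w)(d Q - P'), where P = Q (X - w). The top
   coefficient of d Q - P' cancels, so C is a form of degree d - 2. *)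
pose C := form n.+1 (d%:R *: Q - P^`()).
have sC : (size (d%:R *: Q - P^`())%R <= n.+2)%N.
  have sQ k : (n.+3 <= k)%N -> Q`_k = 0.
    move=> hk; apply: nth_default; apply: leq_trans hk.
    have [->|Q0] := eqVneq Q 0; first by rewrite size_poly0.
    by move: sP; rewrite eQ size_Mmonic ?monicXsubC // size_XsubC addn2.
  apply/leq_sizeP => k hk; rewrite coefB coefZ coef_deriv.
  have -> : P`_k.+1 = Q`_k.
    rewrite eQ mulrBr coefB coefMX coefMC /= (sQ k.+1) ?mul0r ?subr0 //; lia.
  have [->|ne] := eqVneq k n.+2; first by rewrite -[X in _ - X]mulr_natl subrr.
  by rewrite sQ ?mulr0 ?mul0rn ?subr0 //; move: hk ne => /= ??; lia.
have eB : w *: dX F + dY F = line w * C.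
  rewrite eF dX_form dY_form -formZ -formD /line /C formM ?size_XsubC // add1n.
  congr form; rewrite -!mul_polyC; move: (P^`()) => P1; rewrite eQ /d; ring.
have eAB : w *: A + dY (F + g) = line w * C.
  by rewrite /A dXD dYD scalerDr addrACA eYg addr0.
have cAB : cd A (line w * C) m.
  apply: cd_eq cm.
  - exact: ideal2_l.
  - by exists (w%:A), 1; rewrite mul1r mulr_algl.
  - exact: ideal2_l.
  - by exists (- w%:A), 1; rewrite mulNr mulr_algl -eAB mul1r addKr.
have oA : has_ord (rs w A) n.+2.
  have sX : (size P^`() <= n.+3)%N.
    have [->|Pn] := eqVneq P 0; first by rewrite deriv0 size_poly0.
    by rewrite -ltnS; apply: leq_trans (lt_size_deriv Pn) _.
  have e0 k : rs w (form n.+1 (('X - w%:P) ^+ n.+1)) k = 0.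
    by rewrite rs_formE ?sL // horner_exp hornerXsubC subrr expr0n if_same.
  split=> [|k kn]; rewrite eA rsD rsZ e0 mulr0 addr0 rs_formE // ?eqxx //.
  by rewrite ltn_eqF.
(* The line contributes d - 1, since A restricts to P'(w) y^(d-1), and C at least (d-2)^2 by orders;
   the sum is (d-1)^2 - (d-2). *)
have [a [b [-> ca cb]]] := cd_split (nzd_line oA) cAB.
rewrite (codim_uniq ca (cd_line oA)).
have : (n.+1 * n.+1 <= b)%N.
  apply: (@cd_ge K 1 1 _ _ _ _ _ _ _ _ _ cb) => //; rewrite muln1.
    apply: word_dX; apply: wordD; first by rewrite eF; apply: wordW (@word_form d P); rewrite /d; lia.
    apply: wordZ; apply: wordW (@word_form d.-1 _); rewrite /d /=; lia.
  exact: word_form.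
by rewrite /d; nia.
Qed.

End Homogeneous.

(** * Complex differentiability *)

Local Open Scope classical_set_scope.
Local Open Scope ring_scope.
Local Open Scope complex_scope.

Import ComplexField.Normc.

Section ComplexNorm.
Variable R : realType.
Local Notation C := R[i].
Implicit Types z w : C.

(* The norm of R[i] takes its values in R[i]; nc is the same norm valued in R. *)
Definition nc (z : C) : R := normc z.

Lemma normE z : `|z| = (nc z)%:C.
Proof. by rewrite normc_def; case: z. Qed.

Lemma nc_ge0 z : 0 <= nc z.
Proof. by case: z => a b; exact: sqrtr_ge0. Qed.
Lemma nc0 : nc 0 = 0. Proof. exact: normc0. Qed.
Lemma nc1 : nc 1 = 1. Proof. exact: normc1. Qed.
Lemma ncM z w : nc (z * w) = nc z * nc w. Proof. exact: normcM. Qed.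
Lemma ncV z : nc z^-1 = (nc z)^-1. Proof. exact: normcV. Qed.
Lemma ncN z : nc (- z) = nc z. Proof. exact: normcN. Qed.
Lemma ncD z w : nc (z + w) <= nc z + nc w. Proof. exact: le_normcD. Qed.
Lemma ncB z w : nc (z - w) <= nc z + nc w. Proof. by rewrite -(ncN w); apply: ncD. Qed.
Lemma nc_sub z w : nc (z - w) = nc (w - z). Proof. by rewrite -ncN opprB. Qed.
Lemma nc_tri z w u : nc (z - u) <= nc (z - w) + nc (w - u).
Proof. by have := ncD (z - w) (w - u); rewrite addrA subrK. Qed.
Lemma nc_eq0 z : (nc z == 0) = (z == 0).
Proof. by apply/eqP/eqP => [/eq0_normc|->]; rewrite ?nc0. Qed.
Lemma nc_gt0 z : (0 < nc z) = (z != 0).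
Proof. by rewrite lt_def nc_ge0 andbT nc_eq0. Qed.
Lemma ncR (x : R) : nc x%:C = `|x|.
Proof. by rewrite /nc /= expr0n /= addr0 sqrtr_sqr. Qed.
Lemma nci : nc 'i = 1.
Proof. by rewrite /nc /= expr0n /= add0r expr1n sqrtr1. Qed.
Lemma nc_Re z : `|complex.Re z| <= nc z.
Proof. by case: z => a b; rewrite /nc /= -sqrtr_sqr ler_sqrt ?lerDl ?addr_ge0 ?sqr_ge0. Qed.
Lemma nc_Im z : `|complex.Im z| <= nc z.
Proof. by case: z => a b; rewrite /nc /= -sqrtr_sqr ler_sqrt ?lerDr ?addr_ge0 ?sqr_ge0. Qed.
Lemma nc_ReIm z : nc z <= `|complex.Re z| + `|complex.Im z|.
Proof.
rewrite {1}[z]complexE (le_trans (ncD _ _)) // ncM nci mul1r !ncR.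
by [].
Qed.
Lemma ncX z n : nc (z ^+ n) = nc z ^+ n.
Proof. by elim: n => [|n ih]; rewrite ?expr0 ?nc1 // !exprS ncM ih. Qed.

End ComplexNorm.

Section LinearApproximation.
Variable R : realType.
Local Notation C := R[i].

Lemma near_nc (x : C) (P : C -> Prop) :
  (\forall y \near x, P y) <-> exists2 e : R, 0 < e & forall y, nc (y - x) < e -> P y.
Proof.
split=> [/nbhs_normP [e /= e0 h]|[e e0 h]].
  have e' : e = (complex.Re e)%:C by rewrite RRe_real // gtr0_real.
  exists (complex.Re e); first by move: e0; rewrite e' ltcR.
  by move=> y hy; apply: h; rewrite /= distrC normE e' ltcR.
apply/nbhs_normP; exists e%:C; first by rewrite /= ltcR.
by move=> y /=; rewrite distrC normE ltcR; apply: h.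
Qed.

Lemma near_nc2 (x : C * C) (P : C * C -> Prop) :
  (\forall y \near x, P y) <->
  exists2 e : R, 0 < e & forall y, nc (y.1 - x.1) < e -> nc (y.2 - x.2) < e -> P y.
Proof.
split=> [[[A B] [/= /near_nc [a a0 ha] /near_nc [b b0 hb]] h]|[e e0 h]].
  exists (Num.min a b); first by rewrite lt_min a0.
  move=> y; rewrite !lt_min => /andP[h1 _] /andP[_ h2]; apply: h.
  by split; [apply: ha | apply: hb].
exists ([set u | nc (u - x.1) < e], [set u | nc (u - x.2) < e]).
  by split=> /=; apply/near_nc; exists e.
by move=> [u v] [/= hu hv]; apply: h.
Qed.

Lemma dnear_nc (x : C) (P : C -> Prop) :
  (\forall y \near x^', P y) <-> exists2 e : R, 0 < e & forall y, y != x -> nc (y - x) < e -> P y.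
Proof.
split=> [h|[e e0 h]].
  have /near_nc [e e0 he] : \forall y \near x, y != x -> P y by exact: h.
  by exists e => // y yx hy; exact: he.
have : \forall y \near x, y != x -> P y by apply/near_nc; exists e => // y hy yx; exact: h.
exact.
Qed.

(** Complex differentiability at z with partial derivatives A and B, stated with real-valued norms
    so that real arithmetic applies. *)
Definition lin_approx (f : C * C -> C) (z : C * C) (A B : C) := forall e : R, 0 < e ->
  exists2 d : R, 0 < d & forall w : C * C, nc (w.1 - z.1) < d -> nc (w.2 - z.2) < d ->
    nc (f w - f z - (A * (w.1 - z.1) + B * (w.2 - z.2))) <= e * (nc (w.1 - z.1) + nc (w.2 - z.2)).

Lemma norm_pair (h : C * C) : `|h| = (Num.max (nc h.1) (nc h.2))%:C.
Proof.
by rewrite prod_normE !normE /Order.max ltcR; case: ifP.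
Qed.

Definition lin2 (A B : C) (h : C * C) : C := A * h.1 + B * h.2.

Lemma lin2_linear A B : linear (lin2 A B).
Proof. by move=> c u v; rewrite /lin2 /= /GRing.scale /=; ring. Qed.

HB.instance Definition _ A B := GRing.isLinear.Build C (C * C)%type C _ (lin2 A B) (lin2_linear A B).

Lemma lin2_continuous A B : continuous (lin2 A B).
Proof.
move=> x; apply: cvgD.
  by apply: cvgM; [exact: cvg_cst | exact: cvg_fst].
by apply: cvgM; [exact: cvg_cst | exact: cvg_snd].
Qed.

Lemma lin_approx_diff f z A B : lin_approx f z A B ->
  differentiable f z /\ 'd f z = lin2 A B :> (C * C -> C).
Proof.
move=> hf.
have key (e : C) : 0 < e -> \forall h \near (0 : C * C),
    `|f (h + z) - (f z + lin2 A B h)| <= e * `|h|.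
  move=> e0; have [e1 e2] : 0 < complex.Re e /\ e = (complex.Re e)%:C.
    by rewrite RRe_real ?gtr0_real //; split=> //; move: e0; rewrite ltcE /= => /andP[].
  have [|d d0 hd] := hf (complex.Re e / 2); first by rewrite divr_gt0.
  apply/near_nc2; exists d => //= h; rewrite !subr0 => h1 h2.
  have /= := hd (h + z); rewrite !addrK => /(_ h1 h2) hh.
  rewrite normE norm_pair e2 -rmorphM lecR /= opprD addrA.
  apply: le_trans hh _; rewrite -mulrA ler_pM2l //.
  have m1 : nc h.1 <= Num.max (nc h.1) (nc h.2) by rewrite le_max lexx.
  have m2 : nc h.2 <= Num.max (nc h.1) (nc h.2) by rewrite le_max lexx orbT.
  lra.
have dE : 'd f z = lin2 A B :> (C * C -> C).
  by apply: diff_unique; [exact: lin2_continuous | apply/eqaddoP => e /key].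
split=> //; apply/diff_locallyP; rewrite dE; split; first exact: lin2_continuous.
by apply/eqaddoP => e /key.
Qed.

Lemma lin_approx_differentiable f z A B : lin_approx f z A B -> differentiable f z.
Proof. by move=> /lin_approx_diff []. Qed.

Lemma lin_approx_derive f z A B : lin_approx f z A B -> dx f z = A /\ dy f z = B.
Proof.
move=> /lin_approx_diff [df dE]; rewrite /dx /dy !deriveE // dE /lin2 /=.
by rewrite !mulr1 !mulr0 addr0 add0r.
Qed.

Lemma differentiable_lin_approx f z : differentiable f z -> lin_approx f z (dx f z) (dy f z).
Proof.
move=> df e e0; have [dc] := (proj1 (diff_locallyP _ _) df).
move=> /eqaddoP /(_ e%:C); rewrite ltcR => /(_ e0) /near_nc2 [d d0 hd].
exists d => // w h1 h2; have := hd (w - z); rewrite /= !subr0 => /(_ h1 h2).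
rewrite normE norm_pair -rmorphM lecR /=.
rewrite -[X in nc X]/(f (w - z + z) - (f z + 'd f z (w - z))) subrK opprD addrA.
have -> : 'd f z (w - z) = dx f z * (w.1 - z.1) + dy f z * (w.2 - z.2).
  have -> : w - z = (w.1 - z.1) *: (1, 0) + (w.2 - z.2) *: (0, 1) :> C * C.
    by apply/pair_equal_spec; rewrite /= /GRing.scale /= !mulr1 !mulr0 addr0 add0r; case: (w) (z) => ? ? [? ?].
  by rewrite linearD !linearZ /dx /dy !deriveE // /GRing.scale /= mulrC [X in _ + X]mulrC.
move=> h; apply: le_trans h _; rewrite ler_pM2l // ge_max.
by rewrite lerDl lerDr !nc_ge0.
Qed.

End LinearApproximation.

(** * Contour integrals and the theorem of Goursat *)

Section Integral.
Variable R : realType.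
Local Notation C := R[i].
Local Notation mu := (@lebesgue_measure R).
Implicit Types (a b : R) (u v : R -> R) (f g : R -> C).

Definition contR a b u := forall x, a <= x <= b -> forall e, 0 < e ->
  exists2 d, 0 < d & forall y, a <= y <= b -> `|y - x| < d -> `|u y - u x| < e.

Lemma contR_within a b u : contR a b u -> {within `[a, b], continuous u}.
Proof.
move=> h; apply/subspace_continuousP => x /=; rewrite in_itv /= => hx.
apply/cvgrPdist_lt => e e0; have [d d0 hd] := h x hx e e0.
rewrite near_withinE; apply/nbhs_ballP; exists d => //= y.
rewrite /ball /= => hy; rewrite in_itv /= => hy'.
by rewrite distrC; apply: hd => //; rewrite distrC.
Qed.

Lemma contR_int a b u : contR a b u -> mu.-integrable `[a, b] (EFin \o u).
Proof.
move=> h; apply: continuous_compact_integrable; first exact: segment_compact.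
exact: contR_within.
Qed.

Definition RI a b u : R := (\int[mu]_(t in `[a, b]) u t)%R.

Lemma RI_D a b u v : contR a b u -> contR a b v -> RI a b (fun t => u t + v t) = RI a b u + RI a b v.
Proof. by move=> hu hv; rewrite /RI RintegralD //; exact: contR_int. Qed.

Lemma RI_Z a b k u : contR a b u -> RI a b (fun t => k * u t) = k * RI a b u.
Proof. by move=> hu; rewrite /RI RintegralZl //; exact: contR_int. Qed.

Lemma RI_ext a b u v : (forall t, a <= t <= b -> u t = v t) -> RI a b u = RI a b v.
Proof.
move=> h; apply: eq_Rintegral => t; rewrite inE /= in_itv /=; exact: h.
Qed.

Lemma contR_cst a b k : contR a b (fun=> k).
Proof. by move=> x hx e e0; exists 1 => // y _ _; rewrite subrr normr0. Qed.

Lemma RI_cst a b k : a <= b -> RI a b (fun=> k) = k * (b - a).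
Proof.
move=> ab; rewrite /RI Rintegral_cst //; congr (_ * _).
have := lebesgue_measure_itv (`[a, b] : interval R); rewrite /= => ->.
rewrite lte_fin; case: ltP => // ba; have -> : b = a by apply/eqP; rewrite eq_le ab ba.
by rewrite subrr.
Qed.

Lemma RI_le a b u v : contR a b u -> contR a b v -> (forall t, a <= t <= b -> u t <= v t) ->
  RI a b u <= RI a b v.
Proof.
move=> /contR_int hu /contR_int hv h; rewrite /RI.
by apply: (le_Rintegral _ hu hv) => // t /=; rewrite in_itv /=; apply: h.
Qed.

Lemma RI_bound a b u M : a <= b -> contR a b u -> (forall t, a <= t <= b -> `|u t| <= M) ->
  `|RI a b u| <= M * (b - a).
Proof.
move=> ab hu hM; rewrite -RI_cst //.
have hc : contR a b (fun=> M) by exact: contR_cst.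
have huN : contR a b (fun t => -1 * u t).
  move=> x hx e e0; have [d d0 hd] := hu x hx e e0; exists d => // y hy hyx.
  by rewrite !mulN1r -opprD normrN; apply: hd.
rewrite ler_norml; apply/andP; split.
  rewrite lerNl -mulN1r -RI_Z //; apply: RI_le => // t ht; apply: le_trans (hM t ht).
  by rewrite mulN1r -normrN ler_norm.
apply: RI_le => // t ht; apply: le_trans (hM t ht); exact: ler_norm.
Qed.

Lemma RI_split a m b u : a <= m <= b -> contR a b u -> RI a b u = RI a m u + RI m b u.
Proof.
move=> /andP[am mb] hu.
have := @Rintegral_itvB R u (BLeft a) (BRight b) m (contR_int hu).
rewrite !bnd_simp => /(_ am mb) h; rewrite /RI.
have im : contR m b u.
  move=> x /andP[mx xb] e e0; have [|d d0 hd] := hu x _ e e0; first by rewrite xb (le_trans am).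
  by exists d => // y /andP[my yb]; apply: hd; rewrite yb (le_trans am).
rewrite -[X in _ = _ + X]Rintegral_itv_obnd_cbnd.
  by rewrite -h addrC subrK.
by apply: integrableS (contR_int im) => //; apply: subset_itv; rewrite bnd_simp.
Qed.

Lemma RI_FTC a b u v : a < b -> contR a b v -> (forall t, a <= t <= b -> is_derive t 1 u (v t)) ->
  RI a b v = u b - u a.
Proof.
move=> ab hv hu; rewrite /RI /Rintegral (@continuous_FTC2 _ v u) //.
- exact: contR_within.
- have cu t : a <= t <= b -> {for t, continuous u}.
    by move=> /hu h; apply: differentiable_continuous; apply/derivable1_diffP; apply: ex_derive.
  split.
  + move=> t; rewrite in_itv /= => /andP[h1 h2]; have ? := hu t; apply: ex_derive; apply: hu.
    by rewrite !ltW.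
  + by apply: cvg_at_right_filter; apply: cu; rewrite lexx ltW.
  + by apply: cvg_at_left_filter; apply: cu; rewrite lexx ltW.
- move=> t; rewrite in_itv /= => /andP[h1 h2]; rewrite derive1E; apply: derive_val.
  by apply: hu; rewrite !ltW.
Qed.

End Integral.

Section ContourIntegral.
Variable R : realType.
Local Notation C := R[i].
Local Notation Re := (@complex.Re R).
Local Notation Im := (@complex.Im R).
Implicit Types (a b c d x y : R).

Lemma ReD (z w : C) : Re (z + w) = Re z + Re w. Proof. by case: z w => ? ? [? ?]. Qed.
Lemma ImD (z w : C) : Im (z + w) = Im z + Im w. Proof. by case: z w => ? ? [? ?]. Qed.
Lemma ReN (z : C) : Re (- z) = - Re z. Proof. by case: z. Qed.
Lemma ImN (z : C) : Im (- z) = - Im z. Proof. by case: z. Qed.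
Lemma ReM (z w : C) : Re (z * w) = Re z * Re w - Im z * Im w. Proof. by case: z w => ? ? [? ?]. Qed.
Lemma ImM (z w : C) : Im (z * w) = Re z * Im w + Im z * Re w. Proof. by case: z w => ? ? [? ?]. Qed.

Definition reimE := (ReD, ImD, ReN, ImN, ReM, ImM).

Lemma eqC (z w : C) : Re z = Re w -> Im z = Im w -> z = w.
Proof. by case: z w => ? ? [? ?] /= -> ->. Qed.

Definition contC a b (f : R -> C) := forall x, a <= x <= b -> forall e, 0 < e ->
  exists2 d, 0 < d & forall y, a <= y <= b -> `|y - x| < d -> nc (f y - f x) < e.

Definition CI a b (f : R -> C) : C := RI a b (fun t => Re (f t)) +i* RI a b (fun t => Im (f t)).

Lemma contC_Re a b f : contC a b f -> contR a b (fun t => Re (f t)).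
Proof.
move=> h x hx e e0; have [d d0 hd] := h x hx e e0; exists d => // y hy hyx.
by apply: le_lt_trans (hd y hy hyx); rewrite -ReN -ReD; apply: nc_Re.
Qed.

Lemma contC_Im a b f : contC a b f -> contR a b (fun t => Im (f t)).
Proof.
move=> h x hx e e0; have [d d0 hd] := h x hx e e0; exists d => // y hy hyx.
by apply: le_lt_trans (hd y hy hyx); rewrite -ImN -ImD; apply: nc_Im.
Qed.

Lemma contR_Z a b k u : contR a b u -> contR a b (fun t => k * u t).
Proof.
move=> h x hx e e0; have [|d d0 hd] := h x hx (e / (`|k| + 1)); first by rewrite divr_gt0 // ltr_wpDl.
exists d => // y hy hyx; rewrite -mulrBr normrM.
have k0 : 0 < `|k| + 1 by rewrite ltr_wpDl.
have := hd y hy hyx; rewrite ltr_pdivlMr // => h'; apply: le_lt_trans h'.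
by rewrite mulrC ler_wpM2l // lerDl.
Qed.

Lemma contR_D a b u v : contR a b u -> contR a b v -> contR a b (fun t => u t + v t).
Proof.
move=> hu hv x hx e e0.
have [|d d0 hd] := hu x hx (e / 2); first by rewrite divr_gt0.
have [|d' d0' hd'] := hv x hx (e / 2); first by rewrite divr_gt0.
exists (Num.min d d'); first by rewrite lt_min d0.
move=> y hy; rewrite lt_min => /andP[h1 h2]; rewrite opprD addrACA.
by apply: le_lt_trans (ler_normD _ _) _; rewrite [e]splitr ltrD // ?hd ?hd'.
Qed.

Lemma CI_lin a b (k : C) f g : contC a b f -> contC a b g ->
  CI a b (fun t => k * f t + g t) = k * CI a b f + CI a b g.
Proof.
move=> hf hg.
have [f1 f2 g1 g2] : [/\ contR a b (fun t => Re (f t)), contR a b (fun t => Im (f t)),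
   contR a b (fun t => Re (g t)) & contR a b (fun t => Im (g t))].
  by split; [exact: contC_Re | exact: contC_Im | exact: contC_Re | exact: contC_Im].
apply/eqP; rewrite eq_complex ReD ImD ReM ImM /=; apply/andP; split; apply/eqP.
  rewrite (@RI_ext _ _ _ _ (fun t => (Re k * Re (f t) + (- Im k) * Im (f t)) + Re (g t))); last first.
    by move=> t _; rewrite ReD ReM mulNr.
  rewrite RI_D //; last by apply: contR_D; apply: contR_Z.
  by rewrite RI_D ?RI_Z ?mulNr //; apply: contR_Z.
rewrite (@RI_ext _ _ _ _ (fun t => (Re k * Im (f t) + Im k * Re (f t)) + Im (g t))); last first.
  by move=> t _; rewrite ImD ImM.
rewrite RI_D //; last by apply: contR_D; apply: contR_Z.
by rewrite RI_D ?RI_Z //; apply: contR_Z.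
Qed.

Lemma CI_ext a b f g : (forall t, a <= t <= b -> f t = g t) -> CI a b f = CI a b g.
Proof. by move=> h; rewrite /CI; congr (_ +i* _); apply: RI_ext => t /h ->. Qed.

Lemma CI_bound a b f M : a <= b -> contC a b f -> (forall t, a <= t <= b -> nc (f t) <= M) ->
  nc (CI a b f) <= 2 * M * (b - a).
Proof.
move=> ab hf hM; apply: le_trans (nc_ReIm _) _; rewrite -mulrA mulr_natl mulr2n /=.
by apply: lerD; apply: RI_bound => //; [exact: contC_Re | | exact: contC_Im |] => t ht;
   apply: le_trans (hM t ht); [exact: nc_Re | exact: nc_Im].
Qed.

Lemma CI_split a m b f : a <= m <= b -> contC a b f -> CI a b f = CI a m f + CI m b f.
Proof.
move=> am hf; rewrite /CI (RI_split am (contC_Re hf)) (RI_split am (contC_Im hf)).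
by apply/eqP; rewrite eq_complex ReD ImD /= !eqxx.
Qed.

Lemma is_derive_eps (u : R -> R) t l : (forall e, 0 < e -> exists2 d, 0 < d &
   forall s, `|s - t| < d -> `|u s - u t - l * (s - t)| <= e * `|s - t|) -> is_derive t 1 u l.
Proof.
move=> h.
have hc : (fun s : R => s^-1 *: ((u \o shift t) (s *: 1) - u t)) @ 0^' --> l.
  apply/cvgrPdist_le => e e0; have [d d0 hd] := h e e0.
  near=> s; have s0 : s != 0 by near: s; exact: nbhs_dnbhs_neq.
  have sd : `|s| < d by near: s; apply: dnbhs0_lt.
  have := hd (s + t); rewrite addrK => /(_ sd) hs.
  rewrite /= /GRing.scale /= mulr1 -(ler_pM2r (x := `|s|)) ?normr_gt0 //.
  apply: le_trans hs; rewrite -normrM mulrBl mulrAC mulVf // mul1r distrC //.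
by split; [apply/cvg_ex; exists l | apply: cvg_lim].
Unshelve. all: by end_near.
Qed.

Lemma CI_FTC a b (P p : R -> C) : a <= b -> contC a b p ->
  (forall t, a <= t <= b -> forall e, 0 < e -> exists2 d, 0 < d &
    forall s, `|s - t| < d -> nc (P s - P t - p t * (s - t)%:C) <= e * `|s - t|) ->
  CI a b p = P b - P a.
Proof.
rewrite le_eqVlt => /orP[/eqP ab|ab] hp hP.
  have r0 u : RI a b u = 0 by rewrite -ab /RI set_itv1 Rintegral_set1.
  by rewrite /CI !r0 ab subrr.
apply/eqP; rewrite eq_complex !ReD !ImD !ReN !ImN /=; apply/andP; split; apply/eqP.
  apply: (RI_FTC (u := fun t => Re (P t))) => //; first exact: contC_Re.
  move=> t ht; apply: is_derive_eps => e e0; have [d d0 hd] := hP t ht e e0.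
  exists d => // s hs; apply: le_trans (hd s hs); apply: le_trans (nc_Re _).
  by rewrite !(ReD, ReN, ReM) /= mulr0 subr0.
apply: (RI_FTC (u := fun t => Im (P t))) => //; first exact: contC_Im.
move=> t ht; apply: is_derive_eps => e e0; have [d d0 hd] := hP t ht e e0.
exists d => // s hs; apply: le_trans (hd s hs); apply: le_trans (nc_Im _).
by rewrite !(ImD, ImN, ImM) /= mulr0 add0r.
Qed.

Definition onE a b c d (z : C) := [/\ a <= Re z <= b, c <= Im z <= d &
  [\/ Re z = a, Re z = b, Im z = c | Im z = d]].

Definition contE a b c d (f : C -> C) := forall z, onE a b c d z -> forall e, 0 < e ->
  exists2 r, 0 < r & forall w, onE a b c d w -> nc (w - z) < r -> nc (f w - f z) < e.

(* The integral of f along the boundary of the rectangle [a, b] x [c, d]. *)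
Definition BI a b c d (f : C -> C) : C :=
  CI a b (fun t => f (t +i* c)) - CI a b (fun t => f (t +i* d)) +
  'i * (CI c d (fun t => f (b +i* t)) - CI c d (fun t => f (a +i* t))).

Lemma nc_hor x y s : nc (x +i* s - (y +i* s)) = `|x - y|.
Proof. by rewrite -(ncR (x - y)); congr nc; apply: eqC; rewrite !reimE /= ?subrr. Qed.

Lemma nc_ver x y s : nc (s +i* x - (s +i* y)) = `|x - y|.
Proof.
rewrite -(ncR (x - y)) -[RHS]mul1r -(nci R) -ncM; congr nc.
by apply: eqC; rewrite !reimE /= !(subrr, mul0r, mulr0, mul1r, addr0, add0r).
Qed.

Lemma contE_edges a b c d f : a <= b -> c <= d -> contE a b c d f ->
  [/\ contC a b (fun t => f (t +i* c)), contC a b (fun t => f (t +i* d)),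
      contC c d (fun t => f (b +i* t)) & contC c d (fun t => f (a +i* t))].
Proof.
move=> ab cd h; split=> x hx e e0.
- have [|r r0 hr] := h (x +i* c) _ e e0; first by split; rewrite /= ?lexx //; constructor 3.
  by exists r => // y hy hyx; apply: hr; rewrite ?nc_hor //; split; rewrite /= ?lexx //; constructor 3.
- have [|r r0 hr] := h (x +i* d) _ e e0; first by split; rewrite /= ?lexx ?cd //; constructor 4.
  by exists r => // y hy hyx; apply: hr; rewrite ?nc_hor //; split; rewrite /= ?lexx ?cd //; constructor 4.
- have [|r r0 hr] := h (b +i* x) _ e e0; first by split; rewrite /= ?lexx ?ab //; constructor 2.
  by exists r => // y hy hyx; apply: hr; rewrite ?nc_ver //; split; rewrite /= ?lexx ?ab //; constructor 2.
- have [|r r0 hr] := h (a +i* x) _ e e0; first by split; rewrite /= ?lexx ?ab //; constructor 1.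
  by exists r => // y hy hyx; apply: hr; rewrite ?nc_ver //; split; rewrite /= ?lexx ?ab //; constructor 1.
Qed.

Lemma BI_lin a b c d (k : C) f g : a <= b -> c <= d -> contE a b c d f -> contE a b c d g ->
  BI a b c d (fun z => k * f z + g z) = k * BI a b c d f + BI a b c d g.
Proof.
move=> ab cd /(contE_edges ab cd) [f1 f2 f3 f4] /(contE_edges ab cd) [g1 g2 g3 g4].
by rewrite /BI !CI_lin //; ring.
Qed.

Lemma BI_ext a b c d f g : a <= b -> c <= d -> (forall z, onE a b c d z -> f z = g z) ->
  BI a b c d f = BI a b c d g.
Proof.
move=> ab cd h; rewrite /BI; congr (_ - _ + _ * (_ - _)); apply: CI_ext => t ht; apply: h;
  split; rewrite /= ?lexx ?ab ?cd //.
- by constructor 3.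
- by constructor 4.
- by constructor 2.
- by constructor 1.
Qed.

Lemma BI_bound a b c d f M : a <= b -> c <= d -> contE a b c d f ->
  (forall z, onE a b c d z -> nc (f z) <= M) ->
  nc (BI a b c d f) <= 4 * M * (b - a + (d - c)).
Proof.
move=> ab cd cf hM; have [f1 f2 f3 f4] := contE_edges ab cd cf.
have m1 t : a <= t <= b -> nc (f (t +i* c)) <= M.
  by move=> ht; apply: hM; split; rewrite /= ?lexx ?ab ?cd //; constructor 3.
have m2 t : a <= t <= b -> nc (f (t +i* d)) <= M.
  by move=> ht; apply: hM; split; rewrite /= ?lexx ?ab ?cd //; constructor 4.
have m3 t : c <= t <= d -> nc (f (b +i* t)) <= M.
  by move=> ht; apply: hM; split; rewrite /= ?lexx ?ab ?cd //; constructor 2.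
have m4 t : c <= t <= d -> nc (f (a +i* t)) <= M.
  by move=> ht; apply: hM; split; rewrite /= ?lexx ?ab ?cd //; constructor 1.
have := CI_bound ab f1 m1; have := CI_bound ab f2 m2.
have := CI_bound cd f3 m3; have := CI_bound cd f4 m4.
rewrite /BI; set A := CI a b _; set B := CI a b _; set A' := CI c d _; set B' := CI c d _.
move=> h1 h2 h3 h4.
have := ncD (B - A) ('i * (B' - A')); have := ncB B A; have := ncB B' A'.
rewrite ncM nci mul1r => k1 k2 k3.
have -> : 4 * M * (b - a + (d - c)) = 2 * (2 * M * (b - a)) + 2 * (2 * M * (d - c)) by ring.
lra.
Qed.

Lemma BI_split_v a m b c d f : a <= m <= b -> contC a b (fun t => f (t +i* c)) ->
  contC a b (fun t => f (t +i* d)) -> BI a b c d f = BI a m c d f + BI m b c d f.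
Proof. by move=> am h1 h2; rewrite /BI (CI_split am h1) (CI_split am h2); ring. Qed.

Lemma BI_split_h a b c m d f : c <= m <= d -> contC c d (fun t => f (a +i* t)) ->
  contC c d (fun t => f (b +i* t)) -> BI a b c d f = BI a b c m f + BI a b m d f.
Proof. by move=> am h1 h2; rewrite /BI (CI_split am h1) (CI_split am h2); ring. Qed.

Definition cder (f : C -> C) z l := forall e, 0 < e -> exists2 d, 0 < d &
  forall w, nc (w - z) < d -> nc (f w - f z - l * (w - z)) <= e * nc (w - z).

Lemma BI_primitive a b c d (P p : C -> C) : a <= b -> c <= d -> contE a b c d p ->
  (forall z, onE a b c d z -> cder P z (p z)) -> BI a b c d p = 0.
Proof.
move=> ab cd cp hP; have [p1 p2 p3 p4] := contE_edges ab cd cp.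
have hor y : contC a b (fun t => p (t +i* y)) -> (forall t, a <= t <= b -> onE a b c d (t +i* y)) ->
    CI a b (fun t => p (t +i* y)) = P (b +i* y) - P (a +i* y).
  move=> hp ho; apply: (CI_FTC (P := fun t => P (t +i* y))) => // t ht e e0.
  have [r r0 hr] := hP _ (ho t ht) e e0; exists r => // s hs.
  have := hr (s +i* y); rewrite nc_hor => /(_ hs).
  by congr (nc (_ - _ * _) <= _); apply: eqC; rewrite !reimE /= ?subrr.
have ver x : contC c d (fun t => p (x +i* t)) -> (forall t, c <= t <= d -> onE a b c d (x +i* t)) ->
    'i * CI c d (fun t => p (x +i* t)) = P (x +i* d) - P (x +i* c).
  move=> hp ho; rewrite (CI_FTC (P := fun t => - 'i * P (x +i* t))) //.
    have i2 : 'i * 'i = -1 :> C by rewrite -expr2 sqr_i.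
    transitivity (- ('i * 'i) * (P (x +i* d) - P (x +i* c))); first by ring.
    by rewrite i2; ring.
  move=> t ht e e0.
  have [r r0 hr] := hP _ (ho t ht) e e0; exists r => // s hs.
  have := hr (x +i* s); rewrite nc_ver => /(_ hs).
  have -> : x +i* s - (x +i* t) = 'i * (s - t)%:C.
    by apply: eqC; rewrite !reimE /=; ring.
  have -> : - 'i * P (x +i* s) - - 'i * P (x +i* t) - p (x +i* t) * (s - t)%:C =
     - 'i * (P (x +i* s) - P (x +i* t) - p (x +i* t) * ('i * (s - t)%:C)).
    have i2 : 'i * 'i = -1 :> C by rewrite -expr2 sqr_i.
    have -> : p (x +i* t) * ('i * (s - t)%:C) = 'i * (p (x +i* t) * (s - t)%:C) by ring.
    rewrite [in RHS]mulrBr !mulNr [in RHS]mulrA i2; ring.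
  by rewrite ncM ncN nci mul1r.
rewrite /BI mulrBr hor //; last by move=> t ht; split; rewrite /= ?lexx ?ab ?cd //; constructor 3.
rewrite hor //; last by move=> t ht; split; rewrite /= ?lexx ?ab ?cd //; constructor 4.
rewrite ver //; last by move=> t ht; split; rewrite /= ?lexx ?ab ?cd //; constructor 2.
rewrite ver //; last by move=> t ht; split; rewrite /= ?lexx ?ab ?cd //; constructor 1.
ring.
Qed.

End ContourIntegral.

(** * Complex derivatives and Goursat's theorem for rectangles *)

Section Goursat.
Variable R : realType.
Local Notation C := R[i].
Local Notation Re := (@complex.Re R).
Local Notation Im := (@complex.Im R).
Implicit Types (a b c d x y : R) (f g : C -> C) (z w : C).

Lemma cder_cont f z l : cder f z l -> forall e, 0 < e -> exists2 d, 0 < d &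
  forall w, nc (w - z) < d -> nc (f w - f z) < e.
Proof.
move=> h e e0; have [d d0 hd] := h 1 ltr01.
have k0 : 0 < nc l + 2 by rewrite ltr_wpDl ?nc_ge0.
exists (Num.min d (e / (nc l + 2))); first by rewrite lt_min d0 divr_gt0.
move=> w; rewrite lt_min ltr_pdivlMr // => /andP[h1 h2].
have := hd w h1; have := ncD (f w - f z - l * (w - z)) (l * (w - z)).
rewrite subrK ncM => h3 h4; have := nc_ge0 (w - z); nra.
Qed.

Lemma cder_lin k f g z l m : cder f z l -> cder g z m ->
  cder (fun w => k * f w + g w) z (k * l + m).
Proof.
move=> hf hg e e0.
have k0 : 0 < nc k + 1 by rewrite ltr_wpDl ?nc_ge0.
have [|d d0 hd] := hf (e / 2 / (nc k + 1)); first by rewrite !divr_gt0.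
have [|d' d0' hd'] := hg (e / 2); first by rewrite divr_gt0.
exists (Num.min d d'); first by rewrite lt_min d0.
move=> w; rewrite lt_min => /andP[h1 h2].
have -> : k * f w + g w - (k * f z + g z) - (k * l + m) * (w - z) =
  k * (f w - f z - l * (w - z)) + (g w - g z - m * (w - z)) by ring.
apply: le_trans (ncD _ _) _; rewrite ncM.
have h4 := hd' w h2; have := hd w h1; rewrite mulrAC ler_pdivlMr // => h3.
have := nc_ge0 (f w - f z - l * (w - z)); nra.
Qed.

Lemma cderM f g z l m : cder f z l -> cder g z m ->
  cder (fun w => f w * g w) z (l * g z + f z * m).
Proof.
move=> hf hg e e0.
pose k := nc (g z) + nc l + nc (f z) + 1.
have k0 : 0 < k by rewrite ltr_wpDl // !addr_ge0 ?nc_ge0.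
have ek : 0 < e / 3 / k by rewrite !divr_gt0.
have [|d1 d10 h1] := hf (Num.min 1 (e / 3 / (k + 1))).
  by rewrite lt_min ltr01 !divr_gt0 // ltr_wpDl // ltW.
have [d2 d20 h2] := hg _ ek.
have [|d3 d30 h3] := cder_cont hg (e := Num.min 1 (e / 3 / k)).
  by rewrite lt_min ltr01.
exists (Num.min d1 (Num.min d2 d3)); first by rewrite !lt_min d10 d20.
move=> w; rewrite !lt_min => /andP[/h1 H1 /andP[/h2 H2 /h3]]; rewrite lt_min => /andP[H3 H4].
have -> : f w * g w - f z * g z - (l * g z + f z * m) * (w - z) =
   (f w - f z - l * (w - z)) * g w + l * (w - z) * (g w - g z) + f z * (g w - g z - m * (w - z)) by ring.
have gw : nc (g w) <= k + 1.
  have := ncD (g w - g z) (g z); rewrite subrK => h; apply: le_trans h _.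
  rewrite /k; have := nc_ge0 l; have := nc_ge0 (f z); lra.
have b1 : nc ((f w - f z - l * (w - z)) * g w) <= e / 3 * nc (w - z).
  rewrite ncM; apply: le_trans (ler_pM (nc_ge0 _) (nc_ge0 _) H1 gw) _.
  have k1 : 0 < k + 1 by lra.
  have m1 : Num.min 1 (e / 3 / (k + 1)) * (k + 1) <= e / 3.
    by rewrite -ler_pdivlMr // ge_min lexx orbT.
  by rewrite mulrAC ler_wpM2r ?nc_ge0.
have b2 : nc (l * (w - z) * (g w - g z)) <= e / 3 * nc (w - z).
  rewrite !ncM; have lk : nc l <= k by rewrite /k; have := nc_ge0 (g z); have := nc_ge0 (f z); lra.
  rewrite mulrAC ler_wpM2r ?nc_ge0 //.
  apply: le_trans (ler_pM (nc_ge0 _) (nc_ge0 _) lk (ltW H4)) _.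
  by rewrite mulrC divfK // gt_eqF.
have b3 : nc (f z * (g w - g z - m * (w - z))) <= e / 3 * nc (w - z).
  rewrite ncM; have lk : nc (f z) <= k by rewrite /k; have := nc_ge0 (g z); have := nc_ge0 l; lra.
  apply: le_trans (ler_pM (nc_ge0 _) (nc_ge0 _) lk H2) _.
  by rewrite mulrA [k * _]mulrC divfK // gt_eqF.
apply: le_trans (ncD _ _) _; have := ncD ((f w - f z - l * (w - z)) * g w) (l * (w - z) * (g w - g z)).
lra.
Qed.

Lemma nc_inv_bound z w (r : R) : 0 < r -> r <= nc (z - w) -> nc (z - w)^-1 <= r^-1.
Proof. by move=> r0 h; rewrite ncV lef_pV2 // posrE // (lt_le_trans r0). Qed.

Lemma cder_inv w z : z != w -> cder (fun t => (t - w)^-1) z (- (z - w) ^- 2).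
Proof.
move=> zw e e0; pose r := nc (z - w).
have r0 : 0 < r by rewrite nc_gt0 subr_eq0.
(* The error is (t-z)^2 / ((t-w)(z-w)^2). The first bound gives |t-w| >= r/2, the second makes (2/r)
   r^(-2) |t-z| at most e. *)
exists (Num.min (r / 2) (e * r ^+ 3 / 2)); first by rewrite lt_min !divr_gt0 // mulr_gt0 // exprn_gt0.
move=> t; rewrite lt_min => /andP[h1 h2].
have ht : r / 2 <= nc (t - w).
  have := nc_tri z t w; rewrite -/r nc_sub; lra.
have t0 : t - w != 0 by rewrite -nc_gt0; apply: lt_le_trans ht; rewrite divr_gt0.
have z0 : z - w != 0 by rewrite subr_eq0.
have -> : (t - w)^-1 - (z - w)^-1 - - (z - w) ^- 2 * (t - z) =
   (t - w)^-1 * (z - w) ^- 2 * (t - z) * (t - z) by field; rewrite t0 z0.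
rewrite !ncM ler_wpM2r ?nc_ge0 // !ncV ncX -/r.
have i1 : (nc (t - w))^-1 <= 2 / r.
  by rewrite -[2 / r]invf_div lef_pV2 // posrE ?divr_gt0 // (lt_le_trans _ ht) // divr_gt0.
have i2 : 0 < (r ^+ 2)^-1 by rewrite invr_gt0 exprn_gt0.
apply: le_trans (_ : 2 / r * (r ^+ 2)^-1 * (e * r ^+ 3 / 2) <= _).
  apply: ler_pM; [by apply: mulr_ge0; [rewrite invr_ge0 nc_ge0 | exact: ltW] | exact: nc_ge0 | | exact: ltW].
  by rewrite ler_wpM2r // ltW.
by rewrite le_eqVlt; apply/orP; left; apply/eqP; field; rewrite gt_eqF.
Qed.

Lemma cder_cst k z : cder (fun=> k) z 0.
Proof. by move=> e e0; exists 1 => // w _; rewrite subrr mul0r subr0 nc0 mulr_ge0 ?nc_ge0 // ltW. Qed.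

Lemma cder_id z : cder (fun w => w) z 1.
Proof. by move=> e e0; exists 1 => // w _; rewrite mul1r subrr nc0 mulr_ge0 ?nc_ge0 // ltW. Qed.

Lemma contE_cder a b c d f : (forall z, onE a b c d z -> exists l, cder f z l) -> contE a b c d f.
Proof.
move=> h z hz e e0; have [l hl] := h z hz; have [r r0 hr] := cder_cont hl e0.
by exists r => // w _; apply: hr.
Qed.

Lemma contC_cder_hor a b c f : (forall t, a <= t <= b -> exists l, cder f (t +i* c) l) ->
  contC a b (fun t => f (t +i* c)).
Proof.
move=> h x hx e e0; have [l hl] := h x hx; have [r r0 hr] := cder_cont hl e0.
by exists r => // y _ hy; apply: hr; rewrite nc_hor.
Qed.

Lemma contC_cder_ver a c d f : (forall t, c <= t <= d -> exists l, cder f (a +i* t) l) ->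
  contC c d (fun t => f (a +i* t)).
Proof.
move=> h x hx e e0; have [l hl] := h x hx; have [r r0 hr] := cder_cont hl e0.
by exists r => // y _ hy; apply: hr; rewrite nc_ver.
Qed.

Lemma pow2_large (r e : R) : 0 < e -> exists n : nat, r / 2 ^+ n < e.
Proof.
move=> e0; have [r0|r0] := leP r 0.
  by exists 0%N; rewrite expr0 divr1; apply: le_lt_trans e0.
exists (Num.bound (r / e)); rewrite ltr_pdivrMr ?exprn_gt0 // mulrC -ltr_pdivrMr //.
have := archi_boundP (ltW (divr_gt0 r0 e0)) => h; apply: lt_le_trans h _.
by rewrite -natrX ler_nat ltnW // ltn_expl.
Qed.

Lemma nested_point (u v : nat -> R) : (forall n, u n <= u n.+1) -> (forall n, v n.+1 <= v n) ->
  (forall n, u n <= v n) -> exists x, forall n, u n <= x <= v n.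
Proof.
move=> hu hv huv.
have mu n m : (n <= m)%N -> u n <= u m.
  by move=> /subnK <-; elim: (m - n)%N => // k ih; rewrite addSn; apply: le_trans (hu _).
have mv n m : (n <= m)%N -> v m <= v n.
  by move=> /subnK <-; elim: (m - n)%N => // k ih; rewrite addSn; apply: le_trans ih.
have uv n m : u n <= v m.
  by apply: le_trans (mu _ _ (leq_maxl n m)) _; apply: le_trans (mv _ _ (leq_maxr n m)); apply: huv.
exists (sup (range u)) => n; apply/andP; split.
  by apply: ub_le_sup; [exists (v 0%N) => _ [k _ <-]; exact: uv | exists n].
by apply: ge_sup; [exists (u 0%N), 0%N | move=> _ [k _ <-]; exact: uv].
Qed.

(** Compactness by subdivision: a failing rectangle has a failing quarter, and the nested quarters
    shrink to a point where the local hypothesis is contradicted. *)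
Lemma bisection (P : R -> R -> R -> R -> Prop) a0 b0 c0 d0 : a0 <= b0 -> c0 <= d0 ->
  (forall a b c d, [/\ a0 <= a, a <= b & b <= b0] -> [/\ c0 <= c, c <= d & d <= d0] ->
     P a ((a + b) / 2) c ((c + d) / 2) -> P ((a + b) / 2) b c ((c + d) / 2) ->
     P a ((a + b) / 2) ((c + d) / 2) d -> P ((a + b) / 2) b ((c + d) / 2) d -> P a b c d) ->
  (forall x y, a0 <= x <= b0 -> c0 <= y <= d0 -> exists2 r, 0 < r &
     forall a b c d, [/\ a0 <= a, a <= x <= b & b <= b0] -> [/\ c0 <= c, c <= y <= d & d <= d0] ->
       b - a < r -> d - c < r -> P a b c d) ->
  P a0 b0 c0 d0.
Proof.
move=> ab0 cd0 hstep hloc; apply: contrapT => nP.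
pose valid (s : R * R * R * R) := let: (a, b, c, d) := s in
  [/\ a0 <= a, a <= b & b <= b0] /\ [/\ c0 <= c, c <= d & d <= d0] /\ ~ P a b c d.
pose half (s t : R * R * R * R) := let: (a, b, c, d) := s in let: (a', b', c', d') := t in
  [/\ a <= a', b' <= b, c <= c' & d' <= d] /\ b' - a' = (b - a) / 2 /\ d' - c' = (d - c) / 2.
have hnext : forall s, exists t, valid s -> valid t /\ half s t.
  move=> [[[a b] c] d]; case: (pselect (valid (a, b, c, d))) => [|nv]; last by exists (a, b, c, d).
  move=> [h1 [h2 h3]]; case: (h1) => l1 l2 l3; case: (h2) => m1 m2 m3.
  have [q1|q1] := pselect (P a ((a + b) / 2) c ((c + d) / 2)); last first.
    exists (a, (a + b) / 2, c, (c + d) / 2) => _; split; first by split; [split|split; [split|]]=> //; lra.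
    by split; [split|split] => //; lra.
  have [q2|q2] := pselect (P ((a + b) / 2) b c ((c + d) / 2)); last first.
    exists ((a + b) / 2, b, c, (c + d) / 2) => _; split; first by split; [split|split; [split|]]=> //; lra.
    by split; [split|split] => //; lra.
  have [q3|q3] := pselect (P a ((a + b) / 2) ((c + d) / 2) d); last first.
    exists (a, (a + b) / 2, (c + d) / 2, d) => _; split; first by split; [split|split; [split|]]=> //; lra.
    by split; [split|split] => //; lra.
  have [q4|q4] := pselect (P ((a + b) / 2) b ((c + d) / 2) d); last first.
    exists ((a + b) / 2, b, (c + d) / 2, d) => _; split; first by split; [split|split; [split|]]=> //; lra.
    by split; [split|split] => //; lra.
  by case: h3; apply: hstep.
have /choice [next hn] := hnext.
pose s n := iter n next (a0, b0, c0, d0).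
have vs n : valid (s n).
  elim: n => [|n ih]; first by split; [split; rewrite ?lexx|split; [split; rewrite ?lexx|]].
  by have [] := hn _ ih.
have hs n : half (s n) (s n.+1) by have [] := hn _ (vs n).
pose u n := (s n).1.1.1; pose v n := (s n).1.1.2; pose u' n := (s n).1.2; pose v' n := (s n).2.
have Es n : s n = (u n, v n, u' n, v' n) by rewrite /u /v /u' /v'; case: (s n) => [[[]]].
have H1 n : [/\ a0 <= u n, u n <= v n & v n <= b0] /\ [/\ c0 <= u' n, u' n <= v' n & v' n <= d0] /\
    ~ P (u n) (v n) (u' n) (v' n) by have := vs n; rewrite Es.
have H2 n : [/\ u n <= u n.+1, v n.+1 <= v n, u' n <= u' n.+1 & v' n.+1 <= v' n] /\
   v n.+1 - u n.+1 = (v n - u n) / 2 /\ v' n.+1 - u' n.+1 = (v' n - u' n) / 2.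
  by have := hs n; rewrite !Es.
have [x hx] : exists x, forall n, u n <= x <= v n.
  by apply: nested_point => n; [have [[]] := H2 n | have [[]] := H2 n | have [[]] := H1 n].
have [y hy] : exists x, forall n, u' n <= x <= v' n.
  by apply: nested_point => n; [have [[]] := H2 n | have [[]] := H2 n | have [_ [[]]] := H1 n].
have [|| r r0 hr] := hloc x y; [exact: (hx 0%N) | exact: (hy 0%N) |].
have wid n : v n - u n = (b0 - a0) / 2 ^+ n /\ v' n - u' n = (d0 - c0) / 2 ^+ n.
  elim: n => [|n [ih1 ih2]]; first by rewrite expr0 !divr1.
  by have [_ [-> ->]] := H2 n; rewrite ih1 ih2 exprSr !invfM !mulrA.
have [n hn'] := pow2_large (Num.max (b0 - a0) (d0 - c0)) r0.
have [[p1 p2 p3] [[p4 p5 p6] np]] := H1 n; apply: np; apply: hr => //.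
- rewrite (proj1 (wid n)); apply: le_lt_trans hn'; apply: ler_wpM2r; last by rewrite le_max lexx.
  by rewrite invr_ge0 exprn_ge0.
- rewrite (proj2 (wid n)); apply: le_lt_trans hn'; apply: ler_wpM2r; last by rewrite le_max lexx orbT.
  by rewrite invr_ge0 exprn_ge0.
Qed.

Lemma goursat a0 b0 c0 d0 f : a0 <= b0 -> c0 <= d0 ->
  (forall z, a0 <= Re z <= b0 -> c0 <= Im z <= d0 -> exists l, cder f z l) -> BI a0 b0 c0 d0 f = 0.
Proof.
move=> ab0 cd0 hf.
(* The bound is quadratic in the half perimeter s, so that it passes from the quarters to the whole:
   4 (s/2)^2 = s^2. *)
suff H e : 0 < e -> nc (BI a0 b0 c0 d0 f) <= e * (b0 - a0 + (d0 - c0)) ^+ 2.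
  apply/eqP; rewrite -nc_eq0 eq_le nc_ge0 andbT; apply/ler_addgt0Pl => e e0; rewrite addr0.
  pose k := (b0 - a0 + (d0 - c0)) ^+ 2 + 1.
  have k0 : 0 < k by rewrite ltr_wpDl // sqr_ge0.
  have := H (e / k); rewrite divr_gt0 // => /(_ isT) h; apply: le_trans h _.
  rewrite mulrAC ler_pdivrMr // ler_wpM2l ?ltW // /k; lra.
move=> e0.
apply: (@bisection (fun a b c d => nc (BI a b c d f) <= e * (b - a + (d - c)) ^+ 2)) => //.
  move=> a b c d [h1 h2 h3] [k1 k2 k3]; set m := (a + b) / 2; set n := (c + d) / 2.
  have [am mb] : a <= m /\ m <= b by rewrite /m; split; lra.
  have [cn nd] : c <= n /\ n <= d by rewrite /n; split; lra.
  have hor y : c0 <= y <= d0 -> contC a b (fun t => f (t +i* y)).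
    move=> hy; apply: contC_cder_hor => t /andP[t1 t2]; apply: hf => //=.
    by rewrite (le_trans h1 t1) (le_trans t2 h3).
  have ver x : a0 <= x <= b0 -> contC c d (fun t => f (x +i* t)).
    move=> hx; apply: contC_cder_ver => t /andP[t1 t2]; apply: hf => //=.
    by rewrite (le_trans k1 t1) (le_trans t2 k3).
  move=> q1 q2 q3 q4.
  rewrite (@BI_split_v _ a m b c d f); last 3 first.
  - by rewrite am.
  - by apply: hor; rewrite k1 (le_trans k2).
  - by apply: hor; rewrite k3 (le_trans _ k2).
  rewrite (@BI_split_h _ a m c n d f); last 3 first.
  - by rewrite cn.
  - by apply: ver; rewrite h1 (le_trans h2).
  - by apply: ver; rewrite (le_trans h1 am) (le_trans mb h3).
  rewrite (@BI_split_h _ m b c n d f); last 3 first.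
  - by rewrite cn.
  - by apply: ver; rewrite (le_trans h1 am) (le_trans mb h3).
  - by apply: ver; rewrite h3 (le_trans h1).
  apply: le_trans (ncD _ _) _.
  have := ncD (BI a m c n f) (BI a m n d f); have := ncD (BI m b c n f) (BI m b n d f).
  have -> : e * (b - a + (d - c)) ^+ 2 = 4 * (e * ((b - a) / 2 + (d - c) / 2) ^+ 2) by field.
  have e1 : m - a = (b - a) / 2 by rewrite /m; field.
  have e2 : b - m = (b - a) / 2 by rewrite /m; field.
  have e3 : n - c = (d - c) / 2 by rewrite /n; field.
  have e4 : d - n = (d - c) / 2 by rewrite /n; field.
  rewrite e1 e2 e3 e4 in q1 q2 q3 q4 *; lra.
move=> x y hx hy; pose z := x +i* y.
have [l hl] : exists l, cder f z l by apply: hf.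
have [|r r0 hr] := hl (e / 4); first by rewrite divr_gt0.
exists (r / 2); first by rewrite divr_gt0.
move=> a b c d [h1 h2 h3] [k1 k2 k3] br dr.
have ab : a <= b by case/andP: h2; apply: le_trans.
have cd : c <= d by case/andP: k2; apply: le_trans.
(* Subtracting the affine approximation, which has a primitive, does not change the integral; the
   remainder is at most e/4 times the half perimeter. *)
pose g w := -1 * (f z + l * (w - z)) + f w.
pose af w := f z + l * (w - z).
have daf w : cder af w l.
  have h := cder_lin l (cder_id w) (cder_cst (f z - l * z) w).
  move=> e' e0'; have [r' r0' hr'] := h e' e0'; exists r' => // t /hr'.
  by congr (nc _ <= _); rewrite /af; ring.
have zb : a <= Re z <= b by [].
have onE_in w : onE a b c d w -> exists l, cder f w l.
  move=> [/andP[p1 p2] /andP[p3 p4] _]; apply: hf.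
    by rewrite (le_trans h1 p1) (le_trans p2 h3).
  by rewrite (le_trans k1 p3) (le_trans p4 k3).
have cf : contE a b c d f by apply: contE_cder.
have caf : contE a b c d af by apply: contE_cder => w _; eexists; exact: daf.
have eg : BI a b c d f = BI a b c d g.
  rewrite /g (BI_lin (-1) ab cd caf cf).
  rewrite (@BI_primitive _ a b c d (fun w => (f z - l * z) * w + l / 2 * (w * w)) af) ?mulr0 ?add0r //.
  move=> w _.
  have h := cder_lin (f z - l * z) (cder_id w) (cder_lin (l / 2) (cderM (cder_id w) (cder_id w)) (cder_cst 0 w)).
  move=> e' e0'; have [r' r0' hr'] := h e' e0'; exists r' => // t /hr'.
  by congr (nc _ <= _); rewrite /af; field.
have cg : contE a b c d g.
  apply: contE_cder => w hw; have [m hm] := onE_in w hw.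
  by eexists; apply: cder_lin (daf w) hm.
rewrite eg.
have hM w : onE a b c d w -> nc (g w) <= e / 4 * (b - a + (d - c)).
  move=> [/andP[p1 p2] /andP[p3 p4] _].
  have hw : nc (w - z) <= b - a + (d - c).
    apply: le_trans (nc_ReIm _) _; rewrite !reimE /=.
    move: h2 k2 => /andP[? ?] /andP[? ?].
    by apply: lerD; rewrite ler_norml; apply/andP; split; lra.
  have hw' : nc (w - z) < r by apply: le_lt_trans hw _; lra.
  have -> : g w = f w - f z - l * (w - z) by rewrite /g; ring.
  by apply: le_trans (hr w hw') _; rewrite ler_wpM2l // ltW // divr_gt0.
apply: le_trans (BI_bound ab cd cg hM) _.
by rewrite le_eqVlt; apply/orP; left; apply/eqP; field.
Qed.

End Goursat.

(** * The formulas of Cauchy and Hadamard *)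

Section Cauchy.
Variable R : realType.
Local Notation C := R[i].
Local Notation Re := (@complex.Re R).
Local Notation Im := (@complex.Im R).
Implicit Types (a b c d x y : R) (f g : C -> C) (z w h : C).

Lemma contE_lin a b c d k f g : contE a b c d f -> contE a b c d g ->
  contE a b c d (fun z => k * f z + g z).
Proof.
move=> hf hg z hz e e0.
have k0 : 0 < nc k + 1 by rewrite ltr_wpDl ?nc_ge0.
have [|d1 d10 hd] := hf z hz (e / 2 / (nc k + 1)); first by rewrite !divr_gt0.
have [|d2 d20 hd'] := hg z hz (e / 2); first by rewrite divr_gt0.
exists (Num.min d1 d2); first by rewrite lt_min d10.
move=> w hw; rewrite lt_min => /andP[h1 h2].
have -> : k * f w + g w - (k * f z + g z) = k * (f w - f z) + (g w - g z) by ring.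
apply: le_lt_trans (ncD _ _) _; rewrite ncM.
have h4 := hd' w hw h2; have := hd w hw h1; rewrite ltr_pdivlMr // => h3.
have := nc_ge0 (f w - f z); nra.
Qed.

Lemma contE_mul a b c d f g : contE a b c d f -> contE a b c d g ->
  contE a b c d (fun z => f z * g z).
Proof.
move=> hf hg z hz e e0.
pose k := nc (f z) + nc (g z) + 1.
have k0 : 0 < k by rewrite ltr_wpDl // addr_ge0 ?nc_ge0.
have [|d1 d10 hd] := hf z hz (e / 2 / (k + 1)); first by rewrite !divr_gt0 // ltr_wpDl // ltW.
have [|d2 d20 hd'] := hg z hz (Num.min 1 (e / 2 / k)); first by rewrite lt_min ltr01 !divr_gt0.
exists (Num.min d1 d2); first by rewrite lt_min d10.
move=> w hw; rewrite lt_min => /andP[h1 h2].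
have := hd' w hw h2; rewrite lt_min ltr_pdivlMr // => /andP[h3 h4].
have := hd w hw h1; rewrite ltr_pdivlMr; last by rewrite ltr_wpDl // ltW.
move=> h5.
have -> : f w * g w - f z * g z = (f w - f z) * g w + f z * (g w - g z) by ring.
apply: le_lt_trans (ncD _ _) _; rewrite !ncM.
have gw : nc (g w) <= k + 1.
  by have := ncD (g w - g z) (g z); rewrite subrK /k; have := nc_ge0 (f z); lra.
have fz : nc (f z) <= k by rewrite /k; have := nc_ge0 (g z); lra.
have b1 : nc (f w - f z) * nc (g w) <= nc (f w - f z) * (k + 1) by rewrite ler_wpM2l ?nc_ge0.
have b2 : nc (f z) * nc (g w - g z) <= k * nc (g w - g z) by rewrite ler_wpM2r ?nc_ge0.
lra.
Qed.

Lemma contE_cst a b c d k : contE a b c d (fun=> k).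
Proof. by move=> z _ e e0; exists 1 => // w _ _; rewrite subrr nc0. Qed.

Variable r : R.
Hypothesis r0 : 0 < r.

Definition onQ z := onE (- r) r (- r) r z.
Definition contQ f := contE (- r) r (- r) r f.
Definition J f := BI (- r) r (- r) r f.

Let rr : - r <= r. Proof. by apply: (@le_trans _ _ 0); rewrite ?oppr_le0 ltW. Qed.

Lemma onQ_ge z : onQ z -> r <= nc z.
Proof.
case=> _ _ [h|h|h|h].
- by apply: le_trans (nc_Re z); rewrite h normrN ger0_norm // ltW.
- by apply: le_trans (nc_Re z); rewrite h ger0_norm // ltW.
- by apply: le_trans (nc_Im z); rewrite h normrN ger0_norm // ltW.
- by apply: le_trans (nc_Im z); rewrite h ger0_norm // ltW.
Qed.

Lemma J_lin k f g : contQ f -> contQ g -> J (fun z => k * f z + g z) = k * J f + J g.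
Proof. exact: BI_lin. Qed.

Lemma J_ext f g : (forall z, onQ z -> f z = g z) -> J f = J g.
Proof. exact: BI_ext. Qed.

Lemma J_bound f M : contQ f -> (forall z, onQ z -> nc (f z) <= M) -> nc (J f) <= 16 * r * M.
Proof.
move=> cf hM; apply: le_trans (BI_bound rr rr cf hM) _.
by rewrite le_eqVlt; apply/orP; left; apply/eqP; ring.
Qed.

Lemma inv_bound z w : onQ z -> nc w <= r / 2 -> z != w /\ nc (z - w)^-1 <= 2 / r.
Proof.
move=> hz hw; have h := onQ_ge hz.
have k : r / 2 <= nc (z - w) by have := nc_tri z w 0; rewrite !subr0; lra.
have k0 : 0 < r / 2 by rewrite divr_gt0.
split; first by rewrite -subr_eq0 -nc_gt0 (lt_le_trans k0).
by rewrite -[2 / r]invf_div; apply: nc_inv_bound.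
Qed.

Lemma contQ_inv w : nc w <= r / 2 -> contQ (fun z => (z - w)^-1).
Proof.
move=> hw; apply: contE_cder => z hz; have [zw _] := inv_bound hz hw.
by eexists; apply: cder_inv.
Qed.

(** Four cuts remove strips that avoid w, and Goursat's theorem makes each contribute 0. *)
Lemma BI_shrink a b c d a' b' c' d' f w :
  a <= a' -> a' < Re w -> Re w < b' -> b' <= b -> c <= c' -> c' < Im w -> Im w < d' -> d' <= d ->
  (forall z, a <= Re z <= b -> c <= Im z <= d -> z != w -> exists l, cder f z l) ->
  BI a b c d f = BI a' b' c' d' f.
Proof.
move=> aa' aw wb bb' cc' cw wd dd' hf.
have ab' : a' <= b' by apply: ltW; apply: lt_trans wb.
have cd' : c' <= d' by apply: ltW; apply: lt_trans wd.
have ab : a' <= b := le_trans ab' bb'.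
have cd : c' <= d := le_trans cd' dd'.
have a_b' : a <= b' := le_trans aa' ab'.
have c_d' : c <= d' := le_trans cc' cd'.
have a_b : a <= b := le_trans aa' ab.
have c_d : c <= d := le_trans cc' cd.
have chor x1 x2 y : a <= x1 -> x2 <= b -> c <= y <= d -> y != Im w -> contC x1 x2 (fun t => f (t +i* y)).
  move=> h1 h2 h3 h4; apply: contC_cder_hor => t /andP[t1 t2]; apply: hf => //=.
    by rewrite (le_trans h1 t1) (le_trans t2 h2).
  by rewrite eq_complex negb_and h4 orbT.
have cver x y1 y2 : c <= y1 -> y2 <= d -> a <= x <= b -> x != Re w -> contC y1 y2 (fun t => f (x +i* t)).
  move=> h1 h2 h3 h4; apply: contC_cder_ver => t /andP[t1 t2]; apply: hf => //=.
    by rewrite (le_trans h1 t1) (le_trans t2 h2).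
  by rewrite eq_complex negb_and h4.
have gz x1 x2 y1 y2 : a <= x1 -> x1 <= x2 -> x2 <= b -> c <= y1 -> y1 <= y2 -> y2 <= d ->
    [\/ x2 < Re w, Re w < x1, y2 < Im w | Im w < y1] -> BI x1 x2 y1 y2 f = 0.
  move=> h1 h2 h3 h4 h5 h6 h7; apply: goursat => // z /andP[z1 z2] /andP[z3 z4]; apply: hf.
  - by rewrite (le_trans h1 z1) (le_trans z2 h3).
  - by rewrite (le_trans h4 z3) (le_trans z4 h6).
  - apply/eqP => zw; rewrite zw in z1 z2 z3 z4.
    by case: h7; apply/negP; rewrite -leNgt.
have na' : a' != Re w by rewrite lt_eqF.
have nb' : b' != Re w by rewrite gt_eqF.
have nc' : c' != Im w by rewrite lt_eqF.
have nd' : d' != Im w by rewrite gt_eqF.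
have nc_ : c != Im w by rewrite lt_eqF // (le_lt_trans cc').
have nd_ : d != Im w by rewrite gt_eqF // (lt_le_trans wd).
rewrite (@BI_split_v _ a a'); [|by rewrite aa'|by apply: chor; rewrite ?lexx|by apply: chor; rewrite ?lexx ?c_d].
rewrite (gz a) ?add0r ?lexx //; last by constructor 1.
rewrite (@BI_split_v _ a' b'); [|by rewrite ab'|by apply: chor; rewrite ?lexx|by apply: chor; rewrite ?lexx ?c_d].
rewrite [X in _ + X](gz b') ?addr0 ?lexx //; last by constructor 2.
rewrite (@BI_split_h _ _ _ c c'); [|by rewrite cc'|by apply: cver; rewrite ?lexx ?aa'|by apply: cver; rewrite ?lexx ?a_b'].
rewrite [X in X + _](gz a') ?add0r ?lexx //; last by constructor 3.
rewrite (@BI_split_h _ _ _ c' d'); [|by rewrite cd'|by apply: cver; rewrite ?lexx ?aa'|by apply: cver; rewrite ?lexx ?a_b'].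
by rewrite [X in _ + X](gz a') ?addr0 ?lexx //; constructor 4.
Qed.

(* Goursat reduces the contour to a small square around w, where the integrand is bounded. *)
Lemma cauchy_aux f w : nc w < r ->
  (forall z, - r <= Re z <= r -> - r <= Im z <= r -> exists l, cder f z l) ->
  J (fun z => (f z - f w) * (z - w)^-1) = 0.
Proof.
move=> wr hf; set q := fun z => _.
have [w1 w2] : - r < Re w < r /\ - r < Im w < r.
  by rewrite -!ltr_norml; split; apply: le_lt_trans wr; [exact: nc_Re | exact: nc_Im].
have [l hl] : exists l, cder f w l.
  by apply: hf; move: w1 w2 => /andP[? ?] /andP[? ?]; apply/andP; split; apply: ltW.
have hq z : - r <= Re z <= r -> - r <= Im z <= r -> z != w -> exists m, cder q z m.
  move=> h1 h2 zw; have [m hm] := hf z h1 h2.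
  have := cderM (cder_lin 1 hm (cder_cst (- f w) z)) (cder_inv zw) => h; eexists => e e0.
  have [d d0 hd] := h e e0; exists d => // t /hd; by rewrite /q !mul1r; exact.
have [d d0 hd] := hl 1 ltr01.
pose M := nc l + 1.
have M0 : 0 < M by rewrite ltr_wpDl ?nc_ge0.
have qM z : nc (z - w) < d -> nc (q z) <= M.
  move=> hz; rewrite /q; have [->|zw] := eqVneq z w; first by rewrite subrr mul0r nc0 ltW.
  have n0 : 0 < nc (z - w) by rewrite nc_gt0 subr_eq0.
  rewrite ncM ncV ler_pdivrMr //; have := hd z hz; have := ncD (f z - f w - l * (z - w)) (l * (z - w)).
  rewrite subrK ncM /M; lra.
have key e : 0 < e -> nc (J q) <= e.
  move=> e0.
  (* On the square of half side s the integral is at most 16 s M; hence the 16 and the term e / M.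
     The other terms keep the square inside the contour and inside the disc where q is bounded. *)
  pose s := Num.min (Num.min (r - `|Re w|) (r - `|Im w|)) (Num.min d (e / M)) / 16.
  have s16 : 0 < s /\ [/\ 16 * s <= r - `|Re w|, 16 * s <= r - `|Im w|, 16 * s <= d & 16 * s <= e / M].
    have -> : 16 * s = Num.min (Num.min (r - `|Re w|) (r - `|Im w|)) (Num.min d (e / M)).
      by rewrite /s mulrC divfK.
    split; last by rewrite !ge_min !lexx !orbT.
    by rewrite divr_gt0 // !lt_min !subr_gt0 d0 divr_gt0 // !ltr_norml w1 w2.
  case: s16 => s0 [sR sI sd se].
  have [a1 a2] : - r <= Re w - s /\ Re w + s <= r.
    by clear -sR s0; have := ler_norm (Re w); have := ler_norm (- Re w); rewrite normrN; split; lra.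
  have [b1 b2] : - r <= Im w - s /\ Im w + s <= r.
    by clear -sI s0; have := ler_norm (Im w); have := ler_norm (- Im w); rewrite normrN; split; lra.
  have lt1 x : x - s < x by rewrite ltrBlDr ltrDl.
  have lt2 x : x < x + s by rewrite ltrDl.
  have le3 x : x - s <= x + s by apply: ltW; apply: lt_trans (lt2 x).
  rewrite /J (@BI_shrink _ _ _ _ (Re w - s) (Re w + s) (Im w - s) (Im w + s) q w) //.
  apply: le_trans (BI_bound (M := M) (le3 _) (le3 _) _ _) _.
  - apply: contE_cder => z [/andP[z1 z2] /andP[z3 z4] h]; apply: hq.
    + by rewrite (le_trans a1 z1) (le_trans z2 a2).
    + by rewrite (le_trans b1 z3) (le_trans z4 b2).
    + apply/eqP => zw; rewrite zw in h; clear -h s0; case: h => /eqP; apply/negP.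
      * by rewrite gt_eqF // ltrBlDr ltrDl.
      * by rewrite lt_eqF // ltrDl.
      * by rewrite gt_eqF // ltrBlDr ltrDl.
      * by rewrite lt_eqF // ltrDl.
  - move=> z [z1 z2 _]; apply: qM; apply: le_lt_trans (nc_ReIm _) _.
    rewrite !ReD !ImD ReN ImN; clear -z1 z2 sd s0.
    have : `|Re z - Re w| <= s by rewrite ler_distl.
    have : `|Im z - Im w| <= s by rewrite ler_distl.
    lra.
  - by move: se; rewrite ler_pdivlMr //; clear; lra.
apply/eqP; rewrite -nc_eq0 eq_le nc_ge0 andbT; apply/ler_addgt0Pl => e e0; rewrite addr0; exact: key.
Qed.

End Cauchy.

(** * The constant of the Cauchy formula *)

Section Kappa.
Variable R : realType.
Local Notation C := R[i].
Local Notation Re := (@complex.Re R).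
Local Notation Im := (@complex.Im R).
Implicit Types (a b c d x y : R) (f g : C -> C) (z w h : C).
Variable r : R.
Hypothesis r0 : 0 < r.
Local Notation onQ := (onQ r).
Local Notation contQ := (contQ r).
Local Notation J := (J r).
Local Notation inv_bound := (inv_bound r0).
Local Notation contQ_inv := (contQ_inv r0).
Local Notation J_bound := (J_bound r0).
Local Notation J_lin := (J_lin r0).
Local Notation J_ext := (J_ext r0).

Let rr : - r <= r. Proof. by apply: (@le_trans _ _ 0); rewrite ?oppr_le0 ltW. Qed.

(* The value is 2 pi i, but only kappa != 0 is needed. *)
Definition kappa : C := J (fun z => z^-1).

Lemma rem1 z w w' : onQ z -> nc w <= r / 2 -> nc w' <= r / 2 ->
  (z - w')^-1 - (z - w)^-1 - (z - w) ^- 2 * (w' - w) = (z - w) ^- 2 * (z - w')^-1 * (w' - w) ^+ 2.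
Proof.
move=> hz hw hw'; have [h1 _] := inv_bound hz hw; have [h2 _] := inv_bound hz hw'.
by field; rewrite !subr_eq0 h1 h2.
Qed.

Lemma contE_ext a b c d f g : (forall z, f z = g z) -> contE a b c d f -> contE a b c d g.
Proof. by move=> fg hf z hz e e0; have [k k0 hk] := hf z hz e e0; exists k => // w hw h; rewrite -!fg; apply: hk. Qed.

Lemma invX2 (z : C) : z^-1 * z^-1 = z ^- 2.
Proof. by rewrite -expr2 exprVn. Qed.

Lemma contQ_inv2 w : nc w <= r / 2 -> contQ (fun z => (z - w) ^- 2).
Proof.
move=> hw; apply: contE_ext (contE_mul (contQ_inv hw) (contQ_inv hw)) => z; exact: invX2.
Qed.

Let i2r : 0 <= 2 / r. Proof. by rewrite divr_ge0 // ltW. Qed.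

Lemma inv2_bound z w : onQ z -> nc w <= r / 2 -> nc ((z - w) ^- 2) <= (2 / r) ^+ 2.
Proof.
move=> hz hw; have [_ h] := inv_bound hz hw.
by rewrite -invX2 ncM expr2; apply: ler_pM; rewrite ?nc_ge0.
Qed.

Lemma rem1_bound z w w' : onQ z -> nc w <= r / 2 -> nc w' <= r / 2 ->
  nc ((z - w')^-1 - (z - w)^-1 - (z - w) ^- 2 * (w' - w)) <= (2 / r) ^+ 3 * nc (w' - w) ^+ 2.
Proof.
move=> hz hw hw'; rewrite (rem1 hz hw hw') ncM ncX ler_wpM2r ?sqr_ge0 // ncM.
have [_ h] := inv_bound hz hw'; rewrite [(2 / r) ^+ 3]exprSr.
by apply: ler_pM; rewrite ?nc_ge0 // inv2_bound.
Qed.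

(* Subdividing [0, w] into n steps, each changing the integral by O(1/n^2). *)
Lemma kappa_cst w : nc w <= r / 2 -> J (fun z => (z - w)^-1) = kappa.
Proof.
move=> hw; pose k w := J (fun z => (z - w)^-1).
pose K := 16 * r * (2 / r) ^+ 3.
have step u v : nc u <= r / 2 -> nc v <= r / 2 -> nc (k v - k u) <= K * nc (v - u) ^+ 2.
  move=> hu hv.
  (* The first-order variation of the kernel has the primitive -(z-u)^(-1), so only the quadratic
     remainder contributes. *)
  have z2 : J (fun z => (z - u) ^- 2) = 0.
    apply: (@BI_primitive _ _ _ _ _ (fun z => -1 * (z - u)^-1 + 0)) => //; first exact: contQ_inv2.
    move=> z hz; have [zu _] := inv_bound hz hu.
    have h := cder_lin (-1) (cder_inv zu) (cder_cst 0 z).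
    by rewrite mulrNN mul1r addr0 in h.
  have -> : k v - k u = J (fun z => - (v - u) * (z - u) ^- 2 + (-1 * (z - u)^-1 + (z - v)^-1)).
    rewrite J_lin; [|exact: contQ_inv2|by apply: contE_lin; exact: contQ_inv].
    rewrite z2 mulr0 add0r J_lin; [|exact: contQ_inv|exact: contQ_inv].
    by rewrite mulN1r addrC.
  rewrite /K -mulrA; apply: J_bound.
    by apply: contE_lin; [exact: contQ_inv2 | apply: contE_lin; exact: contQ_inv].
  move=> z hz; apply: le_trans (rem1_bound hz hu hv).
  by rewrite le_eqVlt; apply/orP; left; apply/eqP; congr nc; ring.
have K0 : 0 <= K by rewrite /K mulr_ge0 ?exprn_ge0 // mulr_ge0 // ltW.
have E0 : k 0 = kappa by apply: J_ext => z _; rewrite subr0.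
rewrite -[LHS]/(k w) -E0; apply/eqP; rewrite -subr_eq0 -nc_eq0 eq_le nc_ge0 andbT.
apply/ler_addgt0Pl => e e0; rewrite addr0.
pose W := K * nc w ^+ 2.
have W0 : 0 <= W by rewrite mulr_ge0 // sqr_ge0.
have [n hn] : exists n : nat, W / n.+1%:R <= e.
  exists (Num.bound (W / e)); rewrite ler_pdivrMr ?ltr0n // mulrC -ler_pdivrMr //.
  have h := archi_boundP (divr_ge0 W0 (ltW e0)); apply: le_trans (ltW h) _; by rewrite ler_nat.
pose p j : C := (j%:R / n.+1%:R) * w.
have n0 : n.+1%:R != 0 :> C by rewrite pnatr_eq0.
have ncn j : nc (j%:R : C) = j%:R.
  by have := ncR (j%:R : R); rewrite rmorph_nat normr_nat.
have pj j : (j <= n.+1)%N -> nc (p j) <= r / 2.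
  move=> hj; apply: le_trans hw; rewrite /p !ncM ncV !ncn ler_piMl ?nc_ge0 //.
  by rewrite ler_pdivrMr ?ltr0n // mul1r ler_nat.
have key j : (j <= n.+1)%N -> nc (k (p j) - k 0) <= j%:R * (W / n.+1%:R ^+ 2).
  elim: j => [|j ih] hj; first by rewrite /p !mul0r subrr nc0.
  apply: le_trans (nc_tri _ (k (p j)) _) _.
  rewrite -(natr1 j) mulrDl mul1r addrC; apply: lerD; first by apply: ih; exact: ltnW.
  apply: le_trans (step _ _ (pj _ (ltnW hj)) (pj _ hj)) _.
  have -> : p j.+1 - p j = w / n.+1%:R by rewrite /p -mulrBl -mulrBl -natrB // subSnn mul1r mulrC.
  by rewrite ncM ncV ncn /W expr_div_n mulrA.
have := key n.+1 (leqnn _); have -> : p n.+1 = w by rewrite /p divff // mul1r.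
move=> h; apply: le_trans h _; apply: le_trans hn.
have : n.+1%:R != 0 :> R by rewrite pnatr_eq0.
move: (n.+1%:R : R) => N N0; rewrite le_eqVlt; apply/orP; left; apply/eqP; by field.
Qed.

End Kappa.

Section CauchyFormula.
Variable R : realType.
Local Notation C := R[i].
Local Notation Re := (@complex.Re R).
Local Notation Im := (@complex.Im R).
Implicit Types (a b c d x y : R) (f g : C -> C) (z w h : C).
Variable r : R.
Hypothesis r0 : 0 < r.
Local Notation onQ := (onQ r).
Local Notation contQ := (contQ r).
Local Notation J := (J r).
Local Notation kappa := (kappa r).
Local Notation inv_bound := (inv_bound r0).
Local Notation contQ_inv := (contQ_inv r0).
Local Notation J_bound := (J_bound r0).
Local Notation J_lin := (J_lin r0).
Local Notation J_ext := (J_ext r0).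

Let rr : - r <= r. Proof. by apply: (@le_trans _ _ 0); rewrite ?oppr_le0 ltW. Qed.

(** By symmetry the imaginary part is four times the integral of r/(t^2 + r^2) over [-r, r], and the
    integrand is at least 1/(2r). *)
Lemma kappa_neq0 : kappa != 0.
Proof.
pose v t := r / (t ^+ 2 + r ^+ 2).
have c0 : contQ (fun z => z^-1).
  apply: contE_ext (contQ_inv (w := 0) _); first by move=> z; rewrite subr0.
  by rewrite nc0 divr_ge0 // ltW.
have [p1 p2 p3 p4] := contE_edges rr rr c0.
have e1 t : Im (t +i* - r)^-1 = v t by rewrite /= mulNr opprK sqrrN.
have e2 t : Im (t +i* r)^-1 = - v t by rewrite /=.
have e3 t : Re (r +i* t)^-1 = v t by rewrite /= /v addrC.
have e4 t : Re ((- r) +i* t)^-1 = - v t by rewrite /= mulNr sqrrN /v addrC.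
have cv : contR (- r) r v.
  by move=> x hx e e0; have [d d0 hd] := contC_Im p1 hx e0; exists d => // y hy hyx; rewrite -!e1; apply: hd.
have cNv : contR (- r) r (fun t => -1 * v t) by apply: contR_Z.
have h1 : 1 <= RI (- r) r v.
  have -> : 1 = RI (- r) r (fun=> (2 * r)^-1).
    by rewrite RI_cst //; field; rewrite gt_eqF.
  apply: RI_le => // [|t /andP[t1 t2]]; first exact: contR_cst.
  have t2r : t ^+ 2 <= r ^+ 2 by rewrite -[t ^+ 2]real_normK ?num_real // lerXn2r ?nnegrE ?ler_norml ?t1 // ltW.
  have r2 : 0 < r ^+ 2 by rewrite exprn_gt0.
  have k0 : 0 < t ^+ 2 + r ^+ 2 by rewrite ltr_wpDl // sqr_ge0.
  rewrite ler_pdivlMr // mulrC ler_pdivrMr; last by rewrite mulr_gt0.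
  have -> : r * (2 * r) = r ^+ 2 + r ^+ 2 by ring.
  by rewrite lerD2r.
have h2 : RI (- r) r (fun t => - v t) = - RI (- r) r v.
  by rewrite -[RHS]mulN1r -RI_Z //; apply: RI_ext => t _; rewrite mulN1r.
have E : Im kappa = 4 * RI (- r) r v.
  rewrite /kappa /J /BI !(ImD, ImN, ImM) /= mul0r mul1r add0r.
  rewrite (@RI_ext _ _ _ _ _ (fun t _ => e1 t)) (@RI_ext _ _ _ _ _ (fun t _ => e2 t)).
  rewrite (@RI_ext _ _ _ _ _ (fun t _ => e3 t)) (@RI_ext _ _ _ _ _ (fun t _ => e4 t)) h2; ring.
by apply/eqP => k0; move: E h1; rewrite k0 /=; lra.
Qed.

Definition cvx z := - r <= Re z <= r /\ - r <= Im z <= r.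

Lemma onQ_cvx z : onQ z -> cvx z. Proof. by case. Qed.

Lemma contQ_cder f : (forall z, cvx z -> exists l, cder f z l) -> contQ f.
Proof. by move=> h; apply: contE_cder => z /onQ_cvx; apply: h. Qed.

Lemma contQ_mul f g : contQ f -> contQ g -> contQ (fun z => f z * g z).
Proof. exact: contE_mul. Qed.

Lemma contQ_cst k : contQ (fun=> k). Proof. exact: contE_cst. Qed.

Lemma contQ_ext f g : (forall z, f z = g z) -> contQ f -> contQ g.
Proof. exact: contE_ext. Qed.

Lemma contQ_lin k f g : contQ f -> contQ g -> contQ (fun z => k * f z + g z).
Proof. exact: contE_lin. Qed.

Lemma J_Z k f : contQ f -> J (fun z => k * f z) = k * J f.
Proof.
move=> hf; transitivity (J (fun z => k * f z + 0)); first by apply: J_ext => z _; rewrite addr0.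
rewrite J_lin //; last exact: contQ_cst.
have -> : J (fun=> 0) = 0; last by rewrite addr0.
apply/eqP; rewrite -nc_eq0 eq_le nc_ge0 andbT -(mulr0 (16 * r)).
by apply: J_bound => [|z _]; [exact: contQ_cst | rewrite nc0].
Qed.

Lemma cauchy_formula f w : nc w <= r / 2 -> (forall z, cvx z -> exists l, cder f z l) ->
  f w = kappa^-1 * J (fun z => f z * (z - w)^-1).
Proof.
move=> hw hf; have wr : nc w < r by move: r0; lra.
have cf : contQ f by exact: contQ_cder.
have := @cauchy_aux R r f w wr; case/(_ _)/Wrap => [z h1 h2|]; first by apply: hf.
rewrite (_ : J _ = J (fun z => - f w * (z - w)^-1 + f z * (z - w)^-1)); last first.
  by apply: J_ext => z _; ring.
rewrite J_lin; [|exact: contQ_inv|by apply: contQ_mul => //; exact: contQ_inv].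
rewrite (kappa_cst r0 hw) mulNr addrC => /eqP; rewrite subr_eq0 => /eqP ->.
by rewrite mulrC mulfK // kappa_neq0.
Qed.

(** Cauchy's integral for the derivative; [taylor2] shows that it is one, with a quadratic error
    uniform in w. *)
Definition fder f w := kappa^-1 * J (fun z => f z * (z - w) ^- 2).

(** The power (2/r + 1)^3 dominates both (2/r)^2 and (2/r)^3, so one constant bounds the derivative
    and the second-order remainder. *)
Definition Kd := nc kappa^-1 * (16 * r) * (2 / r + 1) ^+ 3.

Lemma Kd_ge0 : 0 <= Kd.
Proof.
have := ltW r0 => r0'.
by rewrite !mulr_ge0 ?nc_ge0 ?exprn_ge0 // addr_ge0 // divr_ge0.
Qed.

Lemma fder_bound f w M : nc w <= r / 2 -> (forall z, cvx z -> exists l, cder f z l) ->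
  (forall z, onQ z -> nc (f z) <= M) -> 0 <= M -> nc (fder f w) <= Kd * M.
Proof.
move=> hw hf hM M0; rewrite ncM /Kd -2!mulrA ler_wpM2l ?nc_ge0 //; apply: J_bound.
  by apply: contQ_mul; [exact: contQ_cder | exact: contQ_inv2].
move=> z hz; rewrite ncM mulrC; apply: ler_pM; rewrite ?nc_ge0 ?hM //.
apply: le_trans (inv2_bound r0 hz hw) _.
have k1 : 0 <= 2 / r by rewrite divr_ge0 // ltW.
apply: (@le_trans _ _ ((2 / r + 1) ^+ 2)).
  by rewrite lerXn2r ?nnegrE ?addr_ge0 // lerDl.
by rewrite (exprS _ 2) ler_peMl ?exprn_ge0 ?addr_ge0 // lerDr.
Qed.

Lemma taylor2 f w w' M : nc w <= r / 2 -> nc w' <= r / 2 ->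
  (forall z, cvx z -> exists l, cder f z l) -> (forall z, onQ z -> nc (f z) <= M) -> 0 <= M ->
  nc (f w' - f w - fder f w * (w' - w)) <= Kd * M * nc (w' - w) ^+ 2.
Proof.
move=> hw hw' hf hM M0; have cf := contQ_cder hf.
have ci u : nc u <= r / 2 -> contQ (fun z => f z * (z - u)^-1).
  by move=> hu; apply: contQ_mul => //; exact: contQ_inv.
have ci2 : contQ (fun z => f z * (z - w) ^- 2) by apply: contQ_mul => //; exact: contQ_inv2.
rewrite (cauchy_formula hw hf) (cauchy_formula hw' hf) /fder.
have -> : kappa^-1 * J (fun z => f z * (z - w')^-1) - kappa^-1 * J (fun z => f z * (z - w)^-1) -
   kappa^-1 * J (fun z => f z * (z - w) ^- 2) * (w' - w) = kappa^-1 *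
   J (fun z => - (w' - w) * (f z * (z - w) ^- 2) + (-1 * (f z * (z - w)^-1) + f z * (z - w')^-1)).
  rewrite J_lin //; last by apply: contQ_lin; exact: ci.
  by rewrite J_lin; [ring | exact: ci | exact: ci].
rewrite ncM /Kd -3!mulrA ler_wpM2l ?nc_ge0 //; apply: J_bound.
  by apply: contQ_lin => //; apply: contQ_lin; exact: ci.
move=> z hz.
have -> : - (w' - w) * (f z * (z - w) ^- 2) + (-1 * (f z * (z - w)^-1) + f z * (z - w')^-1) =
  f z * ((z - w')^-1 - (z - w)^-1 - (z - w) ^- 2 * (w' - w)) by ring.
rewrite ncM mulrCA; apply: ler_pM; rewrite ?nc_ge0 ?hM //.
apply: le_trans (rem1_bound r0 hz hw hw') _.
have k1 : 0 <= 2 / r by rewrite divr_ge0 // ltW.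
by rewrite ler_wpM2r ?sqr_ge0 // lerXn2r ?nnegrE ?addr_ge0 // lerDl.
Qed.

End CauchyFormula.

(** * Cauchy integrals depending on two parameters *)

Section Kernels.
Variable R : realType.
Local Notation C := R[i].
Local Notation Re := (@complex.Re R).
Local Notation Im := (@complex.Im R).
Implicit Types (x y z w h : C).
Variable r : R.
Hypothesis r0 : 0 < r.
Local Notation onQ := (onQ r).
Local Notation contQ := (contQ r).
Local Notation J := (J r).
Local Notation kappa := (kappa r).
Local Notation J_bound := (J_bound r0).
Local Notation J_lin := (J_lin r0).
Local Notation J_ext := (J_ext r0).

(* k1 is the derivative of the kernel k in its second argument; the second-order bound,
   uniform on the contour, allows differentiation under the integral. *)
Definition is_kernel (k k1 : C -> C -> C) := exists2 B : R, 0 <= B &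
  forall x, nc x <= r / 2 -> [/\ contQ (k^~ x), contQ (k1^~ x) &
    forall z, onQ z -> [/\ nc (k z x) <= B, nc (k1 z x) <= B &
      forall x', nc x' <= r / 2 ->
        nc (k z x' - k z x - k1 z x * (x' - x)) <= B * nc (x' - x) ^+ 2]].

Lemma kernel_inv : is_kernel (fun z x => (z - x)^-1) (fun z x => (z - x) ^- 2).
Proof.
have k1 : 0 <= 2 / r by rewrite divr_ge0 // ltW.
have le1 n : (2 / r) ^+ n <= (2 / r + 1) ^+ n by rewrite lerXn2r ?nnegrE ?addr_ge0 // lerDl.
have le3 n : (n <= 3)%N -> (2 / r + 1) ^+ n <= (2 / r + 1) ^+ 3.
  by move=> hn; rewrite ler_weXn2l // lerDr.
exists ((2 / r + 1) ^+ 3); first by rewrite exprn_ge0 ?addr_ge0.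
move=> x hx; split; [exact: contQ_inv | exact: contQ_inv2 |] => z hz; split.
- have [_ h] := inv_bound r0 hz hx; apply: le_trans h _.
  by apply: le_trans (le3 1%N _) => //; rewrite expr1 lerDl.
- by apply: le_trans (inv2_bound r0 hz hx) _; apply: le_trans (le1 _) _; apply: le3.
- move=> x' hx'; apply: le_trans (rem1_bound r0 hz hx hx') _.
  by rewrite ler_wpM2r ?sqr_ge0.
Qed.

Lemma kernel_cst (c : C -> C) B : 0 <= B -> contQ c -> (forall z, onQ z -> nc (c z) <= B) ->
  is_kernel (fun z x => c z) (fun z x => 0).
Proof.
move=> B0 cc hB; exists B => // x hx; split => //; first exact: contQ_cst.
move=> z hz; split; rewrite ?nc0 ?hB // => x' hx'.
by rewrite mul0r subr0 subrr nc0 mulr_ge0 // sqr_ge0.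
Qed.

Lemma kernelM k k1 l l1 : is_kernel k k1 -> is_kernel l l1 ->
  is_kernel (fun z x => k z x * l z x) (fun z x => k1 z x * l z x + k z x * l1 z x).
Proof.
move=> [B B0 hk] [B' B0' hl].
have rr0 := ltW r0.
have q0 : 0 <= 3 + r by rewrite addr_ge0.
exists (B * B' * (3 + r)); first by rewrite !mulr_ge0.
move=> x hx; have [ck ck1 bk] := hk x hx; have [cl cl1 bl] := hl x hx; split.
- exact: contQ_mul.
- apply: contQ_ext (contQ_lin 1 (contQ_mul ck1 cl) (contQ_mul ck cl1)) => z.
  by rewrite mul1r.
move=> z hz; have [k_ k1_ kr] := bk z hz; have [l_ l1_ lr] := bl z hz.
have BB : 0 <= B * B' by rewrite mulr_ge0.
have pr (u v : C) : nc u <= B -> nc v <= B' -> nc (u * v) <= B * B'.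
  by move=> h1 h2; rewrite ncM; apply: ler_pM; rewrite ?nc_ge0.
split.
- apply: le_trans (pr _ _ k_ l_) _; rewrite ler_peMr //; lra.
- apply: le_trans (ncD _ _) _; have := pr _ _ k1_ l_; have := pr _ _ k_ l1_.
  have : 0 <= B * B' * (1 + r) by rewrite mulr_ge0 // addr_ge0.
  by have -> : B * B' * (3 + r) = B * B' + B * B' + B * B' * (1 + r) by [ring]; lra.
move=> x' hx'; have Kr := kr x' hx'; have Lr := lr x' hx'; move: Kr Lr.
set h := x' - x; set n := nc h => Kr Lr.
have [_ _ /(_ z hz) [l_' _ _]] := hl x' hx'.
have n0 : 0 <= n by exact: nc_ge0.
have nr : n <= r by apply: le_trans (ncB _ _) _; lra.
have dl : nc (l z x' - l z x) <= B' * (1 + r) * n.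
  have := ncD (l z x' - l z x - l1 z x * h) (l1 z x * h); rewrite subrK => h1; apply: le_trans h1 _.
  have -> : B' * (1 + r) * n = B' * (r * n) + B' * n by ring.
  apply: lerD; last by rewrite ncM ler_wpM2r.
  apply: le_trans Lr _; rewrite expr2.
  by rewrite ler_wpM2l // ler_wpM2r.
have -> : k z x' * l z x' - k z x * l z x - (k1 z x * l z x + k z x * l1 z x) * h =
  (k z x' - k z x - k1 z x * h) * l z x' + k1 z x * h * (l z x' - l z x) +
  k z x * (l z x' - l z x - l1 z x * h) by ring.
have b1 : nc ((k z x' - k z x - k1 z x * h) * l z x') <= B * n ^+ 2 * B'.
  by rewrite ncM; apply: ler_pM; rewrite ?nc_ge0 //.
have b2 : nc (k1 z x * h * (l z x' - l z x)) <= B * n * (B' * (1 + r) * n).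
  by rewrite !ncM; apply: ler_pM; rewrite ?mulr_ge0 ?nc_ge0 // ler_wpM2r.
have b3 : nc (k z x * (l z x' - l z x - l1 z x * h)) <= B * (B' * n ^+ 2).
  by rewrite ncM; apply: ler_pM; rewrite ?nc_ge0 //.
apply: le_trans (ncD _ _) _; apply: le_trans (lerD (ncD _ _) (lexx _)) _.
apply: le_trans (lerD (lerD b1 b2) b3) _.
by rewrite le_eqVlt; apply/orP; left; apply/eqP; ring.
Qed.

Variable f : C * C -> C.
Variable M : R.
Hypothesis M0 : 0 <= M.
Hypothesis hf : forall z : C * C, nc z.1 <= 2 * r -> nc z.2 <= 2 * r -> exists A B, lin_approx f z A B.
Hypothesis hM : forall z : C * C, nc z.1 <= 2 * r -> nc z.2 <= 2 * r -> nc (f z) <= M.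

Lemma lin_approx_cder1 (g : C * C -> C) x y A B : lin_approx g (x, y) A B -> cder (fun x => g (x, y)) x A.
Proof.
move=> h e e0; have [d d0 hd] := h e e0; exists d => // w hw.
by have := hd (w, y); rewrite /= subrr nc0 mulr0 !addr0; apply.
Qed.

Lemma lin_approx_cder2 (g : C * C -> C) x y A B : lin_approx g (x, y) A B -> cder (fun y => g (x, y)) y B.
Proof.
move=> h e e0; have [d d0 hd] := h e e0; exists d => // w hw.
by have := hd (x, w); rewrite /= subrr nc0 mulr0 !add0r; apply.
Qed.

Lemma cvx_le z : cvx r z -> nc z <= 2 * r.
Proof.
case=> h1 h2; apply: le_trans (nc_ReIm z) _; rewrite mulr_natl mulr2n.
by apply: lerD; rewrite ler_norml.
Qed.

Let half2 z : nc z <= r / 2 -> nc z <= 2 * r.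
Proof. by move: r0; lra. Qed.

Definition f2 (z y : C) := fder r (fun y => f (z, y)) y.

Let cd1 y : nc y <= r / 2 -> forall z, cvx r z -> exists l, cder (fun x => f (x, y)) z l.
Proof.
move=> hy z hz; have [|A [B h]] := @hf (z, y) (cvx_le hz); first exact: half2.
by exists A; apply: lin_approx_cder1 h.
Qed.

Let cd2 z : onQ z -> forall y, cvx r y -> exists l, cder (fun y => f (z, y)) y l.
Proof.
move=> /onQ_cvx/cvx_le hz y hy; have [|A [B h]] := @hf (z, y) hz; first exact: cvx_le.
by exists B; apply: lin_approx_cder2 h.
Qed.

Let bd2 z : onQ z -> forall y, onQ y -> nc (f (z, y)) <= M.
Proof. by move=> /onQ_cvx/cvx_le hz y /onQ_cvx/cvx_le hy; apply: hM. Qed.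

Lemma contQ_unif g : (forall e, 0 < e -> exists2 u, contQ u & forall z, onQ z -> nc (g z - u z) <= e) ->
  contQ g.
Proof.
move=> h z hz e e0; have [|u cu hu] := h (e / 4); first by rewrite divr_gt0.
have [|d d0 hd] := cu z hz (e / 4); first by rewrite divr_gt0.
exists d => // w hw hwz; have := hd w hw hwz; have := hu z hz; have := hu w hw.
have := nc_tri (g w) (u w) (g z); have := nc_tri (u w) (u z) (g z).
rewrite [nc (u z - g z)]nc_sub; lra.
Qed.

(** By [taylor2] the difference quotients in y converge uniformly on the contour, and they are
    continuous there. *)
Lemma contQ_f2 y : nc y < r / 2 -> contQ (fun z => f2 z y).
Proof.
move=> hy; apply: contQ_unif => e e0.
have K0 : 0 <= Kd r * M by rewrite mulr_ge0 // Kd_ge0.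
have K1 : 0 < Kd r * M + 1 by rewrite ltr_wpDl.
pose d := Num.min (r / 2 - nc y) (e / (Kd r * M + 1)).
have d0 : 0 < d by rewrite lt_min subr_gt0 hy divr_gt0.
pose h : C := d%:C.
have nh : nc h = d by rewrite ncR gtr0_norm.
have h0 : h != 0 by rewrite -nc_gt0 nh.
have hy1 : nc y <= r / 2 by exact: ltW.
have hy2 : nc (y + h) <= r / 2.
  apply: le_trans (ncD _ _) _; rewrite nh.
  have : d <= r / 2 - nc y by rewrite ge_min lexx.
  lra.
exists (fun z => h^-1 * f (z, y + h) + - h^-1 * f (z, y)).
  apply: contQ_lin; first exact: (contQ_cder (cd1 hy2)).
  by apply: contQ_mul; [exact: contQ_cst | exact: (contQ_cder (cd1 hy1))].
move=> z hz.
have := taylor2 r0 hy1 hy2 (cd2 hz) (bd2 hz) M0; rewrite -/(f2 z y) (_ : y + h - y = h) ?nh => [H|]; last by ring.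
have -> : f2 z y - (h^-1 * f (z, y + h) + - h^-1 * f (z, y)) =
   - h^-1 * (f (z, y + h) - f (z, y) - f2 z y * h) by field.
rewrite ncM ncN ncV nh mulrC ler_pdivrMr //; apply: le_trans H _.
rewrite expr2 mulrA ler_wpM2r //; first exact: ltW.
have : d <= e / (Kd r * M + 1) by rewrite ge_min lexx orbT.
rewrite ler_pdivlMr // => H; have := ltW d0; nra.
Qed.

Lemma f2_bound z y : onQ z -> nc y <= r / 2 -> nc (f2 z y) <= Kd r * M.
Proof. by move=> hz hy; apply: fder_bound => //; [exact: cd2 | exact: bd2]. Qed.

(** A Cauchy integral in the first variable only, the second being carried along in f. Admissible
    kernels are closed under products, so differentiation stays within this class. *)
Definition KI (k : C -> C -> C) (p : C * C) := J (fun z => f (z, p.2) * k z p.1).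

Lemma kernel_lin_approx k k1 p : is_kernel k k1 -> nc p.1 < r / 2 -> nc p.2 < r / 2 ->
  lin_approx (KI k) p (KI k1 p) (J (fun z => f2 z p.2 * k z p.1)).
Proof.
move=> [B B0 hk] hx hy.
have hx1 := ltW hx; have hy1 := ltW hy.
pose D (q : C * C) := nc (q.1 - p.1) + nc (q.2 - p.2).
(* The three summands bound the product of the two increments, the remainder of the kernel and the
   remainder of f. *)
pose K := Kd r * M * (1 + r) * B + M * B + Kd r * M * B.
have Kd0 : 0 <= Kd r * M by rewrite mulr_ge0 // Kd_ge0.
have rr0 := ltW r0.
have r1 : 0 <= 1 + r by rewrite addr_ge0.
have K0 : 0 <= K.
  by apply: addr_ge0; [apply: addr_ge0 |]; apply: mulr_ge0 => //; apply: mulr_ge0.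
have [ck ck1 bk] := hk _ hx1.
have key (q : C * C) : nc q.1 <= r / 2 -> nc q.2 <= r / 2 ->
    nc (KI k q - KI k p - (KI k1 p * (q.1 - p.1) + J (fun z => f2 z p.2 * k z p.1) * (q.2 - p.2))) <=
    16 * r * (K * D q ^+ 2).
  move=> qx qy; have [ck' _ _] := hk _ qx.
  have c1 : contQ (fun z => f (z, q.2) * k z q.1) by apply: contQ_mul => //; exact: (contQ_cder (cd1 qy)).
  have c2 : contQ (fun z => f (z, p.2) * k z p.1) by apply: contQ_mul => //; exact: (contQ_cder (cd1 hy1)).
  have c3 : contQ (fun z => f (z, p.2) * k1 z p.1) by apply: contQ_mul => //; exact: (contQ_cder (cd1 hy1)).
  have c4 : contQ (fun z => f2 z p.2 * k z p.1) by apply: contQ_mul => //; exact: contQ_f2.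
  set h := q.1 - p.1; set l := q.2 - p.2.
  have -> : KI k q - KI k p - (KI k1 p * h + J (fun z => f2 z p.2 * k z p.1) * l) =
    J (fun z => - l * (f2 z p.2 * k z p.1) + (- h * (f (z, p.2) * k1 z p.1) +
        (-1 * (f (z, p.2) * k z p.1) + f (z, q.2) * k z q.1))).
    rewrite J_lin //; last by apply: contQ_lin => //; exact: contQ_lin.
    rewrite J_lin //; last exact: contQ_lin.
    by rewrite J_lin // /KI; ring.
  apply: J_bound => [|z hz]; first by apply: contQ_lin => //; apply: contQ_lin => //; exact: contQ_lin.
  have [k_ k1_ kr] := bk z hz.
  have Rk := kr _ qx; rewrite -/h in Rk.
  have Rf := taylor2 r0 hy1 qy (cd2 hz) (bd2 hz) M0; rewrite -/(f2 z p.2) -/l in Rf.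
  have f2b := f2_bound hz hy1.
  have fq : nc (f (z, q.2)) <= M.
    by apply: hM => /=; [exact: cvx_le (onQ_cvx hz) | exact: half2].
  have h0 : 0 <= nc h by exact: nc_ge0.
  have l0 : 0 <= nc l by exact: nc_ge0.
  have lr : nc l <= r by apply: le_trans (ncB _ _) _; lra.
  have df : nc (f (z, q.2) - f (z, p.2)) <= Kd r * M * (1 + r) * nc l.
    have := ncD (f (z, q.2) - f (z, p.2) - f2 z p.2 * l) (f2 z p.2 * l); rewrite subrK => h1.
    apply: le_trans h1 _.
    have -> : Kd r * M * (1 + r) * nc l = Kd r * M * (r * nc l) + Kd r * M * nc l by ring.
    apply: lerD; last by rewrite ncM ler_wpM2r.
    apply: le_trans Rf _; rewrite expr2.
    by rewrite ler_wpM2l // ler_wpM2r.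
  have -> : - l * (f2 z p.2 * k z p.1) + (- h * (f (z, p.2) * k1 z p.1) +
        (-1 * (f (z, p.2) * k z p.1) + f (z, q.2) * k z q.1)) =
     (f (z, q.2) - f (z, p.2)) * (k1 z p.1 * h) + f (z, q.2) * (k z q.1 - k z p.1 - k1 z p.1 * h) +
     (f (z, q.2) - f (z, p.2) - f2 z p.2 * l) * k z p.1 by ring.
  have hD : nc h <= D q by rewrite lerDl.
  have lD : nc l <= D q by rewrite lerDr.
  have D0 : 0 <= D q by rewrite addr_ge0.
  have b1 : nc ((f (z, q.2) - f (z, p.2)) * (k1 z p.1 * h)) <= Kd r * M * (1 + r) * D q * (B * D q).
    rewrite ncM ncM; apply: ler_pM; [exact: nc_ge0 | by rewrite mulr_ge0 ?nc_ge0 | |].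
      by apply: le_trans df _; apply: ler_wpM2l => //; apply: mulr_ge0.
    by apply: ler_pM; rewrite ?nc_ge0.
  have sq n : 0 <= n -> n <= D q -> n ^+ 2 <= D q ^+ 2 by move=> n0 nD; rewrite lerXn2r ?nnegrE.
  have b2 : nc (f (z, q.2) * (k z q.1 - k z p.1 - k1 z p.1 * h)) <= M * (B * D q ^+ 2).
    rewrite ncM; apply: ler_pM; rewrite ?nc_ge0 //; apply: le_trans Rk _.
    by rewrite ler_wpM2l // sq.
  have b3 : nc ((f (z, q.2) - f (z, p.2) - f2 z p.2 * l) * k z p.1) <= Kd r * M * D q ^+ 2 * B.
    rewrite ncM; apply: ler_pM; rewrite ?nc_ge0 //; apply: le_trans Rf _.
    by rewrite ler_wpM2l // sq.
  apply: le_trans (ncD _ _) _; apply: le_trans (lerD (ncD _ _) (lexx _)) _.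
  apply: le_trans (lerD (lerD b1 b2) b3) _.
  by rewrite le_eqVlt; apply/orP; left; apply/eqP; rewrite /K; ring.
move=> e e0.
pose K' := 16 * r * K.
have K'0 : 0 <= K' by rewrite !mulr_ge0.
have K'1 : 0 < K' + 1 by rewrite ltr_wpDl.
exists (Num.min (Num.min (r / 2 - nc p.1) (r / 2 - nc p.2)) (e / (K' + 1) / 2)).
  by rewrite !lt_min !subr_gt0 hx hy !divr_gt0.
move=> w; rewrite !lt_min => /andP[/andP[w1 _] w3] /andP[/andP[_ v2] v3].
apply: le_trans (key w _ _) _.
- have := ncD (w.1 - p.1) p.1; rewrite subrK; lra.
- have := ncD (w.2 - p.2) p.2; rewrite subrK; lra.
have D0 : 0 <= D w by rewrite addr_ge0 ?nc_ge0.
rewrite mulrA -/K' -/(D w) expr2 mulrA ler_wpM2r //.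
have : D w <= e / (K' + 1) by rewrite /D; lra.
by rewrite ler_pdivlMr // => H; nra.
Qed.

End Kernels.

(** * Derivatives of holomorphic germs and Hadamard's lemma *)

Section Germs.
Local Opaque dx dy.
Variable R : realType.
Local Notation C := R[i].
Local Notation Re := (@complex.Re R).
Local Notation Im := (@complex.Im R).
Implicit Types (f g : C * C -> C) (z w p : C * C) (A B : C).

Lemma near0P (P : C * C -> Prop) : (\forall z \near (0 : C * C), P z) <->
  exists2 e : R, 0 < e & forall z, nc z.1 < e -> nc z.2 < e -> P z.
Proof.
split=> [/near_nc2 [e e0 h]|[e e0 h]].
  by exists e => // z h1 h2; apply: h; rewrite /= subr0.
by apply/near_nc2; exists e => // z; rewrite /= !subr0; apply: h.
Qed.

Lemma hol_linP f : holomorphic_germ f <-> exists2 e : R, 0 < e &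
  forall z, nc z.1 < e -> nc z.2 < e -> exists A B, lin_approx f z A B.
Proof.
split=> [/near0P [e e0 h]|[e e0 h]].
  by exists e => // z h1 h2; exists (dx f z), (dy f z); apply: differentiable_lin_approx; apply: h.
by apply/near0P; exists e => // z h1 h2; have [A [B]] := h z h1 h2; apply: lin_approx_differentiable.
Qed.

Lemma lin_approx_congr f g z A B (d : R) : 0 < d ->
  (forall w, nc (w.1 - z.1) < d -> nc (w.2 - z.2) < d -> f w = g w) ->
  lin_approx f z A B -> lin_approx g z A B.
Proof.
move=> d0 fg h e e0; have [k k0 hk] := h e e0; exists (Num.min d k); first by rewrite lt_min d0.
move=> w; rewrite !lt_min => /andP[a1 a2] /andP[b1 b2].
have := hk w a2 b2; rewrite (fg w) // (fg z) //; by rewrite subrr nc0.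
Qed.

Lemma lin_approx_near f g A B e z : 0 < e -> nc z.1 < e -> nc z.2 < e ->
  (forall w, nc w.1 < e -> nc w.2 < e -> f w = g w) -> lin_approx f z A B -> lin_approx g z A B.
Proof.
move=> e0 h1 h2 fg; pose d := Num.min (e - nc z.1) (e - nc z.2).
apply: (@lin_approx_congr _ _ _ _ _ d); first by rewrite lt_min !subr_gt0 h1.
move=> w; rewrite !lt_min => /andP[a1 _] /andP[_ b2]; apply: fg.
  by have := ncD (w.1 - z.1) z.1; rewrite subrK; lra.
by have := ncD (w.2 - z.2) z.2; rewrite subrK; lra.
Qed.

Lemma hol_near f g : holomorphic_germ f -> (\forall z \near (0 : C * C), f z = g z) -> holomorphic_germ g.
Proof.
move=> /hol_linP [e e0 hf] /near0P [d d0 fg]; apply/hol_linP.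
exists (Num.min e d) => [|z]; rewrite ?lt_min ?e0 // => /andP[a1 a2] /andP[b1 b2].
have [A [B h]] := hf z a1 b1; exists A, B; exact: (lin_approx_near d0 a2 b2 fg).
Qed.

Lemma dxy_near f g : holomorphic_germ f -> (\forall z \near (0 : C * C), f z = g z) ->
  \forall z \near (0 : C * C), dx f z = dx g z /\ dy f z = dy g z.
Proof.
move=> /hol_linP [e e0 hf] /near0P [d d0 fg]; apply/near0P.
exists (Num.min e d); first by rewrite lt_min e0.
move=> z; rewrite !lt_min => /andP[a1 a2] /andP[b1 b2].
have [A [B h]] := hf z a1 b1.
have [-> ->] := lin_approx_derive h.
by have [-> ->] := lin_approx_derive (lin_approx_near d0 a2 b2 fg h).
Qed.

Definition swapf f : C * C -> C := fun z => f (z.2, z.1).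

Lemma lin_approx_swap f x y A B : lin_approx f (x, y) A B -> lin_approx (swapf f) (y, x) B A.
Proof.
move=> h e e0; have [d d0 hd] := h e e0; exists d => // w h1 h2.
have := hd (w.2, w.1) h2 h1; rewrite /swapf /= [A * _ + _]addrC [nc (w.2 - x) + _]addrC; exact.
Qed.

Lemma hol_swap f : holomorphic_germ f -> holomorphic_germ (swapf f).
Proof.
move=> /hol_linP [e e0 hf]; apply/hol_linP; exists e => // -[x y] /= h1 h2.
by have [A [B h]] := hf (y, x) h2 h1; exists B, A; apply: lin_approx_swap.
Qed.

Lemma dx_swap f : holomorphic_germ f -> \forall z \near (0 : C * C), swapf (dx (swapf f)) z = dy f z.
Proof.
move=> /hol_linP [e e0 hf]; apply/near0P; exists e; first exact: e0.
move=> [x y] h1 h2; have [A [B h]] := hf (x, y) h1 h2; have [_ ->] := lin_approx_derive h.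
by have [] := lin_approx_derive (lin_approx_swap h).
Qed.

Lemma hol_bounded f : holomorphic_germ f -> exists r M : R, [/\ 0 < r, 0 <= M,
  (forall z, nc z.1 <= 2 * r -> nc z.2 <= 2 * r -> exists A B, lin_approx f z A B) &
  (forall z, nc z.1 <= 2 * r -> nc z.2 <= 2 * r -> nc (f z) <= M)].
Proof.
move=> /hol_linP [e e0 hf].
have [|| A [B hAB]] := hf 0; rewrite ?nc0 //.
have [d d0 hd] := hAB 1 ltr01.
pose s := Num.min (Num.min e d) 1.
have s0 : 0 < s by rewrite !lt_min e0 d0 ltr01.
exists (s / 4), (nc (f 0) + (nc A + nc B + 2)); split.
- by rewrite divr_gt0.
- by rewrite !addr_ge0 ?nc_ge0.
- move=> z h1 h2; have [se s1] : s <= e /\ 0 < s by split => //; rewrite !ge_min lexx.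
  by apply: hf; lra.
- move=> z h1 h2; have [sd s1] : s <= d /\ s <= 1 by split; rewrite !ge_min lexx ?orbT.
  have [z1 z2] : nc z.1 < d /\ nc z.2 < d by split; lra.
  have := hd z; rewrite /= !subr0 mul1r => /(_ z1 z2) H.
  have := ncD (f z - f 0 - (A * z.1 + B * z.2)) (f 0 + (A * z.1 + B * z.2)).
  have -> : f z - f 0 - (A * z.1 + B * z.2) + (f 0 + (A * z.1 + B * z.2)) = f z by ring.
  have := ncD (f 0) (A * z.1 + B * z.2); have := ncD (A * z.1) (B * z.2); rewrite !ncM.
  have z1' : nc z.1 <= 1 by lra. have z2' : nc z.2 <= 1 by lra.
  have : nc A * nc z.1 <= nc A by rewrite ler_piMr ?nc_ge0.
  have : nc B * nc z.2 <= nc B by rewrite ler_piMr ?nc_ge0.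
  clear -H z1' z2'; lra.
Qed.

Section Local.
Variables (r M : R) (f : C * C -> C).
Hypothesis r0 : 0 < r.
Hypothesis M0 : 0 <= M.
Hypothesis hf : forall z : C * C, nc z.1 <= 2 * r -> nc z.2 <= 2 * r -> exists A B, lin_approx f z A B.
Hypothesis hM : forall z : C * C, nc z.1 <= 2 * r -> nc z.2 <= 2 * r -> nc (f z) <= M.

Let k0 (z x : C) := (kappa r)^-1 * (z - x)^-1.

Let K0 : is_kernel r k0 (fun (z x : C) => 0 * (z - x)^-1 + (kappa r)^-1 * (z - x) ^- 2).
Proof.
apply: (kernelM r0 _ (kernel_inv r0)).
by apply: (kernel_cst (nc_ge0 (kappa r)^-1)) => //; exact: contQ_cst.
Qed.

Let fdiff y : nc y <= r / 2 -> forall z : C, cvx r z -> exists l, cder (fun x => f (x, y)) z l.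
Proof.
move=> hy z hz; have [||A [B h]] := @hf (z, y); first exact: cvx_le.
  by rewrite /=; move: r0; lra.
by exists A; apply: lin_approx_cder1 h.
Qed.

Let cf y : nc y <= r / 2 -> contQ r (fun z : C => f (z, y)).
Proof. by move=> hy; apply: contQ_cder; exact: fdiff. Qed.

Lemma KI_cauchy p : nc p.1 < r / 2 -> nc p.2 < r / 2 -> KI r f k0 p = f p.
Proof.
case: p => x y /= /ltW hx /ltW hy; rewrite (cauchy_formula r0 hx (fdiff hy)) /KI /k0 /=.
rewrite -(J_Z r0); last by apply: contQ_mul; [exact: cf | exact: contQ_inv].
by apply: (J_ext r0) => z _; ring.
Qed.

Lemma dx_KI p : nc p.1 < r / 2 -> nc p.2 < r / 2 -> dx f p = KI r f (fun (z x : C) => k0 z x * (z - x)^-1) p.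
Proof.
move=> hx hy; have r2 : 0 < r / 2 by rewrite divr_gt0.
have h := kernel_lin_approx r0 M0 hf hM K0 hx hy.
have [-> _] := lin_approx_derive (lin_approx_near r2 hx hy KI_cauchy h).
by apply: (J_ext r0) => z _; rewrite mul0r add0r /k0 -mulrA invX2.
Qed.

Lemma KI_hol k k1 : is_kernel r k k1 -> holomorphic_germ (KI r f k).
Proof.
move=> hk; apply/hol_linP; exists (r / 2); first by rewrite divr_gt0.
move=> z h1 h2; do 2 eexists; exact: (kernel_lin_approx r0 M0 hf hM hk).
Qed.

(** f_x is the integral with kernel 1/(kappa (z-x)^2), again admissible, hence differentiable in
    both variables. *)
Lemma local_dx : holomorphic_germ (dx f).
Proof.
apply: hol_near (KI_hol (kernelM r0 K0 (kernel_inv r0))) _.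
apply/near0P; exists (r / 2); first by rewrite divr_gt0.
by move=> z h1 h2; rewrite dx_KI.
Qed.

(** Integrate the identity 1/(z-x) = 1/z + x/(z(z-x)) against f(z, y): the quotient a has kernel
    1/(kappa z (z-x)). *)
Lemma local_hadamard : exists2 a, holomorphic_germ a & \forall z \near (0 : C * C), f z = f (0, z.2) + z.1 * a z.
Proof.
have r2 : 0 < r / 2 by rewrite divr_gt0.
have h0 : nc 0 <= r / 2 :> R by rewrite nc0 ltW.
pose c (z : C) := (kappa r)^-1 * (z - 0)^-1.
have cc : contQ r c by apply: contQ_mul; [exact: contQ_cst | exact: contQ_inv].
have Kc : is_kernel r (fun (z x : C) => c z * (z - x)^-1) (fun (z x : C) => 0 * (z - x)^-1 + c z * (z - x) ^- 2).
  apply: (kernelM r0 _ (kernel_inv r0)).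
  apply: (@kernel_cst _ _ _ (nc (kappa r)^-1 * (2 / r))) => //.
    by rewrite mulr_ge0 ?nc_ge0 // divr_ge0 // ltW.
  by move=> z hz; rewrite ncM ler_wpM2l ?nc_ge0 //; have [] := inv_bound r0 hz h0.
exists (KI r f (fun (z x : C) => c z * (z - x)^-1)); first exact: KI_hol Kc.
apply/near0P; exists (r / 2) => // -[x y] /= h1 h2.
have hx := ltW h1; have hy := ltW h2.
have cx : contQ r (fun z : C => f (z, y) * (c z * (z - x)^-1)).
  by apply: contQ_mul; [exact: cf | apply: contQ_mul => //; exact: contQ_inv].
have ck (u : C) : nc u <= r / 2 -> contQ r (fun z : C => f (z, y) * k0 z u).
  by move=> hu; apply: contQ_mul; [exact: cf | apply: contQ_mul; [exact: contQ_cst | exact: contQ_inv]].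
rewrite -(@KI_cauchy (x, y)) // -(@KI_cauchy (0, y)) ?nc0 // /KI /=.
rewrite [RHS]addrC -(J_lin r0); [|exact: cx|exact: ck].
apply: (J_ext r0) => z hz; have [zx _] := inv_bound r0 hz hx; have [z0 _] := inv_bound r0 hz h0.
by rewrite /c /k0; field; rewrite kappa_neq0 // subr_eq0 zx z0.
Qed.

End Local.

Lemma hol_dx f : holomorphic_germ f -> holomorphic_germ (dx f).
Proof. by move=> /hol_bounded [r [M [r0 M0 h1 h2]]]; apply: local_dx r0 M0 h1 h2. Qed.

Lemma hol_dy f : holomorphic_germ f -> holomorphic_germ (dy f).
Proof.
move=> hf; apply: hol_near (dx_swap hf); apply: hol_swap; apply: hol_dx; exact: hol_swap.
Qed.

Lemma hadamard1 f : holomorphic_germ f ->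
  exists2 a, holomorphic_germ a & \forall z \near (0 : C * C), f z = f (0, z.2) + z.1 * a z.
Proof. by move=> /hol_bounded [r [M [r0 M0 h1 h2]]]; apply: local_hadamard r0 M0 h1 h2. Qed.

Lemma hol_snd f : holomorphic_germ f -> holomorphic_germ (fun z => f (0, z.2)).
Proof.
move=> /hol_linP [e e0 hf]; apply/hol_linP; exists e => // -[x y] /= h1 h2.
have [|A [B h]] := hf (0, y) _ h2; first by rewrite nc0.
exists 0, B => k k0; have [d d0 hd] := h k k0; exists d => // w w1 w2.
have h0 : nc ((0 : C) - 0) < d by rewrite subrr nc0.
have H : nc (f (0, w.2) - f (0, y) - (A * (0 - 0) + B * (w.2 - y))) <= k * (nc ((0 : C) - 0) + nc (w.2 - y)).
  exact: hd (0, w.2) h0 w2.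
move: H; rewrite subrr nc0 mulr0 !add0r mul0r add0r => H.
by apply: le_trans H _; rewrite ler_pM2l // lerDr nc_ge0.
Qed.

Lemma hadamard f : holomorphic_germ f -> exists a b, [/\ holomorphic_germ a, holomorphic_germ b &
  \forall z \near (0 : C * C), f z = f 0 + z.1 * a z + z.2 * b z].
Proof.
move=> hf; have [a ha /near0P [e e0 Ha]] := hadamard1 hf.
have [b hb /near0P [d d0 Hb]] := hadamard1 (hol_swap hf).
exists a, (fun z => swapf b (0, z.2)); split => //; first by apply: hol_snd; exact: hol_swap.
apply/near0P; exists (Num.min e d) => [|[x y]]; rewrite ?lt_min ?e0 //= => /andP[x1 x2] /andP[y1 y2].
rewrite Ha //= -addrA [x * _ + _]addrC addrA; congr (_ + _).
rewrite -[LHS]/(swapf f (y, 0)) Hb //=.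
by rewrite -[X in X < _]/(nc (0 : C)) nc0.
Qed.

End Germs.

(** * Taylor series and the comparison of Milnor numbers *)

Section GermRing.
Variable R : realType.
Local Notation C := R[i].
Local Notation O := (C * C -> C).
Local Notation hol := (@holomorphic_germ R).
Implicit Types (f g h : O) (z : C * C).

Lemma near0W (P : C * C -> Prop) : (forall z, P z) -> \forall z \near (0 : C * C), P z.
Proof. by move=> h; apply/near0P; exists 1. Qed.
Lemma near0I (P Q : C * C -> Prop) : (\forall z \near (0 : C * C), P z) ->
  (\forall z \near (0 : C * C), Q z) -> \forall z \near (0 : C * C), P z /\ Q z.
Proof.
move=> /near0P [d d0 hd] /near0P [e e0 he]; apply/near0P.
exists (Num.min d e); first by rewrite lt_min d0.
by move=> z; rewrite !lt_min => /andP[a1 a2] /andP[b1 b2]; split; [exact: hd | exact: he].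
Qed.
Lemma near0S (P Q : C * C -> Prop) : (forall z, P z -> Q z) ->
  (\forall z \near (0 : C * C), P z) -> \forall z \near (0 : C * C), Q z.
Proof. by move=> h /near0P [d d0 hd]; apply/near0P; exists d => // z h1 h2; apply: h; apply: hd. Qed.
Lemma near0S2 (P Q S : C * C -> Prop) : (forall z, P z -> Q z -> S z) ->
  (\forall z \near (0 : C * C), P z) -> (\forall z \near (0 : C * C), Q z) ->
  \forall z \near (0 : C * C), S z.
Proof. by move=> h hP hQ; apply: near0S (near0I hP hQ) => z [p q]; apply: h. Qed.

Definition geq f g := \forall z \near (0 : C * C), f z = g z.

Lemma geq_refl f : geq f f. Proof. by apply: near0W => z. Qed.
Lemma geq_sym f g : geq f g -> geq g f. Proof. by move=> h; apply: near0S h => z ->. Qed.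
Lemma geq_trans g f h : geq f g -> geq g h -> geq f h.
Proof. by move=> h1 h2; apply: near0S2 h1 h2 => z -> ->. Qed.
Lemma geqD f f' g g' : geq f f' -> geq g g' -> geq (f + g) (f' + g').
Proof. by move=> h1 h2; apply: near0S2 h1 h2 => z; rewrite !fctE => -> ->. Qed.
Lemma geqM f f' g g' : geq f f' -> geq g g' -> geq (f * g) (f' * g').
Proof. by move=> h1 h2; apply: near0S2 h1 h2 => z; rewrite !fctE => -> ->. Qed.
Lemma geqB f f' g g' : geq f f' -> geq g g' -> geq (f - g) (f' - g').
Proof. by move=> h1 h2; apply: near0S2 h1 h2 => z; rewrite !fctE => -> ->. Qed.
Lemma geq_at0 f g : geq f g -> f 0 = g 0.
Proof. by move=> /near0P [e e0 h]; have n0 : nc (0 : C) < e by [rewrite nc0]; exact: (h 0 n0 n0). Qed.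

Definition cx : O := fun z => z.1.
Definition cy : O := fun z => z.2.

Lemma lin_approx_cx z : lin_approx cx z 1 0.
Proof.
move=> e e0; exists 1 => // w _ _; rewrite /cx mul1r mul0r addr0 subrr nc0.
by rewrite mulr_ge0 ?addr_ge0 ?nc_ge0 // ltW.
Qed.

Lemma lin_approx_cy z : lin_approx cy z 0 1.
Proof.
move=> e e0; exists 1 => // w _ _; rewrite /cy mul1r mul0r add0r subrr nc0.
by rewrite mulr_ge0 ?addr_ge0 ?nc_ge0 // ltW.
Qed.

Lemma lin_approx_cst (c : C) z : lin_approx (fun=> c) z 0 0.
Proof.
move=> e e0; exists 1 => // w _ _; rewrite !mul0r addr0 !subrr nc0.
by rewrite mulr_ge0 ?addr_ge0 ?nc_ge0 // ltW.
Qed.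

Lemma hol_geq f g : geq f g -> hol f -> hol g.
Proof. by move=> h hf; apply: hol_near hf h. Qed.
Lemma hol_cx : hol cx.
Proof. by apply: near0W => z; apply: lin_approx_differentiable (lin_approx_cx z). Qed.
Lemma hol_cy : hol cy.
Proof. by apply: near0W => z; apply: lin_approx_differentiable (lin_approx_cy z). Qed.
Lemma hol_cst (c : C) : hol (fun=> c).
Proof. by apply: near0W => z; apply: lin_approx_differentiable (lin_approx_cst c z). Qed.
Lemma hol0 : hol 0. Proof. exact: hol_cst. Qed.
Lemma hol1 : hol 1. Proof. exact: hol_cst. Qed.
Lemma holD f g : hol f -> hol g -> hol (f + g).
Proof. by move=> h1 h2; apply: near0S2 h1 h2 => z; apply: differentiableD. Qed.
Lemma holN f : hol f -> hol (- f).
Proof. by move=> h; apply: near0S h => z; apply: differentiableN. Qed.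
Lemma holB f g : hol f -> hol g -> hol (f - g).
Proof. by move=> hf hg; apply: holD => //; apply: holN. Qed.
Lemma holM f g : hol f -> hol g -> hol (f * g).
Proof. by move=> h1 h2; apply: near0S2 h1 h2 => z; apply: differentiableM. Qed.
Lemma hol_near_neq0 f : hol f -> f 0 != 0 -> \forall z \near (0 : C * C), f z != 0.
Proof.
move=> /hol_linP [e e0 hf] f0.
have e00 : nc (0 : C) < e by rewrite nc0.
have [A [B h]] := hf 0 e00 e00.
have n0 : 0 < nc (f 0) by rewrite nc_gt0.
have [d d0 hd] := h 1 ltr01.
pose K := nc A + nc B + 2.
have K0 : 0 < K by rewrite ltr_wpDl // addr_ge0 ?nc_ge0.
apply/near0P; exists (Num.min d (nc (f 0) / K)); first by rewrite lt_min d0 divr_gt0.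
move=> z; rewrite !lt_min !ltr_pdivlMr // => /andP[a1 a2] /andP[b1 b2].
apply/eqP => fz; have := hd z; rewrite /= !subr0 fz => /(_ a1 b1); rewrite mul1r sub0r => H.
have E : f 0 = - (- f 0 - (A * z.1 + B * z.2)) - (A * z.1 + B * z.2) by ring.
have := ncB (- (- f 0 - (A * z.1 + B * z.2))) (A * z.1 + B * z.2); rewrite -E ncN.
have := ncD (A * z.1) (B * z.2); rewrite !ncM => H1 H2.
have hA : 0 <= nc A by exact: nc_ge0.
have hB : 0 <= nc B by exact: nc_ge0.
have h1 : nc z.1 * (nc A + 1) + nc z.2 * (nc B + 1) < nc (f 0).
  rewrite -(ltr_pM2r K0) mulrDl.
  have k1 : nc z.1 * (nc A + 1) * K <= nc (f 0) * (nc A + 1).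
    by rewrite mulrAC ler_wpM2r ?addr_ge0 // ltW.
  have k2 : nc z.2 * (nc B + 1) * K < nc (f 0) * (nc B + 1).
    by rewrite mulrAC ltr_pM2r // ltr_wpDl.
  have -> : nc (f 0) * K = nc (f 0) * (nc A + 1) + nc (f 0) * (nc B + 1) by rewrite /K; ring.
  lra.
lra.
Qed.

Lemma hol_inv f : hol f -> f 0 != 0 -> hol (fun z => (f z)^-1) /\ geq (fun z => (f z)^-1 * f z) 1.
Proof.
move=> hf f0; have hn := hol_near_neq0 hf f0; split.
  by apply: near0S2 hf hn => z; apply: differentiableV.
by apply: near0S hn => z fz; rewrite mulVf.
Qed.

Lemma differentiable_der f z v : differentiable f z -> derivable f z v.
Proof. exact: diff_derivable. Qed.

Lemma dxyD f g : hol f -> hol g -> geq (dx (f + g)) (dx f + dx g) /\ geq (dy (f + g)) (dy f + dy g).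
Proof.
move=> hf hg; split; apply: near0S2 hf hg => z df dg.
  by rewrite /dx deriveD //; apply: differentiable_der.
by rewrite /dy deriveD //; apply: differentiable_der.
Qed.

Lemma dxyM f g : hol f -> hol g ->
  geq (dx (f * g)) (f * dx g + g * dx f) /\ geq (dy (f * g)) (f * dy g + g * dy f).
Proof.
move=> hf hg; split; apply: near0S2 hf hg => z df dg.
  by rewrite /dx deriveM //; apply: differentiable_der.
by rewrite /dy deriveM //; apply: differentiable_der.
Qed.

Lemma dxy_cx z : dx cx z = 1 /\ dy cx z = 0.
Proof. exact: lin_approx_derive (lin_approx_cx z). Qed.
Lemma dxy_cy z : dx cy z = 0 /\ dy cy z = 1.
Proof. exact: lin_approx_derive (lin_approx_cy z). Qed.

End GermRing.

(** * Powers of the maximal ideal *)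

Section Jets.
Variable R : realType.
Local Notation C := R[i].
Local Notation O := (C * C -> C).
Local Notation hol := (@holomorphic_germ R).
Local Notation cx := (@cx R).
Local Notation cy := (@cy R).
Local Opaque dx dy.
Implicit Types (f g h : O) (z : C * C).

(* The N-th power of the maximal ideal of the ring of germs. *)
Fixpoint mN N h : Prop := if N is N'.+1 then
  exists a b, [/\ mN N' a, mN N' b & geq h (cx * a + cy * b)] else hol h.

Lemma mN_hol N h : mN N h -> hol h.
Proof.
elim: N h => // N ih h [a [b [/ih ha /ih hb /geq_sym e]]].
by apply: hol_geq e _; apply: holD; apply: holM => //; [exact: hol_cx | exact: hol_cy].
Qed.

Lemma mN_geq N f g : geq f g -> mN N f -> mN N g.
Proof.
case: N => [|N] e; first exact: hol_geq.
by move=> [a [b [ha hb h]]]; exists a, b; split => //; apply: geq_trans (geq_sym e) h.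
Qed.

Lemma mN0 N : mN N 0.
Proof.
elim: N => [|N ih]; first exact: hol0.
by exists 0, 0; split => //; rewrite !mulr0 addr0; apply: geq_refl.
Qed.

Lemma mND N f g : mN N f -> mN N g -> mN N (f + g).
Proof.
elim: N f g => [|N ih] f g; first exact: holD.
move=> [a [b [ha hb e]]] [a' [b' [ha' hb' e']]]; exists (a + a'), (b + b'); split; [exact: ih | exact: ih |].
by apply: geq_trans (geqD e e') _; apply: near0W => z; rewrite !fctE; ring.
Qed.

Lemma mNMl N f g : hol f -> mN N g -> mN N (f * g).
Proof.
move=> hf; elim: N g => [|N ih] g; first exact: holM.
move=> [a [b [ha hb e]]]; exists (f * a), (f * b); split; [exact: ih | exact: ih |].
by apply: geq_trans (geqM (geq_refl f) e) _; apply: near0W => z; rewrite !fctE; ring.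
Qed.

Lemma mNN N f : mN N f -> mN N (- f).
Proof. by move=> h; rewrite -mulN1r; apply: mNMl => //; apply: holN; apply: hol1. Qed.

Lemma mNB N f g : mN N f -> mN N g -> mN N (f - g).
Proof. by move=> hf hg; apply: mND => //; apply: mNN. Qed.

Lemma mN_cx N f : mN N f -> mN N.+1 (cx * f).
Proof. by move=> h; exists f, 0; split => //; [exact: mN0 | rewrite mulr0 addr0; apply: geq_refl]. Qed.
Lemma mN_cy N f : mN N f -> mN N.+1 (cy * f).
Proof. by move=> h; exists 0, f; split => //; [exact: mN0 | rewrite mulr0 add0r; apply: geq_refl]. Qed.

Lemma mNS N f : mN N.+1 f -> mN N f.
Proof.
elim: N f => [|N ih] f; first exact: mN_hol.
by move=> [a [b [ha hb e]]]; exists a, b; split => //; apply: ih.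
Qed.

Lemma mNW M N f : (M <= N)%N -> mN N f -> mN M f.
Proof. by move=> /subnK <-; elim: (N - M)%N => // k ih; rewrite addSn => /mNS. Qed.

Lemma mN1_at0 f : mN 1 f -> f 0 = 0.
Proof. by move=> [a [b [_ _ /geq_at0 ->]]]; rewrite !fctE /cx /cy /= !mul0r addr0. Qed.

Lemma at0_mN1 f : hol f -> f 0 = 0 -> mN 1 f.
Proof.
move=> hf f0; have [a [b [ha hb e]]] := hadamard hf; exists a, b; split => //.
by apply: near0S e => z ->; rewrite f0 add0r.
Qed.

Lemma mN_dxy N f : mN N.+1 f -> mN N (dx f) /\ mN N (dy f).
Proof.
elim: N f => [|N ih] f; first by move=> /mN_hol hf; split; [exact: hol_dx | exact: hol_dy].
move=> [a [b [ha hb e]]].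
have {}ha : mN N.+1 a by []. have {}hb : mN N.+1 b by [].
have hh := mN_hol ha; have hh' := mN_hol hb.
have hX := holM (hol_cx R) hh; have hY := holM (hol_cy R) hh'.
have hf := hol_geq (geq_sym e) (holD hX hY).
have e1 := dxy_near hf e.
have [d1 d2] := dxyD hX hY; have [p1 p2] := dxyM (hol_cx R) hh; have [q1 q2] := dxyM (hol_cy R) hh'.
have [a1 a2] := ih a ha; have [b1 b2] := ih b hb.
split.
  apply: (@mN_geq _ (cx * dx a + a + cy * dx b)).
    apply: geq_sym; apply: near0S2 (near0I e1 d1) (near0I p1 q1) => z [[h0 _] h] [h1 h2].
    have [c1 _] := dxy_cx z; have [c2 _] := dxy_cy z.
    rewrite h0 h -[LHS]/(dx (cx * a) z + dx (cy * b) z) h1 h2.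
    rewrite -[LHS]/((z.1 * dx a z + a z * dx cx z) + (z.2 * dx b z + b z * dx cy z)).
    rewrite -[RHS]/(z.1 * dx a z + a z + z.2 * dx b z); move: c1 c2.
    by move: (dx a z) (dx b z) (dx cx z) (dx cy z) => u v u' v' -> ->; rewrite mulr1 mulr0 addr0.
  by apply: mND; [apply: mND => //; apply: mN_cx | apply: mN_cy].
apply: (@mN_geq _ (cx * dy a + (cy * dy b + b))).
  apply: geq_sym; apply: near0S2 (near0I e1 d2) (near0I p2 q2) => z [[_ h0] h] [h1 h2].
  have [_ c1] := dxy_cx z; have [_ c2] := dxy_cy z.
  rewrite h0 h -[LHS]/(dy (cx * a) z + dy (cy * b) z) h1 h2.
  rewrite -[LHS]/((z.1 * dy a z + a z * dy cx z) + (z.2 * dy b z + b z * dy cy z)).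
  rewrite -[RHS]/(z.1 * dy a z + (z.2 * dy b z + b z)); move: c1 c2.
  by move: (dy a z) (dy b z) (dy cx z) (dy cy z) => u v u' v' -> ->; rewrite mulr1 mulr0 addr0.
by apply: mND; [apply: mN_cx | apply: mND => //; apply: mN_cy].
Qed.

(** Only d = 0 and d = 1 are used: the former gives generators of the k-th power, the latter the
    coefficients that Nakayama's lemma requires. *)
Lemma mN_decomp k d h : mN (k + d) h -> exists2 r : nat -> O, (forall i, mN d (r i)) &
  geq h (\sum_(i < k.+1) r i * (cx ^+ i * cy ^+ (k - i))).
Proof.
elim: k h => [|k ih] h.
  move=> hh; exists (fun=> h) => //; rewrite big_ord1 !expr0 !mulr1; exact: geq_refl.
move=> [a [b [/ih [r hr er] /ih [s hs es] e]]].
pose r' (i : nat) : O := if i is i'.+1 then r i' else 0.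
pose s' (i : nat) : O := if (i <= k)%N then s i else 0.
exists (fun i => r' i + s' i).
  move=> i; apply: mND; first by case: i => // ; exact: mN0.
  by rewrite /s'; case: ifP => // _; exact: mN0.
apply: geq_trans e _; apply: geq_trans (geqD (geqM (geq_refl _) er) (geqM (geq_refl _) es)) _.
have -> : cx * (\sum_(i < k.+1) r i * (cx ^+ i * cy ^+ (k - i))) +
   cy * (\sum_(i < k.+1) s i * (cx ^+ i * cy ^+ (k - i))) =
   \sum_(i < k.+2) (r' i + s' i) * (cx ^+ i * cy ^+ (k.+1 - i)); last exact: geq_refl.
under [RHS]eq_bigr do rewrite mulrDl.
rewrite big_split /=; congr (_ + _).
  rewrite [RHS]big_ord_recl /= -[X in X * _ + _]/(0 : O) mul0r add0r mulr_sumr; apply: eq_bigr => i _ /=.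
  by rewrite subSS exprS; ring.
have s0 : s' k.+1 = 0 by rewrite /s' ltnn.
rewrite [RHS]big_ord_recr /= s0 mul0r addr0 mulr_sumr; apply: eq_bigr => i _ /=.
have ik : (i <= k)%N by rewrite -ltnS.
by rewrite /s' ik subSn // exprS; ring.
Qed.

End Jets.

(** * Polynomials as germs, and Taylor series *)

Section Polynomials.
Variable R : realType.
Local Notation C := R[i].
Local Notation O := (C * C -> C).
Local Notation hol := (@holomorphic_germ R).
Local Notation pf := (@poly_fun R).
Implicit Types (p q : {poly {poly C}}) (z : C * C) (f g : O).

Lemma lin_approxD f g z A B A' B' : lin_approx f z A B -> lin_approx g z A' B' ->
  lin_approx (f + g) z (A + A') (B + B').
Proof.
move=> hf hg; have df := lin_approx_differentiable hf; have dg := lin_approx_differentiable hg.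
have [<- <-] := lin_approx_derive hf; have [<- <-] := lin_approx_derive hg.
have := differentiable_lin_approx (differentiableD df dg).
by rewrite {1}/dx {1}/dy !deriveD //; exact: differentiable_der.
Qed.

Lemma lin_approxM f g z A B A' B' : lin_approx f z A B -> lin_approx g z A' B' ->
  lin_approx (f * g) z (f z * A' + g z * A) (f z * B' + g z * B).
Proof.
move=> hf hg; have df := lin_approx_differentiable hf; have dg := lin_approx_differentiable hg.
have [<- <-] := lin_approx_derive hf; have [<- <-] := lin_approx_derive hg.
have := differentiable_lin_approx (differentiableM df dg).
by rewrite {1}/dx {1}/dy !deriveM //; exact: differentiable_der.
Qed.

Lemma pfD p q : pf (p + q) = pf p + pf q.
Proof. by apply/funext => z; rewrite /poly_fun !hornerD. Qed.
Lemma pfM p q : pf (p * q) = pf p * pf q.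
Proof. by apply/funext => z; rewrite /poly_fun !hornerM. Qed.
Lemma pf0 : pf 0 = 0. Proof. by apply/funext => z; rewrite /poly_fun !horner0. Qed.
Lemma pfC (c : C) : pf c%:P%:P = (fun=> c).
Proof. by apply/funext => z; rewrite /poly_fun !hornerC. Qed.
Lemma pfN p : pf (- p) = - pf p.
Proof. by apply/funext => z; rewrite /poly_fun !hornerN. Qed.
Lemma pfX : pf 'X%:P = @cx R.
Proof. by apply/funext => z; rewrite /poly_fun hornerC hornerX. Qed.
Lemma pfY : pf 'X = @cy R.
Proof. by apply/funext => z; rewrite /poly_fun hornerX hornerC. Qed.

Definition px p := map_poly (fun c : {poly C} => c^`()) p.

Lemma coef_px p i j : (px p)`_j`_i = i.+1%:R * p`_j`_i.+1.
Proof. by rewrite coef_map_id0 ?deriv0 // coef_deriv mulr_natl. Qed.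

Lemma coef_py p i j : (p^`())`_j`_i = j.+1%:R * p`_j.+1`_i.
Proof. by rewrite coef_deriv coefMn mulr_natl. Qed.

Lemma lin_approx_horner (c : {poly C}) z : lin_approx (pf c%:P) z (pf c^`()%:P z) 0.
Proof.
elim/poly_ind: c => [|c a ih]; first by rewrite deriv0 pf0; exact: lin_approx_cst.
have h := lin_approxD (lin_approxM ih (lin_approx_cx z)) (lin_approx_cst a z).
rewrite !polyCD polyCM pfD pfM pfX pfC !addr0 !mulr0 !addr0 in h *.
rewrite derivD derivC derivM derivX addr0 mulr1 polyCD polyCM pfD pfM pfX.
rewrite mulr1 in h; congr lin_approx: h.
by rewrite addrC [_ * pf _ _]mulrC.
Qed.

Lemma lin_approx_pf p z : lin_approx (pf p) z (pf (px p) z) (pf p^`() z).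
Proof.
elim/poly_ind: p => [|p c ih].
  by rewrite deriv0 /px map_poly0 pf0; exact: lin_approx_cst.
have h := lin_approxD (lin_approxM ih (lin_approx_cy z)) (lin_approx_horner c z).
have -> : px (p * 'X + c%:P) = px p * 'X + c^`()%:P.
  apply/polyP => j; rewrite coef_map_id0 ?deriv0 // !coefD !coefMX !coefC derivD.
  by case: j => [|j] /=; rewrite ?deriv0 // coef_map_id0 // deriv0.
rewrite derivD derivC derivM derivX addr0 mulr1.
rewrite !pfD !pfM pfY; rewrite mulr0 add0r addr0 mulr1 in h; congr lin_approx: h.
  by rewrite mulrC.
by rewrite addrC mulrC.
Qed.

Lemma hol_pf p : hol (pf p).
Proof. by apply: near0W => z; apply: lin_approx_differentiable (lin_approx_pf p z). Qed.

Lemma dxy_pf p z : dx (pf p) z = pf (px p) z /\ dy (pf p) z = pf p^`() z.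
Proof. exact: lin_approx_derive (lin_approx_pf p z). Qed.

Lemma pf_at0 p : pf p 0 = p`_0`_0.
Proof. by rewrite /poly_fun /= horner_coef0 polyC0 horner_coef0. Qed.

Local Opaque dx dy.

(** Differentiation lowers the power of the maximal ideal by one, and up to a nonzero integer a
    coefficient of positive degree is a coefficient of a derivative. *)
Lemma coef_mN N p : mN N (pf p) -> forall i j, (i + j < N)%N -> p`_j`_i = 0.
Proof.
elim: N p => [|N ih] p hp i j //; rewrite ltnS => hij.
have [h1 h2] := mN_dxy hp.
have hx : mN N (pf (px p)) by apply: mN_geq h1; apply: near0W => z; have [->] := dxy_pf p z.
have hy : mN N (pf p^`()) by apply: mN_geq h2; apply: near0W => z; have [_ ->] := dxy_pf p z.
case: i hij => [|i] hij; last first.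
  have /eqP := ih _ hx i j hij; rewrite coef_px mulf_eq0 pnatr_eq0 /= => /eqP; exact.
case: j hij => [|j] hij; last first.
  have /eqP := ih _ hy 0%N j hij; rewrite coef_py mulf_eq0 pnatr_eq0 /= => /eqP; exact.
by rewrite -pf_at0; apply: mN1_at0; apply: mNW hp.
Qed.

Lemma pf_mN N p : (forall i j, (i + j < N)%N -> p`_j`_i = 0) -> mN N (pf p).
Proof.
elim: N p => [|N ih] p hp; first exact: hol_pf.
pose c := p`_0.
pose p2 := \poly_(j < size p) p`_j.+1.
pose c1 := \poly_(i < size c) c`_i.+1.
have hc : c = c1 * 'X.
  apply/polyP => i; rewrite coefMX; case: i => [|i] /=; first by apply: hp.
  by rewrite coef_poly; case: ltnP => // h; rewrite nth_default // (leq_trans h).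
have hp2 : p = c1%:P * 'X%:P + p2 * 'X.
  rewrite -polyCM -hc; apply/polyP => j; rewrite coefD coefMX coefC; case: j => [|j] /=; first by rewrite addr0.
  by rewrite add0r coef_poly; case: ltnP => // h; rewrite nth_default // (leq_trans h).
rewrite hp2 pfD !pfM pfX pfY ![pf _ * _]mulrC; apply: mND.
  apply: mN_cx; apply: ih => i j hij; rewrite coefC; case: j hij => [|j] hij /=; last by rewrite coef0.
  by rewrite coef_poly; case: ifP => // _; apply: hp; rewrite addSn.
apply: mN_cy; apply: ih => i j hij; rewrite coef_poly; case: ifP => [_|]; last by rewrite coef0.
by apply: hp; rewrite addnS.
Qed.

(* F is the Taylor series of f at the origin. *)
Definition tay f (F : ser C) := hol f /\ forall N, exists2 p : {poly {poly C}}, (forall i j, (i + j < N)%N -> p`_j`_i = F i j) &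
  mN N (f - pf p).

Lemma tay_hol f F : tay f F -> hol f. Proof. by case. Qed.

Lemma tay_pf p : tay (pf p) (fun i j => p`_j`_i).
Proof. by split; [exact: hol_pf | move=> N; exists p => //; rewrite subrr; exact: mN0]. Qed.

Lemma tayD f g F G : tay f F -> tay g G -> tay (f + g) (F + G).
Proof.
move=> [hf tf] [hg tg]; split; first exact: holD.
move=> N; have [p hp hfp] := tf N; have [q hq hgq] := tg N; exists (p + q).
  by move=> i j hij; rewrite !coefD hp // hq.
by rewrite pfD opprD addrACA; apply: mND.
Qed.

Lemma tayM f g F G : tay f F -> tay g G -> tay (f * g) (F * G).
Proof.
move=> [hf tf] [hg tg]; split; first exact: holM.
move=> N; have [p hp hfp] := tf N; have [q hq hgq] := tg N; exists (p * q).
  move=> i j hij; rewrite coef2M serM; apply: eq_bigr => b _; apply: eq_bigr => a _.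
  by rewrite hp ?hq //; move: (ltn_ord a) (ltn_ord b); lia.
have -> : f * g - pf (p * q) = g * (f - pf p) + pf p * (g - pf q) by rewrite pfM; ring.
by apply: mND; apply: mNMl => //; exact: hol_pf.
Qed.

Lemma tay_cst (c : C) : tay (fun=> c) (c *: 1).
Proof.
rewrite -pfC; have -> : c *: 1 = (fun i j => (c%:P%:P : {poly {poly C}})`_j`_i) :> ser C; last exact: tay_pf.
apply: serP => i j; rewrite serZ ser1 !coefC; case: j => [|j] /=; last by rewrite coef0 andbF mulr0.
by rewrite coefC andbT; case: i => [|i] /=; rewrite ?mulr1 ?mulr0.
Qed.

Lemma tayZ c f F : tay f F -> tay (c *: f) (c *: F).
Proof. by move=> h; have := tayM (tay_cst c) h; rewrite -scalerAl mul1r. Qed.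

Lemma tayB f g F G : tay f F -> tay g G -> tay (f - g) (F - G).
Proof. by move=> hf hg; rewrite -scaleN1r -[- G]scaleN1r; apply: tayD => //; apply: tayZ. Qed.

Lemma tay_dx f F : tay f F -> tay (dx f) (dX F).
Proof.
move=> [hf tf]; split; first exact: hol_dx.
move=> N; have [p hp hfp] := tf N.+1; exists (px p).
  by move=> i j hij; rewrite coef_px hp.
have [h _] := mN_dxy hfp; apply: mN_geq h.
have [e _] := dxyD hf (holN (hol_pf p)).
have e1 : geq (dx (- pf p)) (- pf (px p)).
  by rewrite -pfN; apply: near0W => z; have [-> _] := dxy_pf (- p) z; rewrite -pfN /px raddfN.
exact: geq_trans e (geqD (geq_refl _) e1).
Qed.

Lemma tay_dy f F : tay f F -> tay (dy f) (dY F).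
Proof.
move=> [hf tf]; split; first exact: hol_dy.
move=> N; have [p hp hfp] := tf N.+1; exists p^`().
  by move=> i j hij; rewrite coef_py hp // addnS.
have [_ h] := mN_dxy hfp; apply: mN_geq h.
have [_ e] := dxyD hf (holN (hol_pf p)).
have e1 : geq (dy (- pf p)) (- pf p^`()).
  by rewrite -pfN; apply: near0W => z; have [_ ->] := dxy_pf (- p) z; rewrite -pfN derivN.
exact: geq_trans e (geqD (geq_refl _) e1).
Qed.

Lemma tay_word N f F : tay f F -> mN N f <-> word 1 1 N F.
Proof.
move=> [hf tf]; have [p hp hfp] := tf N; split=> [h i j|h].
  rewrite !muln1 => hij; rewrite -hp //; apply: (@coef_mN N) => //.
  by rewrite -[pf p](subKr f); apply: mNB.
rewrite -(subrK (pf p) f); apply: mND => //; apply: pf_mN => i j hij.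
by rewrite hp // h // !muln1.
Qed.

Lemma tay_uniq f F G : tay f F -> tay f G -> F = G.
Proof.
move=> hF hG; apply: serP => i j; apply/eqP; rewrite -subr_eq0; apply/eqP.
have /(tay_word (i + j).+1) [h _] := tayB hF hG.
by have := h _ i j; rewrite subrr; apply; [exact: mN0 | rewrite !muln1].
Qed.

(** Iterating Hadamard's lemma yields a polynomial jet of each order. Two jets differ by a
    polynomial in the smaller power of the maximal ideal, so the coefficients stabilize. *)
Lemma tay_exists f : hol f -> exists F, tay f F.
Proof.
move=> hf.
have jet N : exists p : {poly {poly C}}, mN N (f - pf p).
  elim: N f hf => [|N ih] f hf; first by exists 0; rewrite pf0 subr0.
  have [a [b [ha hb e]]] := hadamard hf; have [p hp] := ih a ha; have [q hq] := ih b hb.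
  exists ((f 0)%:P%:P + 'X%:P * p + 'X * q).
  rewrite !pfD !pfM pfX pfY pfC.
  apply: (@mN_geq _ _ (@cx R * (a - pf p) + @cy R * (b - pf q))); last by apply: mND; [exact: mN_cx | exact: mN_cy].
  apply: geq_sym; apply: near0S e => z ez.
  rewrite -[LHS]/(f z - (f 0 + z.1 * pf p z + z.2 * pf q z)) ez.
  by rewrite -[RHS]/(z.1 * (a z - pf p z) + z.2 * (b z - pf q z)); ring.
have /choice [P hP] := jet.
exists (fun i j => (P (i + j).+1)`_j`_i); split => // N; exists (P N) => // i j hij.
apply/eqP; rewrite -subr_eq0; apply/eqP.
have h : mN (i + j).+1 (pf (P N - P (i + j).+1)).
  rewrite pfD pfN.
  have -> : pf (P N) - pf (P (i + j).+1) = (f - pf (P (i + j).+1)) - (f - pf (P N)) by ring.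
  by apply: mNB => //; apply: mNW (hP N).
by have := coef_mN h (ltnSn _); rewrite !coefB.
Qed.

End Polynomials.

(** * Formal and holomorphic ideals *)

Section Transfer.
Variable R : realType.
Local Notation C := R[i].
Local Notation O := (C * C -> C).
Local Notation hol := (@holomorphic_germ R).
Local Notation pf := (@poly_fun R).
Local Notation cx := (@cx R).
Local Notation cy := (@cy R).
Local Opaque dx dy.
Implicit Types (p q : {poly {poly C}}) (z : C * C) (f g h a b : O) (F G H : ser C).

Lemma tay_geq f g F : geq f g -> tay f F -> tay g F.
Proof.
move=> e [hf tf]; split; first exact: hol_geq hf.
move=> N; have [p hp h] := tf N; exists p => //; apply: mN_geq h.
exact: geqB e (geq_refl _).
Qed.

Lemma tay0 : tay (0 : O) 0.
Proof. by have := tay_cst (0 : C); rewrite scale0r. Qed.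

Lemma tay_sum n (e : 'I_n -> O) (E : 'I_n -> ser C) (c : 'I_n -> C) : (forall i, tay (e i) (E i)) ->
  tay (\sum_(i < n) c i *: e i) (\sum_(i < n) c i *: E i).
Proof.
move=> h; elim/big_ind2: _ => [|f F g G|i _]; [exact: tay0 | exact: tayD | exact: tayZ].
Qed.

Definition trc N F : ser C := fun i j => (ser_poly N F)`_j`_i.

Lemma word_trc N F : word 1 1 N (F - trc N F).
Proof.
move=> i j; rewrite !muln1 => hij; rewrite serB /trc coef_ser_poly ifT ?subrr //.
by apply/andP; split; lia.
Qed.

Lemma tay_trc N F : tay (pf (ser_poly N F)) (trc N F). Proof. exact: tay_pf. Qed.

Definition wm k i : O := cx ^+ i * cy ^+ (k - i).

Lemma tay_wm k i : tay (wm k i) (mono C i (k - i)).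
Proof.
have -> : wm k i = pf ('X^i%:P * 'X^(k - i)).
  rewrite pfM /wm -pfX -pfY; congr (_ * _).
    by elim: i => [|i ih]; rewrite ?expr0 ?pfC // exprS ih exprS polyCM pfM.
  by elim: (k - i)%N => [|j ih]; rewrite ?expr0 -?polyC1 ?pfC // exprS ih exprS pfM.
suff -> : mono C i (k - i) = (fun a b : nat => ('X^i%:P * 'X^(k - i) : {poly {poly C}})`_b`_a) by exact: tay_pf.
apply: serP => l m; rewrite monoE mul_polyC coefZ coefXn.
by case: (m == _); rewrite ?mulr1 ?mulr0 ?coef0 ?andbF // coefXn andbT.
Qed.

Variables (A B : O) (FA FB : ser C).
Hypotheses (tA : tay A FA) (tB : tay B FB).

Definition Ian h := exists a b, [/\ hol a, hol b & geq h (a * A + b * B)].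

Lemma Ian_geq f g : geq f g -> Ian f -> Ian g.
Proof. by move=> e [a [b [ha hb h]]]; exists a, b; split => //; apply: geq_trans (geq_sym e) h. Qed.

Lemma Ian0 : Ian 0.
Proof. by exists 0, 0; split; [exact: hol0 | exact: hol0 | rewrite !mul0r addr0; exact: geq_refl]. Qed.

Lemma IanD f g : Ian f -> Ian g -> Ian (f + g).
Proof.
move=> [a [b [ha hb e]]] [a' [b' [ha' hb' e']]]; exists (a + a'), (b + b'); split; [exact: holD | exact: holD |].
have -> : (a + a') * A + (b + b') * B = (a * A + b * B) + (a' * A + b' * B) by ring.
exact: geqD.
Qed.

Lemma IanM f g : hol f -> Ian g -> Ian (f * g).
Proof.
move=> hf [a [b [ha hb e]]]; exists (f * a), (f * b); split; [exact: holM | exact: holM |].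
have -> : f * a * A + f * b * B = f * (a * A + b * B) by ring.
exact: geqM (geq_refl _) e.
Qed.

Lemma IanZ (c : C) f : Ian f -> Ian (c *: f).
Proof. by move=> hf; have := IanM (hol_cst c) hf. Qed.

Lemma IanB f g : Ian f -> Ian g -> Ian (f - g).
Proof. by move=> hf hg; rewrite -scaleN1r; apply: IanD => //; apply: IanZ. Qed.

Lemma Ian_sum I (r : seq I) (P : pred I) (f : I -> O) :
  (forall i, P i -> Ian (f i)) -> Ian (\sum_(i <- r | P i) f i).
Proof. by move=> h; elim/big_rec: _ => [|i x Pi hx]; [exact: Ian0 | apply: IanD => //; apply: h]. Qed.

Lemma Ian_tay h H : tay h H -> Ian h -> ideal2 FA FB H.
Proof.
move=> th [a [b [ha hb e]]]; have [Fa ta] := tay_exists ha; have [Fb tb] := tay_exists hb.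
have := tayD (tayM ta tA) (tayM tb tB) => /(tay_geq (geq_sym e)) th'.
by exists Fa, Fb; apply: tay_uniq th th'.
Qed.

(** Formal cofactors need not converge, but truncating them gives polynomials and changes H only in
    order at least N. *)
Lemma ideal_approx N H : ideal2 FA FB H -> exists g G, [/\ Ian g, tay g G & word 1 1 N (H - G)].
Proof.
move=> [a [b ->]]; exists (pf (ser_poly N a) * A + pf (ser_poly N b) * B), (trc N a * FA + trc N b * FB); split.
- exists (pf (ser_poly N a)), (pf (ser_poly N b)); split; [exact: hol_pf | exact: hol_pf | exact: geq_refl].
- exact: tayD (tayM (tay_trc N a) tA) (tayM (tay_trc N b) tB).
have -> : a * FA + b * FB - (trc N a * FA + trc N b * FB) = FA * (a - trc N a) + FB * (b - trc N b) by ring.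
by apply: wordD; apply: wordMl; exact: word_trc.
Qed.

Lemma hol_wm k i : hol (wm k i). Proof. exact: tay_hol (tay_wm k i). Qed.

Lemma mN_wm k i : (i <= k)%N -> mN k (wm k i).
Proof.
move=> ik; apply/(tay_word k (tay_wm k i)).
by have := @word_mono C 1 1 i (k - i); rewrite !muln1 subnKC.
Qed.

Lemma analytic_nakayama k :
  (forall i, (i < k.+1)%N -> exists2 u, mN k.+1 u & Ian (wm k i - u)) ->
  forall h, mN k h -> Ian h.
Proof.
move=> hk h; rewrite -[k in mN k]addn0 => /mN_decomp [r hr e].
apply: Ian_geq (geq_sym e) _; apply: Ian_sum => i _; apply: IanM; first exact: hr.
move: (ltn_ord i); move: (nat_of_ord i) => {}i ik.
apply: (@nakayama_elim O hol (@mN R 1) Ian Ian0 IanD IanM _ _ _ _ _ _ k.+1 (wm k) _ _ i ik) => {i ik}.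
- by apply: holN; exact: hol1.
- exact: holM.
- by move=> a; apply: mN_hol.
- exact: mND.
- by move=> a b; apply: mNMl.
- move=> a ma; have a0 : (1 - a) 0 != 0 by rewrite -[(1 - a) 0]/(1 - a 0) (mN1_at0 ma) subr0 oner_neq0.
  have [hg e'] := hol_inv (holB (hol1 R) (mN_hol ma)) a0.
  exists (fun z => ((1 - a) z)^-1) => // w hw.
  apply: Ian_geq Ian0; apply: near0S e' => z ez.
  by rewrite -[RHS]/(w z - ((1 - a) z)^-1 * (1 - a) z * w z) ez mul1r subrr.
- by move=> i; exact: hol_wm.
- move=> i ik; have [u mu Iu] := hk i ik.
  have /mN_decomp [M hM eM] : mN (k + 1) u by rewrite addn1.
  exists M => //.
  exact: Ian_geq (geqB (geq_refl _) eM) Iu.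
Qed.

(** Degree n monomials lie in the formal ideal, hence in the holomorphic one modulo the next power
    of the maximal ideal; Nakayama removes the error without any convergence argument. *)
Lemma formal_finite n : cd FA FB n -> forall h, mN n h -> Ian h.
Proof.
move=> hc; apply: analytic_nakayama => i ik.
have hw : word 1 1 n (mono C i (n - i)).
  by have := @word_mono C 1 1 i (n - i); rewrite !muln1 subnKC.
have [g [G [Ig tg wG]]] := ideal_approx n.+1 (cd_adic hc hw).
exists (wm n i - g); last by rewrite subKr.
exact/(tay_word _ (tayB (tay_wm n i) tg)).
Qed.

(* The images of the powers of the maximal ideal in the finite-dimensional quotient
   form a stationary chain. *)
Lemma analytic_finite n (e : 'I_n -> O) : (forall i, hol (e i)) ->
  (forall h, hol h -> exists c : 'I_n -> C, Ian (h - \sum_(i < n) c i *: e i)) ->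
  exists k, forall h, mN k h -> Ian h.
Proof.
move=> he hh.
pose S k (c : 'rV[C]_n) := exists2 h, mN k h & Ian (h - \sum_(i < n) c 0 i *: e i).
have sub k : subspace (S k).
  split.
    exists 0; first exact: mN0.
    by rewrite big1 ?subr0; [exact: Ian0 | move=> i _; rewrite mxE scale0r].
  move=> x u v [f hf If] [g hg Ig]; exists (x *: f + g).
    by apply: mND => //; exact: (mNMl (hol_cst x) hf).
  have -> : x *: f + g - \sum_(i < n) (x *: u + v) 0 i *: e i =
     x *: (f - \sum_(i < n) u 0 i *: e i) + (g - \sum_(i < n) v 0 i *: e i); last by apply: IanD => //; apply: IanZ.
  rewrite scalerBr scaler_sumr addrACA -opprD -big_split /=; congr (_ - _).
  by apply: eq_bigr => i _; rewrite !mxE scalerDl scalerA.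
have /choice [M hM] := fun k => subspace_rV (sub k).
have Mle k : (M k.+1 <= M k)%MS.
  apply/row_subP => i; apply/hM; have /hM [h mh Ih] := row_sub i (M k.+1).
  by exists h => //; apply: mNS.
have [k hk] : exists k, (M k <= M k.+1)%MS.
  apply: contrapT => hn.
  have hr k : (\rank (M k) + k <= n)%N.
    elim: k => [|k ih]; first by rewrite addn0 rank_leq_row.
    have := mxrank_leqif_sup (Mle k) => -[r1 r2].
    have : \rank (M k.+1) != \rank (M k) by rewrite r2; apply/negP => hk; apply: hn; exists k.
    lia.
  by have := hr n.+1; lia.
exists k; apply: analytic_nakayama => i ik.
have [c hc] := hh _ (hol_wm k i).
have ce : \sum_(i < n) (\row_j c j : 'rV[C]_n) 0 i *: e i = \sum_(i < n) c i *: e i.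
  by apply: eq_bigr => l _; rewrite mxE.
have Sc : S k (\row_i c i).
  exists (wm k i); first exact: mN_wm.
  by rewrite ce.
have /hM [u mu Iu] : (\row_i c i <= M k.+1)%MS by apply: submx_trans hk; apply/hM.
exists u => //; move: Iu; rewrite ce => Iu; have := IanB hc Iu.
by rewrite opprB addrA subrK.
Qed.

Section Finite.
Variable k : nat.
Hypothesis fin : forall h, mN k h -> Ian h.

Lemma finite_word H : word 1 1 k H -> ideal2 FA FB H.
Proof.
move=> /word1_decomp [r [-> _]].
elim/big_ind: _ => [|F G|i _]; first by exists 0, 0; rewrite !mul0r addr0.
  exact: ideal2D.
rewrite mulrC; apply: ideal2M; apply: Ian_tay (tay_wm k i) _; apply: fin; apply: mN_wm.
by rewrite -ltnS.
Qed.

(** Both ideals contain everything of order k, so an approximation of the formal cofactors to that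
    order decides membership. *)
Lemma finite_ideal h H : tay h H -> Ian h <-> ideal2 FA FB H.
Proof.
move=> th; split=> [|hI]; first exact: Ian_tay.
have [g [G [Ig tg wG]]] := ideal_approx k hI.
rewrite -(subrK g h); apply: IanD => //; apply: fin.
exact/(tay_word _ (tayB th tg)).
Qed.

Lemma ideal_congr F G : word 1 1 k (F - G) -> ideal2 FA FB F <-> ideal2 FA FB G.
Proof.
move=> /finite_word h; have sI := ideal2_subspace FA FB; split=> hI.
  by rewrite -[G](subKr F); apply: subspaceB.
by rewrite -[F](subrK G); apply: subspaceD.
Qed.

(** A formal basis is replaced by its jets, which are polynomials and so germs; a basis of germs is
    replaced by its Taylor series. *)
Lemma finite_transfer n : cd FA FB n <-> exists e : 'I_n -> O, (forall i, hol (e i)) /\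
  forall h, hol h -> exists! c : {ffun 'I_n -> C}, Ian (h - \sum_(i < n) c i *: e i).
Proof.
have ex_uniq (P Q : {ffun 'I_n -> C} -> Prop) : (forall c, P c <-> Q c) -> (exists! c, P c) -> exists! c, Q c.
  by move=> PQ [c [/PQ hc u]]; exists c; split=> // d /PQ; apply: u.
rewrite /cd codimP; last exact: ideal2_subspace.
split=> [[e he]|[e [holE he]]].
- exists (fun i => pf (ser_poly k (e i))); split=> [i|h hh]; first exact: hol_pf.
  have [H tH] := tay_exists hh.
  apply: ex_uniq (he H) => c.
  rewrite (finite_ideal (tayB tH (tay_sum c (fun i => tay_trc k (e i))))).
  apply: ideal_congr; rewrite opprB addrC addrA subrK -opprB -sumrB; apply: wordN.
  by apply: word_sum => i _; rewrite -scalerBr; apply: wordZ; exact: word_trc.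
- have /choice [E tE] := fun i => tay_exists (holE i).
  exists E => H; apply: ex_uniq (he _ (hol_pf (ser_poly k H))) => c.
  rewrite (finite_ideal (tayB (tay_trc k H) (tay_sum c tE))).
  apply: ideal_congr; rewrite opprB addrA subrK -opprB; apply: wordN; exact: word_trc.
Qed.

End Finite.
End Transfer.

Section MilnorNumber.
Variable R : realType.
Local Notation C := R[i].
Local Notation O := (C * C -> C).
Local Opaque dx dy.

Lemma milnor_numberE (f : O) n : milnor_number f n <-> exists e : 'I_n -> O, (forall i, holomorphic_germ (e i)) /\
  forall h, holomorphic_germ h -> exists! c : {ffun 'I_n -> C}, Ian (dx f) (dy f) (h - \sum_(i < n) c i *: e i).
Proof.
have E (h : O) (e : 'I_n -> O) (c : 'I_n -> C) : Ian (dx f) (dy f) (h - \sum_(i < n) c i *: e i) <->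
    in_jacobian_ideal f (fun z => h z - \sum_(i < n) c i * e i z).
  have -> : h - \sum_(i < n) c i *: e i = (fun z => h z - \sum_(i < n) c i * e i z).
    apply/funext => z; rewrite -[LHS]/(h z - (\sum_(i < n) c i *: e i) z) fct_sumE.
    by congr (_ - _); apply: eq_bigr.
  by split=> H; exact: H.
split=> -[e [he hh]]; exists e; split=> // h /hh [c [hc u]]; exists c; split.
- by apply/E.
- by move=> d /E; apply: u.
- by apply/E.
- by move=> d /E; apply: u.
Qed.

(** Each direction supplies its own finiteness: [analytic_finite] from a basis of germs,
    [formal_finite] from the formal codimension. *)
Theorem milnor_cd (f : O) F n : tay f F -> milnor_number f n <-> cd (dX F) (dY F) n.
Proof.
move=> tf; have tA := tay_dx tf; have tB := tay_dy tf; rewrite milnor_numberE; split.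
  move=> [e [he hh]].
  have [|k hk] := @analytic_finite R (dx f) (dy f) n e he.
    by move=> h hol_h; have [c [hc _]] := hh h hol_h; exists c.
  by apply/(finite_transfer tA tB hk); exists e.
by move=> hc; apply/(finite_transfer tA tB (formal_finite tA tB hc)).
Qed.

End MilnorNumber.

(** * Jumps *)

Section Numerics.

Lemma mul_pred m n : (0 < m)%N -> (0 < n)%N -> ((m - 1) * (n - 1) + m + n = m * n + 1)%N.
Proof. by case: m n => [|m] [|n] // _ _; rewrite !subn1 /= mulSn mulnS; lia. Qed.

Lemma add_le_mul k n : (0 < k)%N -> (0 < n)%N -> (k + n <= k * n + 1)%N.
Proof.
case: k => // k _ n0; rewrite mulSn; have : (k <= k * n)%N by rewrite leq_pmulr.
lia.
Qed.

(* The hypotheses on m, e, a, b are those provided by milnor_bound; the conclusions say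
   that the jump (p-1)(q-1) - m >= D - floor(D/p) - floor(D/q), with D = pq - e a positive
   multiple of gcd(p,q), is at least the asserted value. *)
Lemma jump_homogeneous p m e a b : (2 <= p)%N -> (e < p * p)%N -> (p %| e)%N ->
  (m + a + b + 1 <= e)%N -> (e <= (a + 1) * p)%N -> (e <= (b + 1) * p)%N ->
  (m + (p - 2) <= (p - 1) * (p - 1))%N.
Proof.
move=> p2 ep /dvdnP [k ek]; rewrite ek => h1 h2 h3.
have kp : (k < p)%N by rewrite -(@ltn_pmul2r p) -?ek //; lia.
have ka : (k <= a + 1)%N by rewrite -(@leq_pmul2r p) //; lia.
have kb : (k <= b + 1)%N by rewrite -(@leq_pmul2r p) //; lia.
nia.
Qed.

(** With q = rp and D = k'p the jump is at least k'(p-1) - c, where c <= k'/r. Since r >= 2, c <= k'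
    - 1 <= (k'-1)(p-1), which leaves p - 1. *)
Lemma jump_divides p q m e a b : (2 <= p)%N -> (p < q)%N -> (p %| q)%N -> (e < p * q)%N -> (p %| e)%N ->
  (m + a + b + 1 <= e)%N -> (e <= (a + 1) * p)%N -> (e <= (b + 1) * q)%N ->
  (m + (p - 1) <= (p - 1) * (q - 1))%N.
Proof.
move=> p2 pq /dvdnP [r qr] ep /dvdnP [k ek]; rewrite ek => h1 h2 h3.
have p0 : (0 < p)%N by lia.
have r2 : (2 <= r)%N by case: r qr => [|[|r]] // qr; rewrite qr in pq; lia.
have kq : (k < q)%N by rewrite -(@ltn_pmul2r p) // -ek mulnC.
have ka : (k <= a + 1)%N by rewrite -(@leq_pmul2r p).
have kb : (k <= (b + 1) * r)%N by rewrite -(@leq_pmul2r p) // -mulnA -qr.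
pose c := (p - (b + 1))%N; pose k' := (q - k)%N.
have cr : (c * r <= k')%N by rewrite /c /k' mulnBl; lia.
have c2 : (c * 2 <= k')%N by apply: leq_trans cr; rewrite leq_mul2l r2 orbT.
have ck : (c <= (k' - 1) * (p - 1))%N.
  apply: (@leq_trans (k' - 1)); first by rewrite /k' in c2 *; lia.
  by rewrite leq_pmulr //; lia.
have cb : (p <= b + 1 + c)%N by rewrite /c; lia.
have [k'0 E] : (0 < k')%N /\ q = (k + k')%N by rewrite /k'; lia.
move: ck; rewrite mulnBl mul1n mulnBr muln1 => ck.
have Eq : ((p - 1) * (q - 1) = k * p + k' * p + 1 - p - q)%N.
  by rewrite mulnBl mul1n mulnBr muln1 E; lia.
have kp' : (k' <= k' * p)%N by rewrite leq_pmulr.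
have kp'' : (p <= k' * p)%N by rewrite leq_pmull.
have := add_le_mul k'0 p0; lia.
Qed.

(** With p = p'g, q = q'g and D = k'g, the two floors are at most k'/p' and k'/q'. Here p' >= 2
    because p does not divide q, and q' > p', so they sum to at most k'/2 + k'/3, hence to at most
    k' - 1 <= (k'-1)g. *)
Lemma jump_not_divides p q m e a b : (2 <= p)%N -> (p <= q)%N -> ~~ (p %| q)%N -> (e < p * q)%N ->
  (gcdn p q %| e)%N -> (m + a + b + 1 <= e)%N -> (e <= (a + 1) * p)%N -> (e <= (b + 1) * q)%N ->
  (m + gcdn p q <= (p - 1) * (q - 1))%N.
Proof.
move=> p2 pq npq; set g := gcdn p q => ep ge h1 h2 h3.
have g0 : (0 < g)%N by rewrite gcdn_gt0; lia.
have /dvdnP [p' Ep] : (g %| p)%N by exact: dvdn_gcdl.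
have /dvdnP [q' Eq] : (g %| q)%N by exact: dvdn_gcdr.
have /dvdnP [k Ek] := ge.
have p'2 : (2 <= p')%N.
  case: p' Ep => [|[|p']] // Ep; first by rewrite Ep in p2.
  by case/negP: npq; rewrite Ep mul1n dvdn_gcdr.
have pq' : (p < q)%N by rewrite ltn_neqAle pq andbT; apply: contraNneq npq => ->.
have q'3 : (3 <= q')%N by have : (p' < q')%N by [rewrite -(@ltn_pmul2r g) // -Ep -Eq]; lia.
have kpq : (k < p' * q)%N by rewrite -(@ltn_pmul2r g) // -Ek mulnAC -Ep.
pose k' := (p' * q - k)%N.
have ka : (k <= (a + 1) * p')%N by rewrite -(@leq_pmul2r g) // -Ek -mulnA -Ep.
have kb : (k <= (b + 1) * q')%N by rewrite -(@leq_pmul2r g) // -Ek -mulnA -Eq.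
pose c1 := (q - (a + 1))%N; pose c2 := (p - (b + 1))%N.
have E' : (p' * q = p * q')%N by rewrite Ep Eq mulnA mulnAC.
have l1 : (c1 * p' <= k')%N by rewrite /c1 /k' mulnBl [(q * p')%N]mulnC; lia.
have l2 : (c2 * q' <= k')%N by rewrite /c2 /k' E' mulnBl; lia.
have m1 : (c1 * 2 <= k')%N by apply: leq_trans l1; rewrite leq_mul2l p'2 orbT.
have m2 : (c2 * 3 <= k')%N by apply: leq_trans l2; rewrite leq_mul2l q'3 orbT.
have k'0 : (0 < k')%N by rewrite /k'; lia.
have cc : (c1 + c2 <= k' - 1)%N by lia.
have gk : (k' - 1 <= (k' - 1) * g)%N by rewrite leq_pmulr.
have EE : (p * q = k * g + k' * g)%N by rewrite -mulnDl /k' subnKC ?(ltnW kpq) // mulnAC -Ep.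
have q1 : (q <= a + 1 + c1)%N by rewrite /c1; lia.
have q2 : (p <= b + 1 + c2)%N by rewrite /c2; lia.
have Eprod : ((p - 1) * (q - 1) + p + q = p * q + 1)%N.
  by apply: mul_pred; lia.
move: gk cc; rewrite mulnBl mul1n => gk cc.
have : (g <= k' * g)%N by rewrite leq_pmull.
lia.
Qed.

Lemma exponents_not_divides p q : (2 <= p)%N -> (p <= q)%N -> ~~ (p %| q)%N ->
  exists a b, [/\ (0 < a)%N, (0 < b)%N & (a * q + b * p = p * q - gcdn p q)%N].
Proof.
move=> p2 pq npq; set g := gcdn p q.
have g0 : (0 < g)%N by rewrite gcdn_gt0; lia.
have /dvdnP [p' Ep] : (g %| p)%N by exact: dvdn_gcdl.
have /dvdnP [q' Eq] : (g %| q)%N by exact: dvdn_gcdr.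
have p'2 : (2 <= p')%N.
  case: p' Ep => [|[|p']] // Ep; first by rewrite Ep in p2.
  by case/negP: npq; rewrite Ep mul1n dvdn_gcdr.
have q'2 : (2 <= q')%N by have : (p' <= q')%N by [rewrite -(@leq_pmul2r g) // -Ep -Eq]; lia.
have cop : gcdn p' q' = 1%N.
  by apply/eqP; rewrite -(@eqn_pmul2r g) // mul1n muln_gcdl -Ep -Eq.
(* Bezout gives 1 + a q' = c p', that is aq + g = cp; then b = q - c works. *)
have [a ap] := @Bezoutl p' q' (ltnW p'2); rewrite cop => /dvdnP [c hc].
have a0 : (0 < a)%N.
  by case: a ap hc => // _; rewrite mul0n addn0 => hc; have : (p' %| 1)%N by [rewrite hc dvdn_mull]; rewrite dvdn1; lia.
have cq : (c < q)%N.
  rewrite -(@ltn_pmul2r p') ?(ltnW p'2) // -hc.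
  apply: (@leq_ltn_trans (1 + (p' - 1) * q')%N); first by rewrite leq_add2l leq_mul2r; lia.
  have : (q' * p' <= q * p')%N by rewrite leq_mul2r Eq leq_pmulr ?orbT.
  by rewrite mulnBl mul1n; nia.
exists a, (q - c)%N; split => //; first by rewrite subn_gt0.
have E : (a * q' * g + g = c * p' * g)%N by rewrite -hc; ring.
have E1 : (a * q = a * q' * g)%N by rewrite {1}Eq mulnA.
have E2 : (c * p = c * p' * g)%N by rewrite {1}Ep mulnA.
have E3 : (c * p <= q * p)%N by rewrite leq_mul2r ltnW ?orbT.
have E4 : (p * q = q * p)%N by rewrite mulnC.
rewrite mulnBl; lia.
Qed.

End Numerics.

(** * Application to the given polynomial *)

Section QuasihomogeneousSingularity.
Variable R : realType.
Local Notation C := R[i].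
Local Notation O := (C * C -> C).
Local Notation pf := (@poly_fun R).
Local Opaque dx dy.
Implicit Types (P : {poly {poly C}}) (z : C * C).

Lemma pfE P z : pf P z = \sum_(j < size P) \sum_(i < size P`_j) P`_j`_i * z.1 ^+ i * z.2 ^+ j.
Proof.
rewrite /poly_fun (horner_coef P) horner_sum; apply: eq_bigr => j _.
rewrite hornerM -polyC_exp hornerC horner_coef mulr_suml.
by apply: eq_bigr.
Qed.

Lemma pf_scale w1 w2 N P (t u v : C) : (forall i j, P`_j`_i != 0 -> (i * w1 + j * w2 = N)%N) ->
  pf P (t ^+ w1 * u, t ^+ w2 * v) = t ^+ N * pf P (u, v).
Proof.
move=> h; rewrite !pfE mulr_sumr; apply: eq_bigr => j _; rewrite mulr_sumr; apply: eq_bigr => i _ /=.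
have [->|/h <-] := eqVneq P`_j`_i 0; first by rewrite !mul0r mulr0.
by rewrite !exprMn -!exprM exprD [(w1 * i)%N]mulnC [(w2 * j)%N]mulnC; ring.
Qed.

Lemma px_at1 P : (px P).[1] = (P.[1])^`().
Proof.
elim/poly_ind: P => [|P c ih]; first by rewrite /px map_poly0 !horner0 deriv0.
have -> : px (P * 'X + c%:P) = px P * 'X + c^`()%:P.
  apply/polyP => j; rewrite coef_map_id0 ?deriv0 // !coefD !coefMX !coefC derivD.
  by case: j => [|j] /=; rewrite ?deriv0 // coef_map_id0 // deriv0.
by rewrite !hornerE ih derivD.
Qed.

Lemma pf_at1 P u : pf P (u, 1) = P.[1].[u].
Proof. by rewrite /poly_fun /= polyC1. Qed.

Lemma near_punctured (Q : C * C -> Prop) : (\forall z \near (0 : C * C)^', Q z) ->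
  exists2 e : R, 0 < e & forall z, z != 0 -> nc z.1 < e -> nc z.2 < e -> Q z.
Proof.
move=> h; have /near0P [e e0 he] : \forall z \near (0 : C * C), z != 0 -> Q z by exact: h.
by exists e => // z z0 h1 h2; apply: he.
Qed.

Variables (p q : nat) (F : {poly {poly C}}).
Hypotheses (p2 : (2 <= p)%N) (pq : (p <= q)%N) (hx : F`_0`_p = 1) (hy : F`_q`_0 = 1).
Hypothesis hqh : quasihomogeneous F.
Hypothesis hsing : isolated_singularity (pf F).

Let p0 : (0 < p)%N. Proof. exact: ltnW. Qed.
Let q0 : (0 < q)%N. Proof. exact: leq_trans pq. Qed.

Definition coefs : ser C := fun i j => F`_j`_i.

(** The monomials x^p and y^q force p wx = W = q wy, so the weights are proportional to (q, p). *)
Lemma weights i j : F`_j`_i != 0 -> (i * q + j * p = p * q)%N.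
Proof.
have [wx [wy [W [wx0 wy0 W0 h]]]] := hqh.
have e1 : (p * wx = W)%N by rewrite -(h p 0%N) ?hx ?oner_neq0 // mul0n addn0.
have e2 : (q * wy = W)%N by rewrite -(h 0%N q) ?hy ?oner_neq0.
move=> /h e; apply/eqP; rewrite -(eqn_pmul2r wx0); apply/eqP.
have E1 : (j * (p * wx) = j * (q * wy))%N by rewrite e1 e2.
have E2 : ((i * wx + j * wy) * q = p * wx * q)%N by rewrite e e1.
nia.
Qed.

Lemma coefs_homogeneous : homogeneous q p (p * q) coefs.
Proof. exact: weights. Qed.

Lemma slice_at1 : slice p q coefs = F.[1].
Proof.
apply/polyP => i; rewrite coef_poly horner_coef coef_sum.
under eq_bigr do rewrite expr1n mulr1.
case: ltnP => hi; last first.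
  rewrite big1 // => j _; apply/eqP; apply: contraTT hi => /weights e.
  by rewrite -leqNgt -(leq_pmul2r q0); lia.
set J := (_ %/ _)%N.
have hJ j : F`_j`_i != 0 -> j = J.
  by move=> /weights e; rewrite /J mulnBl -e addKn mulnK.
have [lt|ge] := ltnP J (size F).
  rewrite (bigD1 (Ordinal lt)) //= big1 ?addr0 // => j jJ; apply/eqP; apply: contraNT jJ => /hJ e.
  exact/eqP/val_inj.
rewrite /coefs [F`_J]nth_default // coef0 big1 // => j _; apply/eqP; apply: contraTT (ltn_ord j) => /hJ ->.
by rewrite -leqNgt.
Qed.

(* A double root v of F(x, 1) makes (t^q v, t^p) a critical point for every t. *)
Lemma slice_squarefree v : root (slice p q coefs) v -> (slice p q coefs)^`().[v] != 0.
Proof.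
rewrite slice_at1 => /rootP r0; apply/eqP => r1.
have fx : pf (px F) (v, 1) = 0 by rewrite pf_at1 px_at1.
have fy : pf F^`() (v, 1) = 0.
  (* Euler's relation: at (v, 1) both F and F_x vanish, hence so does F_y. *)
  have E : (p * q)%:R%:P%:P * F = q%:R%:P%:P * 'X%:P * px F + p%:R%:P%:P * 'X * F^`().
    apply/polyP => j; apply/polyP => i.
    rewrite -[_ * 'X%:P * _]mulrA -[_ * 'X * _]mulrA coefD !coefCM coefD !coefCM !coefXM.
    have E' : (p * q)%:R * F`_j`_i = (i * q + j * p)%:R * F`_j`_i.
      by have [->|/weights ->] := eqVneq F`_j`_i 0; rewrite ?mulr0.
    rewrite E' natrD mulrDl; congr (_ + _).
      by case: i E' => [|i] _ /=; rewrite ?mul0r ?mulr0 // coef_px natrM; ring.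
    by case: j E' => [|j] _ /=; rewrite ?mul0r ?mulr0 ?coef0 ?mulr0 // coef_py natrM; ring.
  have := congr1 (fun P => pf P (v, 1)) E; rewrite pfD !pfM !pfC pfX pfY.
  rewrite -[LHS]/((p * q)%:R * pf F (v, 1)).
  rewrite -[RHS]/(q%:R * v * pf (px F) (v, 1) + p%:R * 1 * pf F^`() (v, 1)).
  rewrite fx pf_at1 r0 !mulr0 add0r mulr1 => /esym/eqP; rewrite mulf_eq0 pnatr_eq0 => /orP[/eqP|/eqP //].
  by move=> pp; move: p2; rewrite pp.
case: hsing => _ _ _ /near_punctured [e e0 he].
(* d <= 1 makes every positive power of t at most d in absolute value, and d (|v| + 1) < e puts the
   point into the given neighbourhood. *)
pose d := Num.min 2^-1 (e / (nc v + 1) / 2).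
have v1 : 0 < nc v + 1 by rewrite ltr_wpDl ?nc_ge0.
have d0 : 0 < d by rewrite lt_min invr_gt0 ltr0n /= !divr_gt0.
have d1 : d <= 1.
  have : d <= 2^-1 by rewrite ge_min lexx.
  lra.
have de : d * (nc v + 1) < e.
  have : d <= e / (nc v + 1) / 2 by rewrite ge_min lexx orbT.
  have x0 : 0 < e / (nc v + 1) by rewrite divr_gt0.
  rewrite -ltr_pdivlMr //; move: (e / _) x0 => x x0; lra.
pose t : C := d%:C.
have nt : nc t = d by rewrite ncR gtr0_norm.
have t0 : t != 0 by rewrite -nc_gt0 nt.
have tX n : (0 < n)%N -> nc (t ^+ n) <= d.
  by move=> n0; rewrite ncX nt -{2}[d]expr1 ler_wiXn2l // ltW.
have wx i j : (px F)`_j`_i != 0 -> (i * q + j * p = p * q - q)%N.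
  by rewrite coef_px mulf_eq0 negb_or => /andP[_ /weights]; nia.
have wy i j : (F^`())`_j`_i != 0 -> (i * q + j * p = p * q - p)%N.
  by rewrite coef_py mulf_eq0 negb_or => /andP[_ /weights]; nia.
have := he (t ^+ q * v, t ^+ p * 1); apply.
- rewrite mulr1; apply/eqP => -[_ /eqP]; rewrite expf_eq0 (negPf t0) andbF //.
- rewrite /= ncM; apply: le_lt_trans de; apply: ler_pM; rewrite ?nc_ge0 ?tX //.
  by rewrite lerDl.
- rewrite /= mulr1; apply: le_lt_trans (tX p p0) _; apply: le_lt_trans de.
  by rewrite ler_peMr ?lerDr ?nc_ge0 // ltW.
have [-> ->] := dxy_pf F (t ^+ q * v, t ^+ p * 1).
by rewrite (pf_scale _ _ _ wx) (pf_scale _ _ _ wy) fx fy !mulr0.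
Qed.

Lemma tay_F : tay (pf F) coefs. Proof. exact: tay_pf. Qed.

Lemma milnor_F : milnor_number (pf F) ((p - 1) * (q - 1)).
Proof. by apply/(milnor_cd _ tay_F); exact: (cd_F p2 pq hx hy coefs_homogeneous slice_squarefree). Qed.

Lemma milnor_uniq (f : O) m n : holomorphic_germ f -> milnor_number f m -> milnor_number f n -> m = n.
Proof.
move=> hf; have [G tG] := tay_exists hf.
by move=> /(milnor_cd _ tG) h1 /(milnor_cd _ tG) h2; apply: codim_uniq h1 h2.
Qed.

Lemma tay_deformation (f g : O) G H s : tay f G -> tay g H -> tay (linear_deformation f g s) (G + s *: H).
Proof. by move=> tf tg; exact: tayD tf (tayZ s tg). Qed.

(** A punctured neighbourhood contains more points d/(k+1) than P has roots; their modulus is at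
    most 1, so all positive powers stay in the neighbourhood. *)
Lemma generic_parameter (Q : C -> Prop) (P : {poly C}) : (\forall s \near (0 : C)^', Q s) -> P != 0 ->
  exists2 t, P.[t] != 0 & forall d, (0 < d)%N -> Q (t ^+ d).
Proof.
move=> /dnear_nc [e e0 he] P0.
pose d := Num.min 2^-1 (e / 2).
have d0 : 0 < d by rewrite lt_min invr_gt0 ltr0n divr_gt0.
have d1 : d <= 1.
  have : d <= 2^-1 by rewrite ge_min lexx.
  lra.
have de : d < e.
  have : d <= e / 2 by rewrite ge_min lexx orbT.
  lra.
pose t (k : nat) : C := (d / k.+1%:R)%:C.
have [/allP hall|] := boolP (all (root P) [seq t k | k <- iota 0 (size P)]).
  have := @max_poly_roots _ P [seq t k | k <- iota 0 (size P)] P0.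
  rewrite size_map size_iota ltnn => h; suff : false by []; apply: h; first exact/allP.
  rewrite map_inj_uniq ?iota_uniq // => k l /complexI /(mulfI (lt0r_neq0 d0)) /invr_inj /eqP.
  by rewrite eqr_nat => /eqP [].
rewrite -has_predC => /hasP [_ /mapP [k _ ->] /= tk]; exists (t k) => // n n0.
have k0 : 0 < k.+1%:R :> R by rewrite ltr0n.
have tp : 0 < d / k.+1%:R by rewrite divr_gt0.
have nt : nc (t k) = d / k.+1%:R by rewrite ncR gtr0_norm.
have td : d / k.+1%:R <= d by rewrite ler_pdivrMr // ler_peMr ?ler1n // ltW.
apply: he; first by rewrite expf_neq0 // -nc_gt0 nt.
rewrite subr0 ncX nt; apply: le_lt_trans de; apply: le_trans (td).
have t1 := le_trans td d1; by rewrite -{2}[d / _]expr1 ler_wiXn2l // ltW.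
Qed.

Lemma jump_bound l : (0 < l)%N -> is_linear_jump (pf F) l -> exists m e a b,
  [/\ (p - 1) * (q - 1) = m + l, e < p * q, gcdn p q %| e, m + a + b + 1 <= e &
     (e <= (a + 1) * p) && (e <= (b + 1) * q)]%N.
Proof.
move=> l0 [g [hg g0 [m0 [m [h0 hm e0]]]]].
have [G tG] := tay_exists hg.
have G0 : G 0%N 0%N = 0 by have /(tay_word 1 tG) := at0_mN1 hg g0; apply.
have m0E : m0 = ((p - 1) * (q - 1))%N by apply: milnor_uniq h0 milnor_F; exact: hol_pf.
have hyp (P : {poly C}) : P != 0 -> exists2 t, P.[t] != 0 & forall d, (0 < d)%N ->
    cd (dX (coefs + t ^+ d *: G)) (dY (coefs + t ^+ d *: G)) m.
  move=> P0; have [t Pt ht] := generic_parameter hm P0; exists t => // d /ht.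
  by move/(milnor_cd _ (tay_deformation _ tay_F tG)).
case: (milnor_bound p2 pq hx hy coefs_homogeneous slice_squarefree G0 hyp) => [|[e [a [b [h1 h2 h3 h4 h5]]]]].
  by rewrite -m0E e0; lia.
by exists m, e, a, b; rewrite h4 h5 -m0E.
Qed.

(** The bound N on the exponents makes G a polynomial, hence a holomorphic germ. *)
Lemma jump_realized N (G : ser C) m k : (forall i j, ~~ ((i < N) && (j < N))%N -> G i j = 0) -> G 0%N 0%N = 0 ->
  (forall s, s != 0 -> cd (dX (coefs + s *: G)) (dY (coefs + s *: G)) m) ->
  ((p - 1) * (q - 1) = m + k)%N -> is_linear_jump (pf F) k.
Proof.
move=> hN G0 hc e; have tG : tay (pf (ser_poly N G)) G.
  have E : (fun i j => (ser_poly N G)`_j`_i) = G.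
    by apply: serP => i j; rewrite coef_ser_poly; case: ifPn => // /hN.
  by have := tay_pf (ser_poly N G); rewrite E.
exists (pf (ser_poly N G)); split; [exact: hol_pf | |].
  by rewrite pf_at0 coef_ser_poly; case: ifP.
exists ((p - 1) * (q - 1))%N, m; split => //; first exact: milnor_F.
apply/dnear_nc; exists 1 => // s s0 _.
exact/(milnor_cd _ (tay_deformation s tay_F tG))/hc.
Qed.

End QuasihomogeneousSingularity.

Theorem corollary5p3 (R : realType) (p q : nat) (F : {poly {poly R[i]}})
    (hp : (2 <= p)%N) (hpq : (p <= q)%N)
    (hx : F`_0`_p = 1) (hy : F`_q`_0 = 1)
    (hqh : quasihomogeneous F)
    (hsing : isolated_singularity (poly_fun F)) :
  (p = q ->
     lambda_lin (poly_fun F) (if p == 2%N then 1%N else (p - 2)%N)) /\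
  (p <> q ->
     lambda_lin (poly_fun F) (if (p %| q)%N then (p - 1)%N else gcdn p q)).
Proof.
have realized := jump_realized hp hpq hx hy hqh hsing.
have bound := jump_bound hp hpq hx hy hqh hsing.
have hF := coefs_homogeneous hp hpq hx hy hqh.
have sqf := slice_squarefree hp hpq hx hy hqh hsing.
split=> [pq|/eqP pq].
- subst q; split.
  + by case: eqP => // /eqP; lia.
  + have [p2|p2] := eqVneq p 2%N.
      (* F has no linear term, so f_x is s at the origin, a unit, and the Milnor number drops from 1
         to 0. *)
      subst p; apply: (realized 2%N (mono R[i] 1 0) 0%N) => // [i j|s s0].
        by rewrite monoE; case: eqP => [->|//]; case: eqP => [->|].
      apply: cd_one.
      have [|g hg] := @ser_unit _ (dX (coefs F + s *: mono R[i] 1 0)).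
        rewrite /dX serD serZ monoE /= mulr1 mul1r.
        suff -> : coefs F 1%N 0%N = 0 by rewrite add0r.
        by apply/eqP; apply: contraTT isT => /hF.
      by exists g, 0; rewrite hg mul0r addr0.
    have [n pn] : exists n, p = n.+3 by exists (p - 3)%N; lia.
    subst p; have [w hw] := cd_linear_factor hx hy hF sqf.
    apply: (realized n.+3 _ _ _ _ _ hw).
    * by move=> i j hij; rewrite /form; case: eqP => // e; lia.
    * by rewrite /form; case: eqP => // e; lia.
    * by rewrite subnK //; nia.
  + move=> l l0 hl; have [m [e [a [b [h1 h2 h3 h4 /andP[h5 h6]]]]]] := bound l l0 hl.
    (* For p = 2 the lower bound is just l > 0. *)
    case: eqP => // _; rewrite gcdnn in h3.
    by have := jump_homogeneous hp h2 h3 h4 h5 h6; lia.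
- have {}pq : (p < q)%N by rewrite ltn_neqAle pq.
  have g0 : (0 < gcdn p q)%N by rewrite gcdn_gt0; lia.
  split.
  + by case: ifP => _ //; lia.
  + case: ifPn => pdq.
      apply: (realized q (mono R[i] 0 (q - 1)) ((p - 1) * (q - 2))%N).
      * by move=> i j hij; rewrite monoE; case: eqP => // ?; case: eqP => // ?; lia.
      * by rewrite monoE; case: eqP => // ?; case: eqP => // ?; lia.
      * by move=> s s0; apply: cd_divides.
      * by rewrite -mulnSr; congr (_ * _)%N; lia.
    have [a [b [a0 b0 ab]]] := exponents_not_divides hp hpq pdq.
    apply: (realized (a + b).+1 (mono R[i] a b) ((p - 1) * (q - 1) - gcdn p q)%N).
    * by move=> i j hij; rewrite monoE; case: eqP => // ?; case: eqP => // ?; lia.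
    * by rewrite monoE; case: eqP => // e; lia.
    * by move=> s s0; apply: cd_not_divides.
    * rewrite subnK //; apply: (@leq_trans (p - 1)); last by rewrite leq_pmulr; lia.
      have gp : (gcdn p q <= p)%N by rewrite dvdn_leq ?dvdn_gcdl; lia.
      have : gcdn p q != p by apply: contraNneq pdq => <-; exact: dvdn_gcdr.
      lia.
  + move=> l l0 hl; have [m [e [a [b [h1 h2 h3 h4 /andP[h5 h6]]]]]] := bound l l0 hl.
    case: ifPn => pdq.
      have gp : gcdn p q = p by apply/gcdn_idPl.
      by rewrite gp in h3; have := jump_divides hp pq pdq h2 h3 h4 h5 h6; lia.
    by have := jump_not_divides hp hpq pdq h2 h3 h4 h5 h6; lia.
Qed.
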